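(* Let $\mathbb{L}=\mathbb{Z}^-=\{\ldots,-2,-1,0\}$, $\Omega=\{-1,1\}^{\mathbb{L}}$, and for $p\in\mathbb{R}$ consider the power-law Ising ferromagnet LSS $f=f^{\beta}$ with couplings $J(i,j)=|i-j|^{-p}$, $i\neq j\in\mathbb{L}$, at inverse temperature $\beta>0$. It is well defined (i.e. $\sum_{j\neq i}|J(i,j)|<\infty$ for each $i\in\mathbb{L}$) if and only if $p>1$. Furthermore, for $p>1$: (i) $|\mathcal{G}(f)|=1$ at high temperature (i.e. for all sufficiently small $\beta>0$), or at all temperatures (all $\beta>0$) if $p>2$. (ii) If $1<p<2$, then $|\mathcal{G}(f)|>1$ at low temperature (i.e. for all sufficiently large $\beta$).
   Context: $\Omega=\{-1,1\}^{\mathbb{L}}$ carries the product topology and product $\sigma$-algebra $\mathcal F$; $\mathcal{F}_{\le i}$ is generated by coordinates $\le i$. $\omega_k^n=\omega_{[k,n]}$, $\Omega_k^n=\{-1,1\}^{[k,n]}$, $\omega_{-\infty}^n=\omega_{(-\infty,n]}$; juxtaposition denotes concatenation. For couplings $J(i,j)$ with $\sum_j|J(i,j)|<\infty$ for each $i$, the long-range Ising potential at inverse temperature $\beta$ is $\phi_A(\omega)=-\beta J(i,j)\omega_i\omega_j$ if $A=\{i,j\}$ with $i\neq j$, and $\phi_A=0$ for all other finite $A\subset\mathbb{L}$. The Ising LSS $f^{\beta}=\{f_i\}_{i\in\mathbb{L}}$ is the family of transition probabilities $$f_i(\omega_i\mid\omega_{-\infty}^{i-1})=\frac{\sum_{\sigma_{i+1}^0\in\Omega_{i+1}^0}\exp\big[-\sum_{A\cap[i,0]\neq\emptyset}\phi_A(\sigma_{i+1}^0\,\omega_{-\infty}^i)\big]}{\sum_{\sigma_i^0\in\Omega_i^0}\exp\big[-\sum_{A\cap[i,0]\neq\emptyset}\phi_A(\sigma_i^0\,\omega_{-\infty}^{i-1})\big]}$$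 (sums in the exponents over finite $A\subset\mathbb{L}$; for $i=0$ the numerator has the single term with configuration $\omega$). These determine probability kernels $f_i:\mathcal{F}_{\le i}\times\Omega\to[0,1]$ with $f_i(A\mid\cdot)$ $\mathcal{F}_{\le i-1}$-measurable for $A\in\mathcal{F}_{\le i}$ and $f_i(B\mid\cdot)=\mathbf{1}_B$ for $B\in\mathcal{F}_{\le i-1}$. $\mathcal{G}(f)$ is the set of probability measures $\mu$ on $(\Omega,\mathcal{F})$ with $\mu f_i=\mu$ over $\mathcal{F}_{\le i}$ for every $i\in\mathbb{L}$, where $(\mu f_i)(h)=\int f_i(h\mid\omega)\,\mu(d\omega)$. *)

(* Defs.v *)
From HB Require Import structures.
From mathcomp Require Import all_boot all_order all_algebra finmap.
From mathcomp Require Import all_classical all_reals all_analysis.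

Set Implicit Arguments.
Unset Strict Implicit.
Unset Printing Implicit Defensive.

Import Order.TTheory GRing.Theory Num.Theory.
Import numFieldNormedType.Exports.

Local Open Scope classical_set_scope.
Local Open Scope ring_scope.

(* The natural number [k] stands for the site [-k] of Z^- = {..., -2, -1, 0}.
   The order is thereby reversed: the interval [i, 0] of sites is
   {k | k <= i}, the past (-oo, i] is {k | i <= k}, and the site to the right of
   [i] is coded by [i.-1]. Distances between sites are unchanged. *)
Definition site := nat.

(* [true] codes the spin +1 and [false] the spin -1, see [spin]. *)
Definition config := site -> bool.

Definition past_cylinders (i : site) : set (set config) :=
  [set A | exists k b, (i <= k)%N /\ A = [set w : config | w k = b]].

(* Every coordinate belongs to the past of site 0, so this is {-1,1}^L with its
   product sigma-algebra. *)
Definition Omega := g_sigma_algebraType (past_cylinders 0).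

(* The sigma-algebra generated by the coordinates in (-oo, i]. *)
Definition past (i : site) : set (set Omega) := <<s past_cylinders i >>.

Definition set_spin (i : site) (b : bool) (w : Omega) : Omega :=
  fun k => if k == i then b else w k.

(* The configuration equal to [s] on the [n] rightmost sites, coded 0, ..., n-1,
   and to [w] on all the other ones. *)
Definition concat (n : nat) (s : {ffun 'I_n -> bool}) (w : Omega) : Omega :=
  fun k => if insub k is Some o then s o else w k.

Section LSS.
Variable R : realType.

Definition spin (b : bool) : R := if b then 1 else -1.

(* Transition probabilities [f i w] = f_i(w_i | w_{-oo}^{i-1}). The resulting
   kernel, defined for [A] in [past i], redraws the spin at [i]; a member of
   [past i] does not depend on the spins to the right of [i]. *)
Definition lss_kernel (f : site -> Omega -> R) (i : site) (A : set Omega)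
    (w : Omega) : R :=
  \sum_(b : bool) f i (set_spin i b w) * \1_A (set_spin i b w).

Definition consistent (f : site -> Omega -> R) : set (probability Omega R) :=
  [set mu | forall (i : site) (A : set Omega), past i A ->
     (\int[mu]_w (lss_kernel f i A w)%:E)%E = mu A].

(* A [probability] is a function on all sets of configurations, which is
   unconstrained on the nonmeasurable ones: two of them are the same probability
   measure when they agree on measurable sets. *)
Definition same_law (mu nu : probability Omega R) : Prop :=
  forall A : set Omega, measurable A -> mu A = nu A.

Definition exactly_one_law (M : set (probability Omega R)) : Prop :=
  exists2 mu, M mu & forall nu, M nu -> same_law mu nu.

Definition more_than_one_law (M : set (probability Omega R)) : Prop :=
  exists mu nu, [/\ M mu, M nu & ~ same_law mu nu].

Definition summable_couplings (J : site -> site -> R) : Prop :=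
  forall i, summable [set j | j != i] (fun j => (J i j)%:E).

(* [J] is meant to be symmetric, so that the order in which the two elements of
   [A] are enumerated is irrelevant. *)
Definition ising_potential (J : site -> site -> R) (beta : R)
    (A : {fset site}) (w : Omega) : R :=
  if enum_fset A is [:: i; j] then - beta * J i j * spin (w i) * spin (w j)
  else 0.

(* Sum of phi_A(w) over the finite sets A meeting [i, 0]: an unordered sum of
   signed terms, absolutely convergent for summable couplings. *)
Definition ising_energy (J : site -> site -> R) (beta : R) (i : site)
    (w : Omega) : R :=
  let D := [set A : {fset site} | exists2 k, k \in A & (k <= i)%N] in
  let phi := fun A : {fset site} => (ising_potential J beta A w)%:E in
  fine (esum D phi^\+ - esum D phi^\-)%E.

(* The numerator sums over the configurations on the sites strictly to the right
   of [i], of which there are [i] in this coding, and the denominator over those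
   on the interval [i, 0]. *)
Definition ising_lss (J : site -> site -> R) (beta : R) (i : site)
    (w : Omega) : R :=
  (\sum_(s : {ffun 'I_i -> bool}) expR (- ising_energy J beta i (concat s w)))
  / (\sum_(s : {ffun 'I_i.+1 -> bool})
       expR (- ising_energy J beta i (concat s w))).

(* The power law |i - j|^{-p}, only used for [i != j]. *)
Definition power_law (p : R) (i j : site) : R :=
  `| i%:R - j%:R | `^ (- p).

End LSS.

(* Main.v *)
Require Import Defs.
From HB Require Import structures.
From mathcomp Require Import all_boot all_order all_algebra finmap.
From mathcomp Require Import all_classical all_reals all_analysis.
From mathcomp Require Import measurable_realfun ring lra zify.

(** The site coded by k is -k, and the past of a site consists of the larger codes.
Writing [energy n] for the sum of all interactions that touch the n rightmost
sites, the transition probability at i is the marginal at i of the Gibbs kernel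
[gibbs i.+1] on the i+1 rightmost sites, because [weight i.+1] is [weight i]
times a factor that only depends on the past.  Hence the consistent laws are
the laws that every [gibbs n] preserves on quasi-local functions
([consistent_quasi_local], [quasi_local_consistent]).  Such laws exist: an
ultrafilter limit of [gibbs n] with a fixed exterior gives consistent finite
dimensional distributions, which a binary expansion of a uniform variable
realizes ([extension_ex], [gibbs_limit]).

Summability is the convergence of the series of d^-p.

Uniqueness follows when the dependence of [gibbs n] on its exterior vanishes as
n grows ([exactly_one_of_osc]).  If p > 2, the total interaction across the
boundary of an interval is bounded uniformly in the interval, so that any two
exteriors give comparable Gibbs measures, and each enlargement of the interval
contracts oscillations by a fixed factor ([gibbs_contract],
[unique_if_boundary_bounded]).  If beta is small, Dobrushin's comparison applies
in finite volume: resampling one spin replaces the sensitivity at its site by an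
average, with total mass less than 1, of the sensitivities at the other sites
([estimate_update], [unique_if_small_beta]).

Non-uniqueness for 1 < p < 2 is shown by bounding the magnetization at the
origin from below, uniformly in the interval, under the exterior made of + spins.
The Griffiths inequalities, proved by Ginibre's duplication, allow one to replace
each interaction exp(K s_x s_y) by the mixture of no interaction, with probability
1 - tanh K, and of the constraint s_x = s_y, with probability tanh K
([wmean_edge]): correlations can only decrease.  The Ising model thereby
dominates a percolation model, for which a renormalization argument works
([giant_cluster_level]).  A block of K^(N+1) sites consists of K blocks of K^N
sites; if all of these but one contain a cluster of (K-1)^N aligned sites, and
these clusters get connected to each other, then the large block contains a
cluster of (K-1)^(N+1) sites.  Two clusters interact with strength at least
beta (K-1)^(2N) K^(-p(N+1)), which grows geometrically in N when K^(2-p) is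
large: this is where p < 2 is used.  The failure probabilities are then of order
2^-N / beta, and the cluster of the origin reaches every scale with probability at
least 1/2 when beta is large; at each scale, it interacts with the + exterior
with strength at least beta 2^-p. *)

Set Implicit Arguments.
Unset Strict Implicit.
Unset Printing Implicit Defensive.

Import Order.TTheory GRing.Theory Num.Theory.
Import numFieldNormedType.Exports.

Local Open Scope classical_set_scope.
Local Open Scope ring_scope.

Lemma powR_exprn (R : realType) (a p : R) (n : nat) :
  0 <= a -> (a ^+ n) `^ p = (a `^ p) ^+ n.
Proof.
move=> a0; elim: n => [|n IH]; first by rewrite !expr0 powR1.
by rewrite !exprS powRM ?exprn_ge0 // IH.
Qed.

(** * Ginibre positivity and the Griffiths inequalities *)

Section Ferromagnets.
Variables (R : realType) (T : finType).
Notation conf := {ffun T -> bool}.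
Implicit Types (s : conf) (l : seq T) (H W : conf -> R).
Notation spin := (@spin R).

(** Products of spins are indexed by lists rather than by sets: multiplying two
of them amounts to concatenating the lists, and repetitions are harmless. *)
Definition spin_prod l s : R := \prod_(x <- l) spin (s x).

(** The change of variable between two copies of a spin system: the product of
the spins of [s] and of [spin_xor s t] is the spin of [t]. *)
Definition spin_xor (s t : conf) : conf := [ffun x => s x == t x :> bool].

Lemma spin_eqb a b : spin (a == b) = spin a * spin b.
Proof. by case: a; case: b; rewrite /Defs.spin /= ?mulr1 ?mul1r ?mulrNN ?mulr1. Qed.

Lemma spin_prod_xor l s t : spin_prod l (spin_xor s t) = spin_prod l s * spin_prod l t.
Proof.
rewrite /spin_prod -big_split; apply: eq_bigr => x _.
by rewrite ffunE spin_eqb.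
Qed.

Lemma spin_xorK s : involutive (spin_xor s).
Proof. by move=> t; apply/ffunP => x; rewrite !ffunE; case: (s x); case: (t x). Qed.

Lemma spin_prod_pm l s : spin_prod l s = 1 \/ spin_prod l s = -1.
Proof.
rewrite /spin_prod; elim: l => [|x l IH]; first by left; rewrite big_nil.
rewrite big_cons; case: IH => ->; case: (s x);
  rewrite /Defs.spin ?mul1r ?mulN1r ?opprK; auto.
Qed.

(** The sum factorizes over the sites; at each site it is the sum of an even or
odd power of the two spins, that is 2 or 0. *)
Lemma sum_spin_prod_ge0 l : 0 <= \sum_s spin_prod l s.
Proof.
have E s : spin_prod l s = \prod_x spin (s x) ^+ count_mem x l.
  rewrite /spin_prod; elim: l => [|x l IH]; first by rewrite big_nil big1.
  rewrite big_cons IH [RHS](bigD1 x) //= [in LHS](bigD1 x) //= eqxx add1n.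
  rewrite exprS -!mulrA; congr (_ * (_ * _)).
  by apply: eq_bigr => y ny; rewrite eq_sym (negPf ny) add0n.
under eq_bigr do rewrite E.
rewrite -(bigA_distr_bigA (fun x (b : bool) => spin b ^+ count_mem x l)).
apply: prodr_ge0 => x _; rewrite big_bool /Defs.spin expr1n.
by rewrite -signr_odd; case: odd; rewrite /= ?expr0 ?expr1; lra.
Qed.

(** Ginibre's positivity for the duplicated system: all products of sums
(coded by [false]) and differences (coded by [true]) of a spin product taken in
the two copies have a nonnegative mean.  Both Griffiths inequalities are the
cases of one and two factors. *)
Definition ginibre H := forall ls : seq (seq T * bool),
  0 <= \sum_s \sum_t (\prod_(e <- ls)
     (spin_prod e.1 s + (-1) ^+ e.2 * spin_prod e.1 t)) * (H s * H t).

(** In terms of the first copy and of the product of the two copies, the sum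
factorizes into two nonnegative sums. *)
Lemma ginibre1 : ginibre (fun=> 1).
Proof.
move=> ls.
under eq_bigr => s _.
  rewrite (reindex_inj (inv_inj (spin_xorK s))) /=.
  under eq_bigr => t _.
    rewrite !mulr1.
    under eq_bigr => e _ do rewrite spin_prod_xor mulrCA -{1}[spin_prod e.1 s]mulr1 -mulrDr.
    rewrite big_split /=.
    over.
  rewrite -mulr_sumr; over.
rewrite -mulr_suml; apply: mulr_ge0.
  rewrite (_ : \sum_ _ _ = \sum_s spin_prod (flatten (unzip1 ls)) s) ?sum_spin_prod_ge0 //.
  apply: eq_bigr => s _; elim: ls => [|e ls IH]; first by rewrite /spin_prod !big_nil.
  by rewrite big_cons IH /spin_prod /= big_cat.
apply: sumr_ge0 => t _; elim: ls => [|e ls IH]; first by rewrite big_nil.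
rewrite big_cons mulr_ge0 //.
by case: (spin_prod_pm e.1 t) => ->; case: e.2; rewrite /= ?expr0 ?expr1; lra.
Qed.

Definition ferro H := [/\ forall s, 0 <= H s, 0 < H [ffun=> true] & ginibre H].

Lemma ferro1 : ferro (fun=> 1).
Proof. by split => //; exact: ginibre1. Qed.

Lemma spin_prod_true l : spin_prod l [ffun=> true] = 1.
Proof. by rewrite /spin_prod big1 // => x _; rewrite ffunE. Qed.

Lemma eq_ferro H W : H =1 W -> ferro H -> ferro W.
Proof. by move=> /funext ->. Qed.

(** The product of a factor over both copies is a combination with nonnegative
coefficients of squares of sums and differences and of a sum, so that Ginibre's
positivity is preserved. *)
Lemma ferro_factor H a b l : ferro H -> 0 < a -> 0 <= b <= a ->
  ferro (fun s => (a + b * spin_prod l s) * H s).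
Proof.
move=> [H0 H1 gH] a0 /andP[b0 ba]; split.
- move=> s; rewrite mulr_ge0 //; case: (spin_prod_pm l s) => ->; lra.
- by rewrite spin_prod_true mulr_gt0 //; lra.
move=> ls.
pose F (ks : seq (seq T * bool)) := \sum_s \sum_t (\prod_(e <- ks)
     (spin_prod e.1 s + (-1) ^+ e.2 * spin_prod e.1 t)) * (H s * H t).
(* On both copies the factor is (a + b x) (a + b y), and 4 x y is the difference
   of the squares of x + y and x - y, which add up to 4. *)
rewrite [leRHS](_ : _ = (a ^+ 2 + b ^+ 2) / 4 * F ([:: (l, false), (l, false) & ls])
   + (a ^+ 2 - b ^+ 2) / 4 * F ([:: (l, true), (l, true) & ls])
   + a * b * F ((l, false) :: ls)).
  have F0 k : 0 <= F k by exact: gH.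
  have ab : b ^+ 2 <= a ^+ 2 by rewrite ler_sqr ?nnegrE //; lra.
  have a2 := sqr_ge0 a; have b2 := sqr_ge0 b.
  have ab0 : 0 <= a * b by rewrite mulr_ge0 // ltW.
  by apply: addr_ge0; [apply: addr_ge0|]; apply: mulr_ge0 => //; lra.
rewrite /F !mulr_sumr -!big_split; apply: eq_bigr => s _ /=.
rewrite !mulr_sumr -!big_split; apply: eq_bigr => t _ /=.
rewrite !big_cons /= expr0 expr1.
set p := \prod_(_ <- _) _.
by case: (spin_prod_pm l s) => ->; case: (spin_prod_pm l t) => ->; field.
Qed.

(** The mean under the probability proportional to the weight [H]. *)
Definition wmean H (F : conf -> R) : R := (\sum_s F s * H s) / \sum_s H s.

Lemma ferro_sum_gt0 H : ferro H -> 0 < \sum_s H s.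
Proof.
case=> H0 H1 _; rewrite (bigD1 [ffun=> true]) //=.
by rewrite ltr_wpDr // sumr_ge0.
Qed.

Lemma sum_mul_sum (F G : conf -> R) :
  \sum_s \sum_t F s * G t = (\sum_s F s) * \sum_s G s.
Proof. by rewrite big_distrlr. Qed.

Lemma griffiths1 H l : ferro H -> 0 <= wmean H (spin_prod l).
Proof.
move=> fH; have Z := ferro_sum_gt0 fH; case: fH => _ _ gH.
rewrite /wmean; apply: divr_ge0; last exact: ltW.
have := gH [:: (l, false)].
have -> : \sum_s \sum_t (\prod_(e <- [:: (l, false)])
     (spin_prod e.1 s + (-1) ^+ e.2 * spin_prod e.1 t)) * (H s * H t) =
   2 * (\sum_s spin_prod l s * H s) * \sum_s H s.
  transitivity (\sum_s \sum_t ((spin_prod l s * H s) * H t + H s * (spin_prod l t * H t))).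
    apply: eq_bigr => s _; apply: eq_bigr => t _.
    by rewrite big_seq1 /= expr0; ring.
  under eq_bigr do rewrite big_split.
  by rewrite big_split /= !sum_mul_sum; ring.
by rewrite pmulr_lge0 // pmulr_rge0.
Qed.

Lemma griffiths2 H l k : ferro H ->
  wmean H (spin_prod l) * wmean H (spin_prod k) <= wmean H (fun s => spin_prod l s * spin_prod k s).
Proof.
move=> fH; have Z := ferro_sum_gt0 fH; case: fH => _ _ gH.
have := gH [:: (l, true); (k, true)].
have -> : \sum_s \sum_t (\prod_(e <- [:: (l, true); (k, true)])
     (spin_prod e.1 s + (-1) ^+ e.2 * spin_prod e.1 t)) * (H s * H t) =
   2 * ((\sum_s spin_prod l s * spin_prod k s * H s) * (\sum_s H s) -
     (\sum_s spin_prod l s * H s) * \sum_s spin_prod k s * H s).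
  transitivity (\sum_s \sum_t
     (((spin_prod l s * spin_prod k s * H s) * H t + H s * (spin_prod l t * spin_prod k t * H t)) +
     - ((spin_prod l s * H s) * (spin_prod k t * H t) + (spin_prod k s * H s) * (spin_prod l t * H t)))).
    apply: eq_bigr => s _; apply: eq_bigr => t _.
    by rewrite big_cons big_seq1 /= expr1; ring.
  under eq_bigr do rewrite big_split sumrN !big_split.
  by rewrite big_split sumrN !big_split /= !sum_mul_sum; ring.
rewrite pmulr_rge0 // subr_ge0 /wmean => h.
rewrite mulf_div ler_pdivrMr; last exact: mulr_gt0.
by rewrite mulrA divfK // gt_eqF.
Qed.

Lemma eq_wmean H W F : H =1 W -> wmean H F = wmean W F.
Proof. by move=> /funext ->. Qed.

Lemma wmean_factor H F a b l : ferro H -> a != 0 ->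
  wmean (fun s => (a + b * spin_prod l s) * H s) F =
  (a * wmean H F + b * wmean H (fun s => spin_prod l s * F s)) / (a + b * wmean H (spin_prod l)).
Proof.
move=> fH a0; have Z := ferro_sum_gt0 fH; rewrite /wmean.
have -> : \sum_s F s * ((a + b * spin_prod l s) * H s) =
   a * (\sum_s F s * H s) + b * \sum_s spin_prod l s * F s * H s.
  rewrite !mulr_sumr -big_split; apply: eq_bigr => s _ /=; ring.
have -> : \sum_s (a + b * spin_prod l s) * H s =
   a * (\sum_s H s) + b * \sum_s spin_prod l s * H s.
  rewrite !mulr_sumr -big_split; apply: eq_bigr => s _ /=; ring.
set z := \sum_s H s; set y := \sum_s F s * _; set x := \sum_s _ * H s.
set w := \sum_s spin_prod l s * H s.
have z0 : z != 0 by rewrite gt_eqF.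
rewrite -[in RHS](mulfK z0 a) -!mulrA.
rewrite [X in _ = (a * _ + b * (x / z)) / X](_ : _ = (a * z + b * w) / z); last by field.
rewrite [X in _ = X / _](_ : _ = (a * y + b * x) / z); last by field.
by rewrite invf_div mulrA mulfVK.
Qed.

(** A ferromagnetic factor [a + b s_l] dominates the mixture of the absence of
the factor, with probability [1 - b / a], and of the constraint [s_l = 1], with
probability [b / a].  With [m] and [z] the means of [s_l] and [s_l s_k], both
sides exceed the mean [y] of [s_k] by a multiple of [z - m y], which is
nonnegative by the second Griffiths inequality; for [t = b / a] these multiples
are [t / (1 + m)] and [t / (1 + t m)], and [m] is nonnegative by the first one. *)
Lemma wmean_edge H a b l k : ferro H -> 0 < a -> 0 <= b <= a ->
  (1 - b / a) * wmean H (spin_prod k)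
    + b / a * wmean (fun s => (1 + spin_prod l s) / 2 * H s) (spin_prod k)
  <= wmean (fun s => (a + b * spin_prod l s) * H s) (spin_prod k).
Proof.
move=> fH a0 /andP[b0 ba].
have -> : wmean (fun s => (1 + spin_prod l s) / 2 * H s) (spin_prod k) =
          wmean (fun s => (2^-1 + 2^-1 * spin_prod l s) * H s) (spin_prod k).
  by apply: eq_wmean => s; congr (_ * _); field.
rewrite !wmean_factor ?gt_eqF ?invr_gt0 //.
have := griffiths1 l fH; have := griffiths2 l k fH.
set m := wmean H (spin_prod l); set y := wmean H (spin_prod k); set z := wmean H _ => zy m0.
set t := b / a.
have t0 : 0 <= t by rewrite divr_ge0 // ltW.
have t1 : t <= 1 by rewrite ler_pdivrMr // mul1r.
have -> : (a * y + b * z) / (a + b * m) = (y + t * z) / (1 + t * m).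
  have ? : a + b * m != 0 by rewrite gt_eqF // ltr_wpDr // mulr_ge0.
  rewrite /t; field; rewrite gt_eqF //=.
have -> : (2^-1 * y + 2^-1 * z) / (2^-1 + 2^-1 * m) = (y + z) / (1 + m).
  by field; rewrite gt_eqF ?andbT //; lra.
have tm0 : 0 <= t * m by rewrite mulr_ge0.
have tmm : t * m <= m by rewrite ler_piMl.
rewrite -subr_ge0.
rewrite [leRHS](_ : _ = t * (z - m * y) * ((1 + t * m)^-1 - (1 + m)^-1)).
  apply: mulr_ge0; first by rewrite mulr_ge0 // subr_ge0.
  by rewrite subr_ge0 lef_pV2 ?posrE; lra.
by field; rewrite !gt_eqF //; lra.
Qed.

(** Adding a ferromagnetic factor increases the means of all spin products. *)
Lemma wmean_factor_ge H a b l k : ferro H -> 0 < a -> 0 <= b <= a ->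
  wmean H (spin_prod k) <= wmean (fun s => (a + b * spin_prod l s) * H s) (spin_prod k).
Proof.
move=> fH a0 /andP[b0 ba].
rewrite wmean_factor ?gt_eqF //.
have := griffiths1 l fH; have := griffiths2 l k fH.
set m := wmean H (spin_prod l); set y := wmean H (spin_prod k); set z := wmean H _ => zy m0.
have ab : 0 < a + b * m by rewrite ltr_wpDr // mulr_ge0.
rewrite ler_pdivlMr // mulrDr [a * _]mulrC lerD2l mulrCA ler_wpM2l //.
by rewrite mulrC.
Qed.
End Ferromagnets.

(** * Clusters of aligned spins *)

Section Clusters.
Variables (R : realType) (T : finType).
Notation conf := {ffun T -> bool}.
Implicit Types (s : conf) (l k : seq T) (H W : conf -> R) (C D : {set T}).
Notation spin_prod := (spin_prod R).

Lemma ferro_prod (I : Type) (r : seq I) (P : pred I) (a b : I -> R)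
    (l : I -> seq T) H :
  (forall i, 0 < a i /\ 0 <= b i <= a i) -> ferro H ->
  ferro (fun s => (\prod_(i <- r | P i) (a i + b i * spin_prod (l i) s)) * H s) /\
  forall k, wmean H (spin_prod k)
    <= wmean (fun s => (\prod_(i <- r | P i) (a i + b i * spin_prod (l i) s)) * H s) (spin_prod k).
Proof.
move=> ab fH; elim: r => [|i r [fr er]].
  by under eq_fun do rewrite big_nil mul1r.
under eq_fun do rewrite big_cons.
case: (P i) => //; under eq_fun do rewrite -mulrA.
have [ai bi] := ab i; split; first exact: ferro_factor.
by move=> k; apply: le_trans (er k) _; exact: wmean_factor_ge.
Qed.

(** The indicator that the spins are constant on [C], see [alignedE].  This
product of ferromagnetic factors makes it a weight to which the Griffiths
inequalities apply. *)
Definition aligned C s : R :=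
  \prod_(q : T * T | (q.1 \in C) && (q.2 \in C)) (2^-1 + 2^-1 * spin_prod [:: q.1; q.2] s).

Lemma spin_prod2 x y s : spin_prod [:: x; y] s = if s x == s y then 1 else -1.
Proof.
by rewrite /spin_prod !big_cons big_nil mulr1 -spin_eqb; case: (_ == _).
Qed.

Lemma alignedE C s :
  aligned C s = [forall x in C, forall y in C, s x == s y]%:R.
Proof.
rewrite /aligned; case: forall_inP => [h|/forall_inP/forall_inPn[x xC]].
  rewrite big1 // => -[x y] /andP[xC yC].
  by rewrite spin_prod2 (forall_inP (h x xC) y yC) /=; field.
move=> /forall_inPn[y yC /negPf sxy].
by rewrite (bigD1 (x, y)) /= ?xC ?yC // spin_prod2 sxy mulrN1 subrr mul0r.
Qed.

Lemma ferro_aligned C H : ferro H -> ferro (fun s => aligned C s * H s) /\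
  forall k, wmean H (spin_prod k) <= wmean (fun s => aligned C s * H s) (spin_prod k).
Proof. by move=> fH; apply: ferro_prod => // i; split; lra. Qed.

Lemma aligned0 s : aligned finset.set0 s = 1.
Proof. by rewrite /aligned big1 // => q; rewrite inE. Qed.

Lemma aligned_const C s x y : aligned C s != 0 -> x \in C -> y \in C -> s x = s y.
Proof.
rewrite alignedE; case: forall_inP => [h _ xC yC|]; last by rewrite eqxx.
exact/eqP/(forall_inP (h x xC)).
Qed.

Lemma aligned_join C D x y s : x \in C -> y \in D ->
  (1 + spin_prod [:: x; y] s) / 2 * (aligned C s * aligned D s) = aligned (C :|: D) s.
Proof.
move=> xC yD; rewrite spin_prod2 !alignedE.
case: (boolP [forall a in C :|: D, _]) => [/forall_inP h|].
  have h' a b : a \in C :|: D -> b \in C :|: D -> s a = s b.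
    by move=> aU bU; exact/eqP/(forall_inP (h a aU)).
  rewrite (h' x y) ?inE ?xC ?yD ?orbT // eqxx.
  have -> : [forall a in C, forall b in C, s a == s b].
    apply/forall_inP => a aC; apply/forall_inP => b bC.
    by rewrite (h' a b) ?inE ?aC ?bC.
  have -> : [forall a in D, forall b in D, s a == s b].
    apply/forall_inP => a aC; apply/forall_inP => b bC.
    by rewrite (h' a b) ?inE ?aC ?bC ?orbT.
  by rewrite /=; field.
move=> nU; case: eqP => [sxy|]; last by rewrite subrr mul0r mul0r.
case: forall_inP => [hC|]; last by rewrite mul0r mulr0.
case: forall_inP => [hD|]; last by rewrite !mulr0.
case/negP: nU; apply/forall_inP => a aU; apply/forall_inP => b bU.
have e c : c \in C :|: D -> s c = s x.
  rewrite inE => /orP[cC|cD]; first exact/eqP/(forall_inP (hC c cC)).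
  by rewrite sxy; exact/eqP/(forall_inP (hD c cD)).
by rewrite !e.
Qed.

Definition ch (x : R) := (expR x + expR (- x)) / 2.
Definition sh (x : R) := (expR x - expR (- x)) / 2.

(** The hyperbolic tangent, in a form that is visibly increasing. *)
Definition th (x : R) := 1 - 2 / (expR (2 * x) + 1).

Lemma ch_sh x : 0 <= x -> 0 < ch x /\ 0 <= sh x <= ch x.
Proof.
move=> x0; have := expR_gt0 x; have := expR_gt0 (- x).
have : expR (- x) <= expR x by rewrite ler_expR; lra.
by rewrite /ch /sh => ? ? ?; split; lra.
Qed.

Lemma thE x : th x = sh x / ch x.
Proof.
have -> : th x = 1 - 2 / (expR x * expR x + 1).
  by rewrite /th -expRD; congr (1 - 2 / (expR _ + 1)); lra.
rewrite /sh /ch expRN.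
have := expR_gt0 x; move: (expR x) => e e0.
have e1 : e != 0 by rewrite gt_eqF.
have e2 : e * e + 1 != 0 by rewrite gt_eqF // ltr_wpDl // ltW // mulr_gt0.
by field; rewrite ?e1 ?e2.
Qed.

Lemma le_th x y : x <= y -> th x <= th y.
Proof.
move=> xy; rewrite /th lerD2l lerN2 ler_pM2l // lef_pV2 ?posrE ?addr_gt0 ?expR_gt0 //.
by rewrite lerD2r ler_expR; lra.
Qed.

Lemma th01 x : 0 <= x -> 0 <= th x <= 1.
Proof.
move=> x0; rewrite thE; have [c /andP[s0 sc]] := ch_sh x0.
by rewrite divr_ge0 ?(ltW c) //= ler_pdivrMr // mul1r.
Qed.

Lemma th_gt0 x : 0 < x -> 0 < th x.
Proof.
move=> x0; rewrite /th subr_gt0 ltr_pdivrMr ?mul1r.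
  by have := expR_gt1 (2 * x); rewrite mulr_gt0 // => ?; lra.
by rewrite addr_gt0 ?expR_gt0.
Qed.

(** This polynomial decay of the probability of not being connected suffices,
since the strength of the interactions grows geometrically with the scale. *)
Lemma onem_th_le x : 0 < x -> 1 - th x <= x^-1.
Proof.
move=> x0; rewrite /th opprB addrC subrK.
rewrite ler_pdivrMr ?addr_gt0 ?expR_gt0 // mulrC ler_pdivlMr //.
by have := expR_ge1Dx (2 * x) => ?; lra.
Qed.

Lemma exp_spin_prod x l s : expR (x * spin_prod l s) = ch x + sh x * spin_prod l s.
Proof.
by rewrite /ch /sh; case: (spin_prod_pm R l s) => ->; rewrite ?mulr1 ?mulrN1; field.
Qed.

Lemma ferro_exp (I : Type) (r : seq I) (P : pred I) (a : I -> R) (l : I -> seq T) H :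
  (forall i, 0 <= a i) -> ferro H ->
  ferro (fun s => expR (\sum_(i <- r | P i) a i * spin_prod (l i) s) * H s) /\
  forall k, wmean H (spin_prod k)
    <= wmean (fun s => expR (\sum_(i <- r | P i) a i * spin_prod (l i) s) * H s) (spin_prod k).
Proof.
move=> a0 fH; under eq_fun do rewrite expR_sum.
under eq_fun do under eq_bigr do rewrite exp_spin_prod.
by apply: ferro_prod => // i; exact: ch_sh.
Qed.

(** On configurations that are constant on both clusters, the interactions
between them add up to a single one, of strength [kap], to which [wmean_edge]
applies; all other interactions can be dropped. *)
Lemma merge_clusters C D (P : pred (T * T)) (J : T * T -> R) x y H k kap :
  ferro H -> (forall q, 0 <= J q) -> x \in C -> y \in D ->
  (forall u v, u \in C -> v \in D -> P (u, v)) ->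
  kap = \sum_(q : T * T | (q.1 \in C) && (q.2 \in D)) J q ->
  (1 - th kap) * wmean H (spin_prod k) + th kap * wmean (fun s => aligned (C :|: D) s * H s) (spin_prod k)
  <= wmean (fun s => expR (\sum_(q : T * T | P q) J q * spin_prod [:: q.1; q.2] s) *
       (aligned C s * (aligned D s * H s))) (spin_prod k).
Proof.
move=> fH J0 xC yD PCD kapE.
have kap0 : 0 <= kap by rewrite kapE sumr_ge0.
pose H1 s := aligned C s * (aligned D s *
  (expR (\sum_(q : T * T | P q && ~~ ((q.1 \in C) && (q.2 \in D)))
     J q * spin_prod [:: q.1; q.2] s) * H s)).
have [fR eR] := @ferro_exp _ (index_enum _)
  (fun q : T * T => P q && ~~ ((q.1 \in C) && (q.2 \in D))) J
  (fun q => [:: q.1; q.2]) H J0 fH.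
have [fD eD] := ferro_aligned D fR.
have [fC eC] := ferro_aligned C fD.
have [fU eU] := ferro_aligned (C :|: D) fR.
have [fUH eUH] := ferro_aligned (C :|: D) fH.
have -> : wmean (fun s => expR (\sum_(q : T * T | P q) J q * spin_prod [:: q.1; q.2] s) *
       (aligned C s * (aligned D s * H s))) (spin_prod k) =
   wmean (fun s => (ch kap + sh kap * spin_prod [:: x; y] s) * H1 s) (spin_prod k).
  apply: eq_wmean => s; rewrite -exp_spin_prod /H1.
  rewrite (bigID (fun q : T * T => (q.1 \in C) && (q.2 \in D))) /= expRD.
  have [->|aC] := eqVneq (aligned C s) 0; first by rewrite !mul0r !mulr0.
  have [->|aD] := eqVneq (aligned D s) 0; first by rewrite !mul0r !mulr0.
  have -> : \sum_(q : T * T | P q && ((q.1 \in C) && (q.2 \in D)))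
      J q * spin_prod [:: q.1; q.2] s = kap * spin_prod [:: x; y] s.
    rewrite kapE mulr_suml; apply: eq_big => [[u v]|[u v]] /=.
      by apply/andb_idl => /andP[uC vD]; exact: PCD.
    move=> /andP[_ /andP[uC vD]]; rewrite !spin_prod2.
    by rewrite (aligned_const aC uC xC) (aligned_const aD vD yD).
  ring.
have [c0 sc] := ch_sh kap0.
have fH1 : ferro H1 by [].
apply: le_trans (wmean_edge [:: x; y] k fH1 c0 sc); rewrite -thE.
have /andP[t0 t1] := th01 kap0.
apply: lerD; apply: ler_wpM2l => //; first by rewrite subr_ge0.
  by apply: le_trans (eR k) _; apply: le_trans (eD k) _; exact: eC.
rewrite [leRHS](_ : _ = wmean (fun s => expR (\sum_(q : T * T |
   P q && ~~ ((q.1 \in C) && (q.2 \in D))) J q * spin_prod [:: q.1; q.2] s) *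
   (aligned (C :|: D) s * H s)) (spin_prod k)).
  by have [_] := @ferro_exp _ (index_enum _)
    (fun q : T * T => P q && ~~ ((q.1 \in C) && (q.2 \in D))) J
    (fun q => [:: q.1; q.2]) _ J0 fUH; exact.
apply: eq_wmean => s; rewrite -(aligned_join s xC yD) /H1; ring.
Qed.

End Clusters.

(** * Mixtures of clusters *)

Section Mixtures.
Variables (R : realType) (n : nat) (J : 'I_n * 'I_n -> R).
Notation T := 'I_n.
Hypothesis J0 : forall q, 0 <= J q.
Notation spin_prod := (spin_prod R).
Notation aligned := (aligned R).
Implicit Types (B C D : {set T}) (k : seq T).

(** The weight of the interactions inside [B]. *)
Definition inner B (s : {ffun T -> bool}) : R :=
  expR (\sum_(q : T * T | [&& q.1 \in B, q.2 \in B & (q.1 < q.2)%N])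
          J q * spin_prod [:: q.1; q.2] s).

(** The interactions inside [B] are dominated by a random constraint: with
probability [p i], the spins in [C i] are aligned, and nothing else is imposed.
The domination is required in the presence of an arbitrary ferromagnetic weight
[H], which makes it possible to apply it to disjoint blocks one after the
other, without any independence argument. *)
Definition mixture B (I : finType) (p : I -> R) (C : I -> {set T}) :=
  [/\ forall i, 0 <= p i, \sum_i p i = 1, forall i, C i \subset B
    & forall H k, ferro H ->
      \sum_i p i * wmean (fun s => aligned (C i) s * H s) (spin_prod k)
        <= wmean (fun s => inner B s * H s) (spin_prod k)].

Lemma inner_union B B' s : (forall u v, u \in B -> v \in B' -> (u < v)%N) ->
  inner (B :|: B') s = inner B s * (inner B' s *
    expR (\sum_(q : T * T | (q.1 \in B) && (q.2 \in B')) J q * spin_prod [:: q.1; q.2] s)).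
Proof.
move=> lt; rewrite /inner -!expRD; congr expR.
rewrite !(big_mkcond (fun q => _ && _)) -!big_split /=.
apply: eq_bigr => -[u v] _ /=; rewrite !inE.
have d w : (w \in B) && (w \in B') = false.
  by apply/negP => /andP[wB wB']; have := lt _ _ wB wB'; rewrite ltnn.
have l1 : (u \in B) && (v \in B') ==> (u < v)%N.
  by apply/implyP => /andP[uB vB]; exact: lt.
have l2 : (v \in B) && (u \in B') ==> ~~ (u < v)%N.
  by apply/implyP => /andP[vB uB]; rewrite -leqNgt ltnW // lt.
move: (d u) (d v) l1 l2.
by case: (u \in B); case: (u \in B'); case: (v \in B); case: (v \in B');
  case: (u < v)%N => //=; rewrite ?addr0 ?add0r.
Qed.

(** The cluster retained in the union of two regions.  The boolean records
whether the clusters of the two regions, when both have at least [m] sites, get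
connected; failing that, both are forgotten.  If one of them is too small, the
other one is kept. *)
Definition merged (m : nat) (C D : {set T}) (b : bool) : {set T} :=
  if (m <= #|C|)%N then
    if (m <= #|D|)%N then if b then C :|: D else finset.set0 else C
  else D.

Definition merged_weight (I I' : Type) (p : I -> R) (q : I' -> R) (d : R)
  (x : I * I' * bool) : R := p x.1.1 * q x.1.2 * (if x.2 then 1 - d else d).

Lemma sum_triple (I I' : finType) (F : I * I' * bool -> R) :
  \sum_x F x = \sum_i \sum_j (F (i, j, true) + F (i, j, false)).
Proof.
rewrite (eq_bigr (fun x => F (x.1, x.2))); last by case.
rewrite -(pair_big xpredT xpredT (fun y b => F (y, b))) /=.
rewrite (eq_bigr (fun x => \sum_b F (x.1, x.2, b))); last by case.
rewrite -(pair_big xpredT xpredT (fun y b => \sum_c F (y, b, c))) /=.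
by do 2 apply: eq_bigr => ? _; rewrite big_bool.
Qed.

Lemma mixture_merge B B' (I I' : finType) p q (C : I -> {set T}) (D : I' -> {set T})
    (m : nat) (j0 d : R) :
  (forall u v, u \in B -> v \in B' -> (u < v)%N /\ j0 <= J (u, v)) ->
  (0 < m)%N -> 0 <= j0 -> 1 - th (j0 * m%:R ^+ 2) <= d <= 1 ->
  mixture B p C -> mixture B' q D ->
  mixture (B :|: B') (merged_weight p q d)
    (fun x => merged m (C x.1.1) (D x.1.2) x.2).
Proof.
move=> lt m0 j00 /andP[dth d1] [p0 p1 CB pC] [q0 q1 DB qD].
have t01 : 0 <= th (j0 * m%:R ^+ 2) <= 1 by rewrite th01 // mulr_ge0 // exprn_ge0.
have d0 : 0 <= d by case/andP: t01 => ? ?; lra.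
split.
- by move=> [[i j] []] /=; rewrite /merged_weight /= !mulr_ge0 // subr_ge0.
- rewrite sum_triple /merged_weight /=.
  under eq_bigr => i _.
    under eq_bigr do rewrite -mulrDr subrK mulr1.
    rewrite -mulr_sumr q1 mulr1; over.
  exact: p1.
- move=> [[i j] b]; rewrite /merged /=.
  case: ifP => _; last by rewrite (fintype.subset_trans (DB j)) // finset.subsetUr.
  case: ifP => _; last by rewrite (fintype.subset_trans (CB i)) // finset.subsetUl.
  by case: b; [exact: finset.setUSS | exact: finset.sub0set].
move=> H k fH.
pose X s := expR (\sum_(q : T * T | (q.1 \in B) && (q.2 \in B')) J q * spin_prod [:: q.1; q.2] s).
have lt' u v : u \in B -> v \in B' -> (u < v)%N by move=> uB vB; have [] := lt u v uB vB.
under [leRHS]eq_wmean do rewrite (inner_union _ lt') -!mulrA.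
have inner_ferro E G : ferro G -> ferro (fun s => inner E s * G s).
  by move=> fG; have [] := @ferro_exp _ _ _ (index_enum _)
   (fun q : T * T => [&& q.1 \in E, q.2 \in E & (q.1 < q.2)%N]) J
   (fun q => [:: q.1; q.2]) G J0 fG.
have [fX eX] : ferro (fun s => X s * H s) /\
   forall k, wmean H (spin_prod k) <= wmean (fun s => X s * H s) (spin_prod k).
  by have [] := @ferro_exp _ _ _ (index_enum _)
   (fun q : T * T => (q.1 \in B) && (q.2 \in B')) J
   (fun q => [:: q.1; q.2]) H J0 fH.
have step1 := pC _ k (inner_ferro B' _ fX).
apply: le_trans step1; rewrite sum_triple; apply: ler_sum => i _.
rewrite /merged_weight /=.
have [fC eC] := ferro_aligned (C i) fX.
have step2 := qD _ k fC.
under [X in _ <= _ * X]eq_wmean do rewrite mulrCA.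
apply: le_trans (ler_wpM2l (p0 i) step2).
rewrite mulr_sumr; apply: ler_sum => j _.
rewrite -!mulrA -!mulrDr; apply: ler_wpM2l => //; apply: ler_wpM2l => //.
have [fD eD] := ferro_aligned (D j) fX.
have [fDC eDC] := ferro_aligned (D j) fC.
rewrite /merged; case: (leqP m #|C i|) => mC; last first.
  rewrite -mulrDl subrK mul1r; have [fDH eDH] := ferro_aligned (D j) fH.
  apply: le_trans (_ : wmean (fun s => aligned (D j) s * (X s * H s)) (spin_prod k) <= _).
    under [leRHS]eq_wmean do rewrite mulrCA.
    have [_] := @ferro_exp _ _ _ (index_enum _)
     (fun q : T * T => (q.1 \in B) && (q.2 \in B')) J
     (fun q => [:: q.1; q.2]) _ J0 fDH; exact.
  under [leRHS]eq_wmean do rewrite mulrCA.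
  by have [_] := ferro_aligned (C i) fD; exact.
case: (leqP m #|D j|) => mD; last first.
  rewrite -mulrDl subrK mul1r; have [fCH eCH] := ferro_aligned (C i) fH.
  apply: le_trans (eDC k).
  under [leRHS]eq_wmean do rewrite mulrCA.
  have [_] := @ferro_exp _ _ _ (index_enum _)
     (fun q : T * T => (q.1 \in B) && (q.2 \in B')) J
     (fun q => [:: q.1; q.2]) _ J0 fCH; exact.
have /card_gt0P[x xC] : (0 < #|C i|)%N by exact: leq_trans mC.
have /card_gt0P[y yD] : (0 < #|D j|)%N by exact: leq_trans mD.
have -> : wmean (fun s => aligned finset.set0 s * H s) (spin_prod k) = wmean H (spin_prod k).
  by apply: eq_wmean => s; rewrite aligned0 mul1r.
have PCD u v : u \in C i -> v \in D j -> (u \in B) && (v \in B').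
  by move=> uC vD; rewrite (fintype.subsetP (CB i)) // (fintype.subsetP (DB j)).
have := @merge_clusters _ _ (C i) (D j) (fun q => (q.1 \in B) && (q.2 \in B')) J
  x y H k _ fH J0 xC yD PCD erefl.
set kap := \sum_(q : T * T | _) _ => step3.
have kapge : j0 * m%:R ^+ 2 <= kap.
  apply: le_trans (_ : \sum_(q : T * T | (q.1 \in C i) && (q.2 \in D j)) j0 <= _); last first.
    apply: ler_sum => -[u v] /= /andP[uC vD].
    by have /andP[uB vB] := PCD u v uC vD; have [] := lt u v uB vB.
  rewrite sumr_const -[leRHS]mulr_natr; apply: ler_wpM2l => //.
  rewrite -natrX ler_nat.
  rewrite (_ : #|_| = #|C i| * #|D j|)%N; first by rewrite -mulnn leq_mul.
  by rewrite -cardX; apply: eq_card => z; rewrite !inE.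
have tk := le_th kapge.
have [fU eU] := ferro_aligned (C i :|: D j) fH.
apply: le_trans (_ : _ <= wmean (fun s => X s * (aligned (C i) s * (aligned (D j) s * H s))) (spin_prod k)) _; last first.
  by rewrite le_eqVlt; apply/orP; left; apply/eqP; apply: eq_wmean => s; ring.
apply: le_trans step3.
have := eU k; set a := wmean H _; set b := wmean _ _ => ab.
rewrite -subr_ge0.
rewrite [leRHS](_ : _ = (th kap - (1 - d)) * (b - a)); last by ring.
by apply: mulr_ge0; lra.
Qed.

(** The clusters of the two regions are independent under [merged_weight], and
the connection between them fails with probability [d]. *)
Lemma merged_weight_bound (I I' : finType) (p : I -> R) (q : I' -> R) (d : R)
    (E : pred (I * I' * bool)) (E1 E2 : pred I) (F : pred I') :
  (forall i, 0 <= p i) -> (forall i, 0 <= q i) -> \sum_i p i = 1 -> \sum_i q i = 1 ->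
  0 <= d <= 1 ->
  (forall i j b, E (i, j, b) -> [|| E1 i, E2 i && F j | ~~ b]) ->
  \sum_(x | E x) merged_weight p q d x <=
    \sum_(i | E1 i) p i + (\sum_(i | E2 i) p i) * (\sum_(j | F j) q j) + d.
Proof.
move=> p0 q0 p1 q1 /andP[d0 d1] h.
rewrite big_mkcond sum_triple /merged_weight /=.
have -> : \sum_(i | E1 i) p i = \sum_i \sum_j (p i * q j * (E1 i)%:R).
  rewrite big_mkcond; apply: eq_bigr => i _; rewrite -mulr_suml -mulr_sumr q1 mulr1.
  by case: (E1 i); rewrite ?mulr1 ?mulr0.
have -> : (\sum_(i | E2 i) p i) * (\sum_(j | F j) q j) =
   \sum_i \sum_j (p i * q j * (E2 i && F j)%:R).
  rewrite (big_mkcond E2) (big_mkcond F) big_distrlr /=.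
  do 2 apply: eq_bigr => ? _; case: ifP; case: ifP; rewrite /= ?mulr0 ?mul0r ?mulr1 //.
rewrite [X in _ <= _ + X](_ : d = \sum_i \sum_j (p i * q j * d)); last first.
  by under eq_bigr do rewrite -mulr_suml -mulr_sumr q1 mulr1; rewrite -mulr_suml p1 mul1r.
rewrite -!big_split; apply: ler_sum => i _; rewrite -!big_split; apply: ler_sum => j _ /=.
have /= ht := h i j true.
rewrite -!mulrDr.
have -> a (b1 b2 : bool) : (if b1 then a * (1 - d) else 0) + (if b2 then a * d else 0) =
   a * (b1%:R * (1 - d) + b2%:R * d).
  by case: b1; case: b2 => /=; ring.
apply: ler_wpM2l; first exact: mulr_ge0.
have := ht; case: (E (i, j, true)) => /= [/(_ isT)|_].
  by case: (E1 i); case: (_ && _); case: (E (i, j, false)) => //= _; lra.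
by case: (E1 i); case: (_ && _); case: (E (i, j, false)) => //=; lra.
Qed.

End Mixtures.

(** * Renormalization: a large cluster at every scale *)

Section Renormalization.
Variables (R : realType) (n : nat) (J : 'I_n * 'I_n -> R).
Hypothesis J0 : forall q, 0 <= J q.
Notation T := 'I_n.

Definition block (x len : nat) : {set T} := [set u : T | (x <= u < x + len)%N]%SET.

Lemma blockD x a b : block x (a + b) = block x a :|: block (x + a) b.
Proof. by apply/setP => u; rewrite !inE addnA; lia. Qed.

(** Two events are controlled separately: a cluster of [m] sites exists up to
probability [eps], and it contains [root] up to probability [rho].  Only the
first bound improves quadratically from one scale to the next. *)
Definition giant_cluster (root : T) (len m : nat) (eps rho : R) :=
  exists (I : finType) (p : I -> R) (C : I -> {set T}),
    [/\ mixture J (block root len) p C,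
        \sum_(i | (#|C i| < m)%N) p i <= eps
      & \sum_(i | ~~ ((root \in C i) && (m <= #|C i|)%N)) p i <= rho].

Lemma giant_cluster_site root : giant_cluster root 1 1 0 0.
Proof.
exists unit, (fun=> 1), (fun=> [set root]%SET); split.
- split => //.
  + by rewrite big_const card_unit /= addr0.
  + by move=> _; apply/fintype.subsetP => u; rewrite !inE => /eqP ->; rewrite leqnn addn1 ltnS leqnn.
  + move=> H k fH; rewrite big_const card_unit /= addr0 mul1r.
    rewrite le_eqVlt; apply/orP; left; apply/eqP; apply: eq_wmean => s; congr (_ * _).
    rewrite alignedE (_ : [forall x in _, _]) /=; last first.
      by apply/forall_inP => u /set1P ->; apply/forall_inP => v /set1P ->.
    rewrite /inner big1 ?expR0 // => -[u v] /=; rewrite !inE; lia.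
- by rewrite big1 // => i; rewrite cards1.
- by rewrite big1 // => i; rewrite cards1 set11.
Qed.

(** The [K] subblocks are merged one after the other.  After [k] of them, the
retained cluster has [k * m] sites unless one subblock is bad, and
[(k - 1) * m] sites unless two of them are bad or a connection fails: hence the
product [eps * (eps + d)] in the conclusion. *)
Lemma giant_cluster_step (K L m : nat) (eps rho d j0 : R) :
  (1 < K)%N -> (0 < m)%N -> (0 < L)%N -> 0 <= j0 ->
  1 - th (j0 * m%:R ^+ 2) <= d <= 1 ->
  (forall u v : T, (u < v < u + K * L)%N -> j0 <= J (u, v)) ->
  (forall root : T, (root + L <= n)%N -> giant_cluster root L m eps rho) ->
  forall root : T, (root + K * L <= n)%N ->
  giant_cluster root (K * L) (K.-1 * m) (K%:R ^+ 2 * eps * (eps + d) + K%:R * d)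
    (rho + K%:R * d + (K%:R ^+ 2 * eps * (eps + d) + K%:R * d)).
Proof.
move=> K1 m0 L0 j00 /andP[dth d1] Jj IH root rKL.
have d0 : 0 <= d.
  have : 0 <= j0 * m%:R ^+ 2 by rewrite mulr_ge0 // exprn_ge0.
  by move/(@th01 R) => /andP[? ?]; lra.
have eps0 : 0 <= eps.
  have [|I [p [C [[p0 _ _ _] h _]]]] := IH root.
    by apply: leq_trans rKL; rewrite leq_add2l leq_pmull // ltnW.
  by apply: le_trans h; exact: sumr_ge0.
(* The first bound serves only in the induction on the number of merged blocks. *)
suff [I [p [C [mix _ b r]]]] : exists (I : finType) (p : I -> R) (C : I -> {set T}),
    [/\ mixture J (block root (K * L)) p C,
        \sum_(i | (#|C i| < K * m)%N) p i <= K%:R * (eps + d),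
        \sum_(i | (#|C i| < K.-1 * m)%N) p i <= K%:R ^+ 2 * eps * (eps + d) + K%:R * d
      & \sum_(i | ~~ ((root \in C i) && (m <= #|C i|)%N)) p i <= rho + K%:R * d].
  exists I, p, C; split => //.
  apply: le_trans (lerD r b).
  case: mix => p0 _ _ _.
  rewrite [X in _ <= X + _]big_mkcond [X in _ <= _ + X]big_mkcond [leLHS]big_mkcond.
  rewrite -big_split; apply: ler_sum => i _ /=; have := p0 i.
  rewrite [(K.-1 * m <= _)%N]leqNgt.
  case: (root \in C i) => /=; last by case: ifP => _ ?; lra.
  by case: (m <= #|C i|)%N; case: (#|C i| < K.-1 * m)%N => /= ?; lra.
suff grow : forall k, (k < K)%N ->
  exists (I : finType) (p : I -> R) (C : I -> {set T}),
    [/\ mixture J (block root (k.+1 * L)) p C,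
        \sum_(i | (#|C i| < k.+1 * m)%N) p i <= k.+1%:R * (eps + d),
        \sum_(i | (#|C i| < k * m)%N) p i
          <= k.+1%:R ^+ 2 * eps * (eps + d) + k.+1%:R * d
      & \sum_(i | ~~ ((root \in C i) && (m <= #|C i|)%N)) p i <= rho + k.+1%:R * d].
  by have := grow K.-1; rewrite prednK ?(ltnW K1) //; apply; lia.
elim=> [|k IHk] kK.
  rewrite !mul1n !mul0n !mul1r.
  have [|I [p [C [mix a r]]]] := IH root; first by apply: leq_trans rKL; rewrite leq_add2l leq_pmull // ltnW.
  exists I, p, C; split => //; first by lra.
  - by rewrite big1 // expr1n mul1r addr_ge0 // mulr_ge0 // addr_ge0.
  - by lra.
have [I [p [C [mix a b r]]]] := IHk (ltnW kK).
have kLn : (root + k.+1 * L < n)%N.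
  by apply: leq_trans rKL; rewrite ltn_add2l ltn_pmul2r.
have [|I' [q [D [mix' a' _]]]] := IH (Ordinal kLn).
  by apply: leq_trans rKL; rewrite /= -addnA -mulSnr leq_add2l leq_mul2r kK orbT.
have [p0 p1 CB _] := mix; have [q0 q1 DB _] := mix'.
have cU i j : #|C i :|: D j| = (#|C i| + #|D j|)%N.
  rewrite cardsU (_ : C i :&: D j = finset.set0) ?cards0 ?subn0 //.
  apply/setP => u; rewrite !inE; apply/negP => /andP[uC uD].
  have := fintype.subsetP (CB i) u uC; have := fintype.subsetP (DB j) u uD.
  rewrite !inE /= => /andP[h _] /andP[_].
  by rewrite ltnNge h.
exists (I * I' * bool)%type, (merged_weight p q d),
  (fun x => merged m (C x.1.1) (D x.1.2) x.2).
have bound E E1 E2 F := @merged_weight_bound R I I' p q d E E1 E2 F p0 q0 p1 q1.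
have d01 : 0 <= d <= 1 by rewrite d0.
split.
- rewrite mulSnr blockD; apply: (mixture_merge J0 _ m0 j00) mix mix'; last by rewrite dth.
  move=> u v; rewrite !inE /= => /andP[ru uk] /andP[kv vk].
  have uv : (u < v)%N by exact: leq_trans kv.
  split => //; apply: Jj; rewrite uv /=; apply: (leq_trans vk).
  by rewrite -addnA -mulSnr leq_add // leq_mul2r kK orbT.
- apply: le_trans (bound _ (fun i => (#|C i| < k.+1 * m)%N) xpredT
    (fun j => (#|D j| < m)%N) d01 _) _.
    move=> i j c; rewrite /merged /=; have [//|mC] := ltnP #|C i|.
    have [//|mD] := ltnP #|D j|; rewrite /= (leq_trans _ mC) ?leq_pmull //.
    by case: c => //=; rewrite cU mulSn addnC ltnNge leq_add.
  by rewrite p1 mul1r -(natr1 k.+1); lra.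
- apply: le_trans (bound _ (fun i => (#|C i| < k * m)%N) (fun i => (#|C i| < k.+1 * m)%N)
    (fun j => (#|D j| < m)%N) d01 _) _.
    move=> i j c; rewrite /merged /=; have [//|mC] := ltnP #|C i|.
    case: (leqP m #|C i|) => mC1; case: (ltnP #|D j| m) => mD //=; rewrite ?andbF ?andbT ?orbF /=.
    + by move=> ->.
    + by case: c => //=; rewrite cU mulSn addnC ltnNge leq_add.
    + by move=> _; rewrite mulSn ltn_addr.
    + have : (k * m < 1 * m)%N by rewrite mul1n (leq_ltn_trans mC).
      by rewrite ltn_pmul2r // ltnS leqn0 => /eqP ->; rewrite mul1n ltnNge mD.
  have := ler_pM (sumr_ge0 _ (fun i _ => p0 i)) (sumr_ge0 _ (fun j _ => q0 j)) a a'.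
  rewrite -(natr1 k.+1) => h; apply: le_trans (lerD (lerD b h) (lexx d)) _.
  have k0 : 0 <= k.+1%:R :> R by [].
  have e0 : 0 <= k.+1%:R * (eps * (eps + d)) by rewrite !mulr_ge0 // addr_ge0.
  have e1 : 0 <= eps * (eps + d) by rewrite mulr_ge0 // addr_ge0.
  rewrite -subr_ge0; set kk := k.+1%:R in e0 *.
  rewrite [leRHS](_ : _ = kk * (eps * (eps + d)) + eps * (eps + d)); last by ring.
  exact: addr_ge0.
- apply: le_trans (bound _ (fun i => ~~ ((root \in C i) && (m <= #|C i|)%N)) xpred0
    xpredT d01 _) _.
    move=> i j c; rewrite /merged /=; have [rC|//] := boolP (root \in C i).
    have [mC|//] := leqP m #|C i|; have [mD|mD] := leqP m #|D j|; last by rewrite rC mC.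
    by case: c; rewrite ?orbT // inE rC cU (leq_trans mC) ?leq_addr.
  by rewrite big_pred0_eq mul0r addr0 -(natr1 k.+1); lra.
Qed.

Lemma le_power_law (p : R) (u v D : nat) : 0 <= p -> u != v -> (u <= v + D)%N ->
  (v <= u + D)%N -> D%:R `^ (- p) <= power_law p u v.
Proof.
move=> p0 uv uD vD; rewrite /power_law !powRN.
have n0 : 0 < `|u%:R - v%:R| :> R by rewrite normr_gt0 subr_eq0 eqr_nat.
have nD : `|u%:R - v%:R| <= D%:R :> R.
  have : u%:R <= v%:R + D%:R :> R by rewrite -natrD ler_nat.
  have : v%:R <= u%:R + D%:R :> R by rewrite -natrD ler_nat.
  by rewrite ler_norml => ? ?; lra.
have D0 : 0 < D%:R :> R by exact: lt_le_trans nD.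
by rewrite lef_pV2 ?posrE ?powR_gt0 // ge0_ler_powR // nnegrE ltW.
Qed.

(** With [m = K.-1 ^ N] sites in each cluster, two clusters of the same block of
scale [N + 1] interact with strength at least [2 ^ N / theta], because
[2 K^p <= (K - 1)^2]; the connection thus fails with probability at most
[theta / 2 ^ N] by [onem_th_le]. *)
Lemma giant_cluster_level (p beta : R) (K : nat) :
  0 <= p -> (1 < K)%N -> 2 * K%:R `^ p <= (K.-1)%:R ^+ 2 ->
  let theta := K%:R `^ p / beta in
  0 < beta -> 4 * K%:R ^+ 2 * (4 * K%:R + 1) * theta <= 1 ->
  (forall u v : T, u != v -> beta * power_law p u v <= J (u, v)) ->
  forall N (root : T), (root + K ^ N <= n)%N ->
  giant_cluster root (K ^ N) (K.-1 ^ N) (4 * K%:R * theta / 2 ^+ N)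
     (6 * K%:R * theta * (1 - 2 ^- N)).
Proof.
move=> p0 K1 Kp t b0 tle Jpl.
have Kpow0 : 0 < K%:R `^ p :> R by rewrite powR_gt0 // ltr0n; lia.
have t0 : 0 < t by rewrite divr_gt0.
have K2 : 2 <= K%:R :> R by rewrite ler_nat.
elim=> [|N IH] root rn.
  rewrite !expn0 in rn *; have [I [q [C [mix a b]]]] := giant_cluster_site root.
  exists I, q, C; split => //.
    apply: le_trans a _; rewrite expr0 divr1.
    by apply: mulr_ge0; [apply: mulr_ge0|exact: ltW].
  by rewrite expr0 invr1 subrr mulr0.

have d2 : 0 < 2 ^- N :> R by rewrite invr_gt0 exprn_gt0.
have d2l : 2 ^- N <= 1 :> R by rewrite invf_le1 ?exprn_gt0 // exprn_ege1 // ler1n.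
have e2 : 2 ^- N.+1 = 2 ^- N / 2 :> R by rewrite exprSr invfM.
have tle1 : t <= 1.
  apply: le_trans tle; rewrite ler_peMl ?(ltW t0) //.
  have : 4 <= K%:R ^+ 2 :> R by rewrite -[4]/(2 * 2)%N%:R; nra.
  by nra.
pose j0 := beta * (K ^ N.+1)%:R `^ (- p).
have jm : 2 ^+ N / t <= j0 * (K.-1 ^ N)%:R ^+ 2.
  rewrite /j0 /t powRN !natrX.
  have -> : (K%:R ^+ N.+1) `^ p = (K%:R `^ p) ^+ N.+1 :> R.
    exact: powR_exprn.
  move: Kp Kpow0; rewrite -exprM [(N * 2)%N]mulnC exprM.
  move: (K%:R `^ p) (K.-1%:R ^+ 2) => P Q QP P0.
  have -> : 2 ^+ N / (P / beta) = beta / P ^+ N.+1 * (2 * P) ^+ N.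
    by rewrite exprMn exprS; field; rewrite !expf_neq0 ?gt_eqF.
  apply: ler_wpM2l; first by rewrite divr_ge0 ?exprn_ge0 ?ltW.
  by rewrite lerXn2r // nnegrE ?mulr_ge0 ?(le_trans _ QP) ?mulr_ge0 // ltW.
have j0m : 0 < j0 * (K.-1 ^ N)%:R ^+ 2.
  by apply: lt_le_trans jm; rewrite divr_gt0 // exprn_gt0.
have := @giant_cluster_step K (K ^ N) (K.-1 ^ N) (4 * K%:R * t / 2 ^+ N)
  (6 * K%:R * t * (1 - 2 ^- N)) (t / 2 ^+ N) j0 K1.
rewrite !expn_gt0 -!expnS => /(_ _ _ _ _ _ IH root rn).
set x := 2 ^- N in d2 d2l e2 *; have k0 : 0 < K%:R :> R by lra.
have ktx : 0 < K%:R * t * x by do 2 apply: mulr_gt0 => //.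
(* The hypothesis on theta makes the quadratic error term of the previous step
   at most K theta / 2^N, as large as the linear one. *)
have key : K%:R ^+ 2 * (4 * K%:R * t * x) * (4 * K%:R * t * x + t * x) <= K%:R * t * x.
  rewrite [leLHS](_ : _ = (4 * K%:R ^+ 2 * (4 * K%:R + 1) * t) * (K%:R * t * x * x)); last by ring.
  apply: le_trans (_ : 1 * (K%:R * t * x * x) <= _).
    by apply: ler_wpM2r => //; rewrite mulr_ge0 // ltW.
  by rewrite mul1r ler_piMr // ltW.
case.
- by apply/orP; left; rewrite -subn1 subn_gt0.
- by apply/orP; left; exact: ltnW.
- by rewrite mulr_ge0 ?powR_ge0 // ltW.
- apply/andP; split.
    apply: le_trans (onem_th_le j0m) _; rewrite -[leRHS]invf_div.
    by rewrite lef_pV2 ?posrE // divr_gt0 // exprn_gt0.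
  by rewrite mulr_ile1 // ltW.
- move=> u v uv; apply: le_trans (Jpl u v _); last by apply/eqP => e; move: uv; rewrite e ltnn.
  by apply: ler_wpM2l; [exact: ltW | apply: le_power_law => //; clear -uv; lia].
move=> I [q [C [mix a b]]]; exists I, q, C; split => //.
- by apply: le_trans a _; rewrite e2; lra.
- by apply: le_trans b _; rewrite e2; lra.
Qed.

Lemma spin_prod_le1 (S : finType) l (s : {ffun S -> bool}) : spin_prod R l s <= 1.
Proof. by case: (spin_prod_pm R l s) => ->; lra. Qed.

(** The cluster of [root] feels the sum of the external fields at its sites. *)
Lemma giant_cluster_magnetization root len m eps rho (h : T -> R) (h0 : R) :
  giant_cluster root len m eps rho -> 0 <= h0 -> (forall u, h0 <= h u) ->
  (1 - rho) * th (h0 * m%:R) <=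
  wmean (fun s => inner J (block root len) s * expR (\sum_u h u * spin_prod R [:: u] s))
    (spin_prod R [:: root]).
Proof.
move=> [I [p [C [[p0 p1 CB dom] _ bad]]]] h00 h0h.
have hge0 u : 0 <= h u by exact: le_trans (h0h u).
have [fh _] := @ferro_exp _ _ _ (index_enum _) xpredT h (fun u => [:: u]) _ hge0 (@ferro1 R T).
have fH : ferro (fun s => expR (\sum_u h u * spin_prod R [:: u] s)).
  by apply: eq_ferro fh => s; rewrite mulr1.
apply: le_trans (dom _ _ fH).
have thm : 0 <= th (h0 * m%:R) by have /andP[] := @th01 R (h0 * m%:R) (mulr_ge0 h00 (ler0n _ _)).
apply: le_trans (_ : \sum_i p i * ((root \in C i) && (m <= #|C i|)%N)%:R * th (h0 * m%:R) <= _).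
  rewrite -mulr_suml; apply: ler_wpM2r => //.
  rewrite lerBlDr -[leLHS]p1; apply: le_trans (lerD (lexx _) bad).
  rewrite [X in _ <= _ + X]big_mkcond -big_split; apply: ler_sum => i _ /=.
  by case: (_ && _); rewrite /= ?mulr1 ?mulr0 ?addr0 ?add0r.
apply: ler_sum => i _; rewrite -mulrA; apply: ler_wpM2l => //.
have [fC _] := ferro_aligned (C i) fH.
case: andP => [[rC mC]|_]; last by rewrite mul0r griffiths1.
rewrite mul1r.
pose kap := \sum_(u in C i) h u.
have kapm : h0 * m%:R <= kap.
  apply: le_trans (_ : \sum_(u in C i) h0 <= _); last exact: ler_sum.
  by rewrite sumr_const -[leRHS]mulr_natr ler_wpM2l // ler_nat.
have kap0 : 0 <= kap by exact: sumr_ge0.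
apply: le_trans (le_th kapm) _.
have [fR _] := @ferro_exp _ _ _ (index_enum _) (fun u => u \notin C i) h
  (fun u => [:: u]) _ hge0 (@ferro1 R T).
have [fRC _] := ferro_aligned (C i) fR.
have -> : wmean (fun s => aligned R (C i) s * expR (\sum_u h u * spin_prod R [:: u] s)) (spin_prod R [:: root])
  = wmean (fun s => (ch kap + sh kap * spin_prod R [:: root] s) * (aligned R (C i) s *
     (expR (\sum_(u | u \notin C i) h u * spin_prod R [:: u] s) * 1))) (spin_prod R [:: root]).
  apply: eq_wmean => s; rewrite -exp_spin_prod (bigID (mem (C i))) /= expRD mulr1.
  have [->|aC] := eqVneq (aligned R (C i) s) 0; first by rewrite !mul0r mulr0.
  rewrite mulrCA; congr (expR _ * _); rewrite /kap mulr_suml; apply: eq_bigr => u uC.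
  by rewrite /spin_prod !big_seq1 (aligned_const aC uC rC).
have [c0 /andP[s0 sc]] := ch_sh kap0.
rewrite wmean_factor ?gt_eqF // thE.
set m1 := wmean _ _; set m2 := wmean _ _.
have -> : m2 = 1.
  have sq s : spin_prod R [:: root] s * spin_prod R [:: root] s = 1.
    by case: (spin_prod_pm R [:: root] s) => ->; rewrite ?mulrNN mulr1.
  rewrite /m2 /wmean; under eq_bigr do rewrite sq mul1r.
  by rewrite divff // gt_eqF // ferro_sum_gt0.
have m10 : 0 <= m1 by exact: griffiths1.
have m11 : m1 <= 1.
  rewrite ler_pdivrMr ?ferro_sum_gt0 // mul1r; apply: ler_sum => s _.
  by rewrite ler_piMl ?spin_prod_le1 //; case: fRC.
have cs0 : 0 < ch kap + sh kap * m1 by rewrite ltr_wpDr // mulr_ge0.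
rewrite ler_pdivlMr // mulrAC ler_pdivrMr //.
have ss : sh kap ^+ 2 <= ch kap ^+ 2 by rewrite lerXn2r // nnegrE // ltW.
have : 0 <= (ch kap ^+ 2 - sh kap ^+ 2) * m1 by rewrite mulr_ge0 // subr_ge0.
nra.
Qed.
End Renormalization.

(** * Power-law series and their tails *)

Section PowerLawSeries.
Variable R : realType.
Implicit Types (p : R) (n k L M N : nat).

Definition zsum p L M : R := \sum_(L <= d < M) d%:R `^ (- p).

Lemma zsum_ge0 p L M : 0 <= zsum p L M.
Proof. by apply: sumr_ge0 => d _; exact: powR_ge0. Qed.

Lemma zsum_cat p L M N : (L <= M)%N -> (M <= N)%N -> zsum p L N = zsum p L M + zsum p M N.
Proof. by move=> LM MN; rewrite /zsum (big_cat_nat LM MN). Qed.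

(** Each dyadic block of the series is at most [2 `^ (1 - p)] times the
preceding one. *)
Lemma zsum_dyadic p k : 1 < p ->
  zsum p 1 (2 ^ k) <= (1 - (2 `^ (1 - p)) ^+ k) / (1 - 2 `^ (1 - p)).
Proof.
move=> p1; set r := 2 `^ (1 - p).
have r1 : r < 1 by rewrite /r /powR gt_eqF // expR_lt1 nmulr_rlt0 ?ln_gt0 ?ltr1n //; lra.
elim: k => [|k IH]; first by rewrite expn0 /zsum big_geq // expr0 subrr mul0r.
rewrite (@zsum_cat _ _ (2 ^ k)) ?expn_gt0 // ?leq_exp2l //.
rewrite [leRHS](_ : _ = (1 - r ^+ k) / (1 - r) + r ^+ k); last first.
  by rewrite exprS; field; rewrite gt_eqF // subr_gt0.
apply: lerD => //.
apply: le_trans (_ : \sum_(2 ^ k <= d < 2 ^ k.+1) (2 ^ k)%:R `^ (- p) <= _).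
  rewrite /zsum !big_nat; apply: ler_sum => d /andP[kd _].
  have k0 : 0 < (2 ^ k)%:R :> R by rewrite ltr0n expn_gt0.
  have kdR : (2 ^ k)%:R <= d%:R :> R by rewrite ler_nat.
  rewrite !powRN lef_pV2 ?posrE ?powR_gt0 //; last exact: lt_le_trans kdR.
  by apply: ge0_ler_powR; rewrite ?nnegrE ?ler0n //; lra.
rewrite sumr_const_nat expnS mul2n -addnn addnK -[leLHS]mulr_natl natrX.
rewrite /r -[leRHS]powR_exprn // powRD; last by rewrite expf_neq0 ?implybT.
by rewrite powRr1 ?exprn_ge0.
Qed.

Definition zeta p : R := limn (zsum p 1).

Lemma is_cvg_zsum p : 1 < p -> cvgn (zsum p 1).
Proof.
move=> p1; have r1 : 2 `^ (1 - p) < 1.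
  by rewrite /powR gt_eqF // expR_lt1 nmulr_rlt0 ?ln_gt0 ?ltr1n //; lra.
apply: nondecreasing_is_cvgn.
  move=> L M; case: L => [|L] LM; first by rewrite /zsum big_geq // zsum_ge0.
  by rewrite (@zsum_cat _ 1 _ _ _ LM) // lerDl zsum_ge0.
exists (1 - 2 `^ (1 - p))^-1 => _ [M _ <-].
have M2 : (M <= 2 ^ M)%N by rewrite ltnW // ltn_expl.
apply: le_trans (_ : zsum p 1 (2 ^ M) <= _).
  case: M M2 => [|M] M2; first by rewrite /zsum big_geq // zsum_ge0.
  by rewrite (@zsum_cat _ 1 _ _ _ M2) // lerDl zsum_ge0.
apply: le_trans (zsum_dyadic M p1) _.
rewrite ler_pdivrMr ?subr_gt0 // mulVf ?gt_eqF ?subr_gt0 //.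
Qed.

Definition tail p L : R := zeta p - zsum p 1 L.

Lemma zsum_le_tail p L M : 1 < p -> (0 < L)%N -> zsum p L M <= tail p L.
Proof.
move=> p1 L0; rewrite /tail lerBrDl.
have le1 N : zsum p 1 N <= zeta p.
  apply: nondecreasing_cvgn_le; last exact: is_cvg_zsum.
  move=> L' M'; case: L' => [|L'] LM; first by rewrite /zsum big_geq // zsum_ge0.
  by rewrite (@zsum_cat _ 1 _ _ _ LM) // lerDl zsum_ge0.
have [LM|/ltnW ML] := leqP L M; first by rewrite -zsum_cat.
by rewrite [X in _ + X](_ : _ = 0) ?addr0 // /zsum big_geq.
Qed.

Lemma tail_ge0 p L : 1 < p -> (0 < L)%N -> 0 <= tail p L.
Proof. by move=> p1 L0; apply: le_trans (zsum_le_tail L p1 L0); exact: zsum_ge0. Qed.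

Lemma tail_le p L M : 1 < p -> (0 < L)%N -> (L <= M)%N -> tail p M <= tail p L.
Proof.
by move=> p1 L0 LM; rewrite /tail (@zsum_cat _ 1 _ _ L0 LM) lerD2l lerN2 lerDl zsum_ge0.
Qed.

Lemma cvg_tail p : 1 < p -> tail p @ \oo --> (0 : R).
Proof.
move=> p1; rewrite -[X in _ --> X](subrr (zeta p)).
by apply: cvgB; [exact: cvg_cst|exact: is_cvg_zsum].
Qed.

Lemma tail_small p (e : R) : 1 < p -> 0 < e ->
  exists L, (0 < L)%N /\ forall M, (L <= M)%N -> tail p M <= e.
Proof.
move=> p1 e0; have /cvgrPdist_le/(_ e e0) [L _ h] := cvg_tail p1.
exists L.+1; split => // M LM; have := h M (ltnW LM).
by rewrite sub0r normrN; apply: le_trans; exact: ler_norm.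
Qed.

Lemma zsumS p L M : zsum p L M.+1 = zsum p L M + (L <= M)%:R * M%:R `^ (- p).
Proof.
rewrite /zsum; have [LM|ML] := leqP L M; first by rewrite big_nat_recr //= mul1r.
by rewrite !big_geq ?mul0r ?addr0 // ltnW.
Qed.

(** For a cut of the half-line, [n] sites on one side see the other side at
distances at least 1, ..., n; a distance [d] occurs at most [d] times. *)
Lemma zsum_boundary p n M :
  \sum_(1 <= L < n.+1) zsum p L M <= zsum (p - 1) 1 M.
Proof.
elim: M => [|M IH].
  rewrite big_nat big1 /zsum ?big_geq // => L /andP[L1 _].
  by rewrite big_geq.
under eq_bigr do rewrite zsumS.
rewrite big_split zsumS /= -mulr_suml; apply: lerD => //.
case: M {IH} => [|M].
  rewrite mul0r [X in X * _](_ : _ = 0) ?mul0r //.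
  by rewrite big_nat big1 // => L /andP[L1 _]; rewrite leqNgt L1.
rewrite mul1r opprB addrC powRD ?pnatr_eq0 ?implybT // powRr1 // [leRHS]mulrC.
apply: ler_wpM2r; first exact: powR_ge0.
have -> : \sum_(1 <= L < n.+1) (L <= M.+1)%:R = (minn n M.+1)%:R :> R.
  elim: n => [|n IH]; first by rewrite big_geq.
  rewrite big_nat_recr //= IH -natrD; congr (_%:R).
  by case: leqP; lia.
by rewrite ler_nat geq_minr.
Qed.

(** The total interaction between the [n] rightmost sites and the others is
bounded in [n] because the series of [d * d `^ (- p)] converges. *)
Lemma sum_tail_bounded p : 2 < p -> exists C, forall n, \sum_(a < n) tail p (n - a) <= C.
Proof.
move=> p2; have p1 : 1 < p by lra.
exists (zeta (p - 1)) => n; have p11 : 1 < p - 1 by lra.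
have -> : \sum_(a < n) tail p (n - a) = \sum_(1 <= L < n.+1) tail p L.
  rewrite big_add1 big_mkord /= (reindex_inj rev_ord_inj) /=.
  by apply: eq_bigr => i _; rewrite subKn // ltnS.
apply/ler_addgt0Pr => e e0.
have [M0 [M00 hM]] := @tail_small p (e / n.+1%:R) p1 (divr_gt0 e0 (ltr0Sn _ n)).
pose M := maxn M0 n.
have M0M : (M0 <= M)%N by rewrite leq_maxl.
apply: le_trans (_ : \sum_(1 <= L < n.+1) (zsum p L M + tail p M) <= _).
  rewrite !big_nat; apply: ler_sum => L /andP[L1 Ln].
  by rewrite /tail (@zsum_cat _ 1 L M) //; [lra|rewrite /M; lia].
rewrite big_split /=; apply: lerD.
  apply: le_trans (zsum_boundary _ _ _) _.
  have := @zsum_le_tail (p - 1) 1 M p11 isT.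
  by rewrite /tail {2}/zsum big_geq // subr0.
rewrite sumr_const_nat subn1 /= -[leLHS]mulr_natl.
apply: le_trans (_ : n.+1%:R * (e / n.+1%:R) <= _).
  by apply: ler_pM => //; [exact: tail_ge0 (leq_trans M00 M0M)|rewrite ler_nat|exact: hM].
by rewrite mulrC divfK // pnatr_eq0.
Qed.

Lemma power_lawE p a b : (a < b)%N -> power_law p a b = (b - a)%:R `^ (- p).
Proof.
by move=> ab; rewrite /power_law distrC -natrB ?(ltnW ab) // normr_nat.
Qed.

Lemma power_lawC p a b : power_law p a b = power_law p b a.
Proof. by rewrite /power_law distrC. Qed.

Lemma power_law_ge0 p a b : 0 <= power_law p a b.
Proof. exact: powR_ge0. Qed.

Lemma sum_power_law p a L M : (a < L)%N ->
  \sum_(L <= b < M) power_law p a b = zsum p (L - a) (M - a).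
Proof.
move=> aL; rewrite /zsum.
have [LM|ML] := leqP L M; last by rewrite !big_geq //; lia.
rewrite -{1}(subnK (ltnW aL)) -{1}(subnK (leq_trans (ltnW aL) LM)) big_addn addnK.
by apply: eq_big_nat => d hd; rewrite power_lawE ?addnK //; lia.
Qed.

Lemma sum_power_law_left p i : \sum_(0 <= j < i) power_law p i j = zsum p 1 i.+1.
Proof.
rewrite big_nat_rev /zsum big_add1 /=; apply: eq_big_nat => j /andP[_ ji].
by rewrite power_lawC power_lawE add0n; last lia; congr (_%:R `^ _); lia.
Qed.

(** The interactions of a site with the sites on its two sides. *)
Lemma row_sum_le p i M : 1 < p ->
  \sum_(0 <= j < M | j != i) power_law p i j <= 2 * tail p 1.
Proof.
move=> p1.
apply: le_trans (_ : \sum_(0 <= j < maxn M i.+1 | j != i) power_law p i j <= _).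
  rewrite [leRHS](big_cat_nat (leq0n M)) ?leq_maxl //= lerDl.
  by apply: sumr_ge0 => j _; exact: power_law_ge0.
have Mi : (i < maxn M i.+1)%N by rewrite leq_maxr.
rewrite (big_cat_nat (leq0n i) (ltnW Mi)) /= [X in _ + X]big_ltn_cond // eqxx /=.
have -> : \sum_(0 <= j < i | j != i) power_law p i j = zsum p 1 i.+1.
  rewrite -sum_power_law_left [LHS]big_nat_cond [RHS]big_nat_cond.
  by apply: eq_bigl => j; clear; apply/idP/idP; lia.
have -> : \sum_(i.+1 <= j < maxn M i.+1 | j != i) power_law p i j =
    zsum p 1 (maxn M i.+1 - i).
  rewrite -(subSnn i) -sum_power_law // [LHS]big_nat_cond [RHS]big_nat_cond.
  by apply: eq_bigl => j; clear; apply/idP/idP; lia.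
by rewrite mulr_natl mulr2n; apply: lerD; exact: zsum_le_tail.
Qed.

Lemma summable_power_law p : summable_couplings (power_law p) <-> 1 < p.
Proof.
have E i : esum [set j | j != i] (fun j => `|(power_law p i j)%:E|%E) =
    (\sum_(j <oo | j != i) (power_law p i j)%:E)%E.
  rewrite nneseries_esum => [|j _]; last by rewrite lee_fin power_law_ge0.
  by apply: eq_esum => j _; rewrite abse_EFin ger0_norm ?power_law_ge0.
split=> [sJ|p1 i]; last first.
  rewrite /summable E; apply: (@le_lt_trans _ _ (2 * tail p 1)%:E); last exact: ltry.
  apply: lime_le; first by apply: is_cvg_nneseries => j _ _; rewrite lee_fin power_law_ge0.
  by apply: nearW => M; rewrite sumEFin lee_fin row_sum_le.
rewrite ltNge; apply/negP => p1; have := sJ 0%N; rewrite /summable E => foo.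
pose C := (\sum_(j <oo | j != 0%N) (power_law p 0 j)%:E)%E.
have C0 : (0 <= C)%E by apply: nneseries_ge0 => j _ _; rewrite lee_fin power_law_ge0.
apply: (@dvg_harmonic R); apply: nondecreasing_is_cvgn.
  by apply: nondecreasing_series => j _ _; exact: harmonic_ge0.
exists (fine C) => _ [M _ <-].
have : (\sum_(0 <= j < M.+1 | j != 0%N) (power_law p 0 j)%:E <= C)%E.
  by apply: nneseries_lim_ge => j _; rewrite lee_fin power_law_ge0.
rewrite sumEFin -(@fineK _ C) ?ge0_fin_numE // lee_fin.
apply: le_trans; rewrite big_ltn_cond //= big_add1 /= /series /=.
apply: ler_sum => j _; rewrite power_lawE // subn0 powRN /harmonic /=.
rewrite lef_pV2 ?posrE ?powR_gt0 ?ltr0n //.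
by apply: ler1_powR => //; rewrite ler1n.
Qed.

End PowerLawSeries.

(** * The energy as a sum of local fields *)

Section Energy.
Variables (R : realType) (p : R).
Hypothesis p1 : 1 < p.
Notation J := (power_law p).
Notation spin := (spin R).
Implicit Types (w : Omega) (a b n M N : nat).

Definition field_upto a M w : R := \sum_(a.+1 <= b < M) J a b * spin (w b).

(** The field on the spin at [a] of all the sites in its past.  Each pair of
sites is attributed to its right site, so that [energy n] is the sum over the
pairs meeting the [n] rightmost sites. *)
Definition field a w : R := limn (fun M => field_upto a M w).

Lemma spin_norm (b : bool) : `|spin b| = 1.
Proof. by case: b; rewrite /Defs.spin ?normr1 // normrN1. Qed.

Lemma field_upto_norm a M N w w' : (a < M)%N -> (M <= N)%N ->
  (forall b, (a < b < M)%N -> w b = w' b) ->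
  `|field_upto a N w - field_upto a N w'| <= 2 * zsum p (M - a) (N - a).
Proof.
move=> aM MN ww'; rewrite /field_upto !(big_cat_nat aM MN) /=.
rewrite [X in `|X + _ - _|](_ : _ = \sum_(a.+1 <= b < M) J a b * spin (w' b)); last first.
  by apply: eq_big_nat => b hb; rewrite ww'.
rewrite [X in `|X|](_ : _ = \sum_(M <= b < N) J a b * spin (w b)
   - \sum_(M <= b < N) J a b * spin (w' b)); last by ring.
rewrite -sumrB -sum_power_law // mulr_sumr.
apply: le_trans (ler_norm_sum _ _ _) _; apply: ler_sum => b _.
rewrite -mulrBr normrM ger0_norm ?power_law_ge0 // mulrC ler_wpM2r ?power_law_ge0 //.
by apply: le_trans (ler_normB _ _) _; rewrite !spin_norm; lra.
Qed.

Lemma is_cvg_field a w : cvgn (fun M => field_upto a M w).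
Proof.
pose u b : R := if (a < b)%N then J a b * spin (w b) else 0.
have E M : field_upto a M w = series u M.
  rewrite /series /= /field_upto /u -big_mkcond /=.
  have [aM|Ma] := ltnP a M.
    rewrite [RHS](big_cat_nat (leq0n a.+1) aM) /= [X in _ = X + _]big_nat_cond.
    rewrite [X in _ = X + _]big_pred0 ?add0r; last by move=> b; lia.
    by rewrite [LHS]big_nat_cond [RHS]big_nat_cond; apply: eq_bigl => b; clear; apply/idP/idP; lia.
  rewrite big_geq; last lia.
  by rewrite big_nat_cond big_pred0 // => b; lia.
rewrite (_ : (fun M => _) = series u); last by apply/funext.
apply: normed_cvg; apply: nondecreasing_is_cvgn.
  by apply: nondecreasing_series => b _ _; exact: normr_ge0.
exists (2 * tail p 1) => _ [M _ <-]; apply: le_trans (row_sum_le a M p1).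
rewrite /series /= [leRHS]big_mkcond; apply: ler_sum => b _; rewrite /u.
case: ltnP => [ab|_]; last by rewrite normr0; case: ifP => // _; exact: power_law_ge0.
by rewrite normrM spin_norm mulr1 ger0_norm ?power_law_ge0 // gtn_eqF.
Qed.

Lemma field_cvg a w : field_upto a M w @[M --> \oo] --> field a w.
Proof. exact: is_cvg_field. Qed.

Lemma field_diff a M w w' : (a < M)%N -> (forall b, (a < b < M)%N -> w b = w' b) ->
  `|field a w - field a w'| <= 2 * tail p (M - a).
Proof.
move=> aM ww'.
have c : `|field_upto a N w - field_upto a N w'| @[N --> \oo] --> `|field a w - field a w'|.
  by apply: cvg_norm; apply: cvgB; exact: field_cvg.
rewrite -(cvg_lim (@Rhausdorff R) c); apply: limr_le.
  by apply/cvg_ex; eexists; exact: c.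
near=> N; apply: le_trans (field_upto_norm aM _ ww') _; first by near: N; exists M.
by rewrite ler_wpM2l // zsum_le_tail // subn_gt0.
Unshelve. all: by end_near. Qed.

Lemma field_flip a k c w : (a < k)%N ->
  field a (set_spin k c w) = field a w + J a k * (spin c - spin (w k)).
Proof.
move=> ak; apply: (@cvg_lim _ (@Rhausdorff R)).
have h : field_upto a M w + J a k * (spin c - spin (w k)) @[M --> \oo] -->
    field a w + J a k * (spin c - spin (w k)).
  by apply: cvgD; [exact: field_cvg|exact: cvg_cst].
apply: cvg_trans h; apply: near_eq_cvg; near=> M.
have kM : (k < M)%N by near: M; exists k.+1.
apply/eqP; rewrite eq_sym addrC -subr_eq /field_upto -sumrB.
rewrite (bigD1_seq k) ?mem_index_iota ?ak ?iota_uniq //= big1_seq ?addr0.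
  by rewrite -mulrBr /set_spin eqxx.
by move=> b /andP[/negPf bk _]; rewrite /set_spin bk subrr.
Unshelve. all: by end_near. Qed.

Lemma field_past a k c w : (k <= a)%N -> field a (set_spin k c w) = field a w.
Proof.
move=> ka; congr (limn _); apply/funext => M; apply: eq_big_nat => b /andP[ab _].
by rewrite /set_spin gtn_eqF // (leq_ltn_trans ka).
Qed.

Definition energy n w : R := \sum_(a < n) spin (w a) * field a w.

Section Potential.
Variable beta : R.
Let bond w (q : nat * nat) : R := - beta * J q.1 q.2 * spin (w q.1) * spin (w q.2).

Lemma fset2_perm (a b : nat) : a != b -> perm_eq (enum_fset [fset a; b]%fset) [:: a; b].
Proof.
move=> ab; apply: uniq_perm; rewrite ?fset_uniq //= ?inE ?ab //.
by move=> c; rewrite !inE.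
Qed.

Lemma ising_potential_pair w q : (q.1 < q.2)%N ->
  ising_potential J beta [fset q.1; q.2]%fset w = bond w q.
Proof.
case: q => a b /= ab; have nab : a != b by rewrite neq_ltn ab.
have := fset2_perm nab; rewrite /ising_potential.
case E : (enum_fset _) => [|c [|d [|? ?]]] /= h; try by have := perm_size h.
have c2 : c \in [:: a; b] by rewrite -(perm_mem h) mem_head.
have d2 : d \in [:: a; b] by rewrite -(perm_mem h) !inE eqxx orbT.
have cd : c != d.
  have : uniq [:: c; d] by rewrite (perm_uniq h) /= inE nab.
  by rewrite /= inE andbT.
move: c2 d2 cd; rewrite /bond !inE /= => /orP[/eqP->|/eqP->] /orP[/eqP->|/eqP->] //;
  rewrite ?eqxx //.
by move=> _; rewrite power_lawC; ring.
Qed.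

Lemma ising_potential_neq0 w (A : {fset site}) : ising_potential J beta A w != 0 ->
  exists q : nat * nat, (q.1 < q.2)%N /\ A = [fset q.1; q.2]%fset.
Proof.
rewrite /ising_potential; case E : (enum_fset A) => [|a [|b [|? ?]]]; rewrite ?eqxx // => _.
have Ae : A = [fset a; b]%fset.
  apply/fsetP => c; have -> : (c \in A) = (c \in enum_fset A) by [].
  by rewrite E !inE.
have : uniq (enum_fset A) by exact: fset_uniq.
rewrite E /= inE andbT neq_ltn => /orP[ab|ba]; first by exists (a, b).
by exists (b, a); split => //; rewrite Ae fsetUC.
Qed.

(** Only pairs contribute to the sum over finite sets, and each pair meeting the
interval is enumerated once by its right site [a <= i] and its left site.  The
function [g] is meant to be the positive or the negative part. *)
Lemma esum_pairs w (g : R -> \bar R) i : g 0 = 0%E -> (forall x, (0 <= g x)%E) ->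
  esum [set A : {fset site} | exists2 k, k \in A & (k <= i)%N]
    (fun A => g (ising_potential J beta A w)) =
  (\sum_(a < i.+1) esum [set b | (a < b)%N] (fun b => g (bond w (val a, b))))%E.
Proof.
move=> g00 g0.
pose P := [set a : nat | (a < i.+1)%N] `*`` (fun a => [set b : nat | (a < b)%N]).
pose e (q : nat * nat) := [fset q.1; q.2]%fset.
transitivity (esum (e @` P) (fun A => g (ising_potential J beta A w))).
  rewrite esum_mkcond [RHS]esum_mkcond; apply: eq_esum => A _.
  have [A0|/ising_potential_neq0[q [q12 Ae]]] :=
    eqVneq (ising_potential J beta A w) 0; first by rewrite A0 g00 !if_same.
  case: ifPn; case: ifPn => //; rewrite !(inE, notin_setE) /=.
    move=> nA [k kA ki]; exfalso; apply: nA; exists q => //; split => //=.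
    move: kA; rewrite Ae !inE => /orP[/eqP e1|/eqP e2]; first by rewrite ltnS -e1.
    by rewrite ltnS (leq_trans (ltnW q12)) // -e2.
  move=> [[a b] [/= ai ab] <-] nA; exfalso; apply: nA; exists a => //.
  by rewrite !inE eqxx.
rewrite esum_image; last first.
  move=> [a b] [c d]; rewrite !inE /P /= => -[/= _ ab] [/= _ cd] /fsetP eab.
  have ha : (a == c) || (a == d) by have := eab a; rewrite !inE eqxx => <-.
  have hb : (b == c) || (b == d) by have := eab b; rewrite !inE eqxx orbT => <-.
  suff [-> ->] : a = c /\ b = d by [].
  by clear -ab cd ha hb; lia.
transitivity (esum P (fun q => g (bond w q))).
  by apply: eq_esum => q [_ /=] q12; rewrite ising_potential_pair.
rewrite -(@esum_esum _ _ _ _ _ (fun a b => g (bond w (a, b)))) //.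
  rewrite esum_fset //; first by rewrite -fsbig_ord.
  by move=> a _; exact: esum_ge0.
Qed.

Lemma big_nat_gt a M (F : nat -> R) :
  \sum_(0 <= b < M | (a < b)%N) F b = \sum_(a.+1 <= b < M) F b.
Proof.
have [aM|Ma] := ltnP a M.
  rewrite (big_cat_nat (leq0n a.+1) aM) /= [X in X + _]big_nat_cond.
  rewrite [X in X + _]big_pred0 ?add0r; last by move=> b; clear; lia.
  by rewrite [LHS]big_nat_cond [RHS]big_nat_cond; apply: eq_bigl => b; clear; apply/idP/idP; lia.
rewrite [RHS]big_geq; last by clear -Ma; lia.
by rewrite big_nat_cond big_pred0 // => b; clear -Ma; lia.
Qed.

Lemma esum_bonds w a : exists x y : R,
  [/\ esum [set b | (a < b)%N] (fun b => maxe (bond w (a, b))%:E 0%E) = x%:E,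
      esum [set b | (a < b)%N] (fun b => maxe (- (bond w (a, b))%:E)%E 0%E) = y%:E
    & x - y = - beta * (spin (w a) * field a w)].
Proof.
pose f b := (bond w (a, b))%:E; pose P b := (a < b)%N.
have sf : summable [set` P] f.
  rewrite /summable (_ : esum _ _ = (\sum_(b <oo | P b) `|f b|)%E); last first.
    by rewrite nneseries_esum.
  apply: (@le_lt_trans _ _ (`|beta| * (2 * tail p 1))%:E); last exact: ltry.
  apply: lime_le; first by apply: is_cvg_nneseries.
  apply: nearW => M; rewrite sumEFin lee_fin.
  apply: le_trans (ler_wpM2l (normr_ge0 beta) (row_sum_le a M p1)).
  rewrite mulr_sumr /P big_mkcond [leRHS]big_mkcond; apply: ler_sum => b _.
  case: ifPn => [ab|_]; last by case: ifP => // _; rewrite mulr_ge0 ?power_law_ge0.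
  rewrite gtn_eqF //= !normrM !spin_norm !mulr1 normrN.
  by rewrite [X in _ * X <= _]ger0_norm ?power_law_ge0.
have fin g : (forall b, (0 <= g b)%E) -> summable [set` P] g ->
    esum [set` P] g \is a fin_num.
  move=> g0; rewrite summableE (_ : esum _ (fun _ => _) = esum [set` P] g) //.
  by apply: eq_esum => b _; rewrite gee0_abs.
have f1 : esum [set` P] f^\+%E \is a fin_num.
  by apply: fin; [move=> b; exact: funepos_ge0 | exact: summable_funepos].
have f2 : esum [set` P] f^\-%E \is a fin_num.
  by apply: fin; [move=> b; exact: funeneg_ge0 | exact: summable_funeneg].
have h : (esum [set` P] f^\+ - esum [set` P] f^\- =
    (- beta * (spin (w a) * field a w))%:E)%E; last first.
  exists (fine (esum [set` P] f^\+%E)), (fine (esum [set` P] f^\-%E)).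
  have setE : [set b | (a < b)%N] = [set` P] by apply/seteqP; split.
  split; [by rewrite fineK // setE funepos.unlock | by rewrite fineK // setE funeneg.unlock |].
  by move: h; rewrite -(fineK f1) -(fineK f2) -EFinB => -[].
rewrite -(summable_eseries_esum sf).
apply: cvg_lim => //.
rewrite (_ : (fun n => _) = EFin \o (fun M => - beta * (spin (w a) * field_upto a M w))).
  apply: cvg_EFin; first by apply: nearW.
  by apply: cvgMr; apply: cvgMr; exact: field_cvg.
apply/funext => M; rewrite sumEFin /= /P big_nat_gt /field_upto !mulr_sumr; congr (_%:E).
by apply: eq_bigr => b _; rewrite /bond /=; ring.
Qed.

Lemma ising_energyE i w : ising_energy J beta i w = - beta * energy i.+1 w.
Proof.
have [x xP] := choice (esum_bonds w); have [y xyP] := choice xP.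
have [c1 c2] : maxe (0 : R)%:E 0%E = 0%E /\ maxe (- (0 : R)%:E)%E 0%E = 0%E.
  by rewrite oppe0 maxxx.
have Ep := @esum_pairs w (fun z => maxe z%:E 0%E) i c1 _.
have En := @esum_pairs w (fun z => maxe (- z%:E)%E 0%E) i c2 _.
rewrite /ising_energy funepos.unlock funeneg.unlock /=.
rewrite Ep ?En; try by move=> z; rewrite le_max lexx orbT.
rewrite (eq_bigr (fun a : 'I_i.+1 => (x a)%:E)) => [|a _]; last by have [] := xyP a.
rewrite [X in (_ - X)%E](eq_bigr (fun a : 'I_i.+1 => (y a)%:E)) => [|a _]; last by have [] := xyP a.
rewrite !sumEFin.
rewrite -EFinB /= -sumrB /energy mulr_sumr; apply: eq_bigr => a _.
by have [] := xyP a.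
Qed.

End Potential.

End Energy.

(** * Finite-volume Gibbs kernels *)

Section Specification.
Variables (R : realType) (p beta : R).
Hypotheses (p1 : 1 < p) (beta0 : 0 < beta).
Notation J := (power_law p).
Notation spin := (spin R).
Notation field := (field p).
Notation energy := (energy p).
Implicit Types (w : Omega) (F G : Omega -> R) (i k n M N : nat).

Definition agree_from n w w' := forall k, (n <= k)%N -> w k = w' k.
Definition agree_upto n w w' := forall k, (k < n)%N -> w k = w' k.
(** Functions of the coordinates in the past of [n], [n] included. *)
Definition past_dep n F := forall w w', agree_from n w w' -> F w = F w'.

Lemma concat_ge n (s : {ffun 'I_n -> bool}) w : agree_from n (concat s w) w.
Proof. by move=> k nk; rewrite /concat insubF // ltnNge nk. Qed.

Lemma concat_lt n (s : {ffun 'I_n -> bool}) w k (kn : (k < n)%N) :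
  concat s w k = s (Ordinal kn).
Proof. by rewrite /concat insubT. Qed.

Lemma concat_eq n (s : {ffun 'I_n -> bool}) w w' :
  agree_from n w w' -> concat s w = concat s w'.
Proof.
move=> h; apply/funext => k; have [nk|kn] := leqP n k; last by rewrite !concat_lt.
by rewrite !concat_ge // h.
Qed.

Definition sum_conf n F w : R := \sum_(s : {ffun 'I_n -> bool}) F (concat s w).

Definition extend_conf n (bs : bool * {ffun 'I_n -> bool}) : {ffun 'I_n.+1 -> bool} :=
  [ffun i => if unlift ord_max i is Some j then bs.2 j else bs.1].

Lemma concat_extend n bs w :
  concat (@extend_conf n bs) w = concat bs.2 (set_spin n bs.1 w).
Proof.
apply/funext => k; have [kn|nk] := ltnP k n.
  rewrite (concat_lt _ _ (ltnW kn : (k < n.+1)%N)) concat_lt ffunE.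
  case: unliftP => [j|] /(congr1 val) /=; last by move=> e; exfalso; move: (kn); rewrite e ltnn.
  rewrite /bump leqNgt ltn_ord add0n => e; congr (bs.2 _); exact/val_inj.
rewrite [RHS]concat_ge // /set_spin; have [->|kn] := eqVneq k n.
  rewrite (concat_lt _ _ (ltnSn n)) ffunE.
  case: unliftP => [j|] // /(congr1 val) /= e.
  by have := neq_bump n j; rewrite -e eqxx.
by rewrite concat_ge // ltn_neqAle eq_sym kn.
Qed.

(** This recursion replaces most manipulations of configurations on finite
intervals. *)
Lemma sum_confS n F w : sum_conf n.+1 F w = \sum_b sum_conf n F (set_spin n b w).
Proof.
rewrite /sum_conf pair_big /= (reindex (@extend_conf n)) /=.
  by apply: eq_bigr => bs _; rewrite concat_extend.
exists (fun s => (s ord_max, [ffun j => s (lift ord_max j)])) => [[b s] _|s _].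
  rewrite /extend_conf /= ffunE unlift_none; congr (_, _); apply/ffunP => j.
  by rewrite !ffunE liftK.
apply/ffunP => i; rewrite ffunE; case: unliftP => [j ->|-> //].
by rewrite ffunE.
Qed.

Lemma sum_conf_dep n F : past_dep n (sum_conf n F).
Proof. by move=> w w' ww'; apply: eq_bigr => s _; rewrite (concat_eq s ww'). Qed.

Lemma sum_conf_mul n c F w : past_dep n c ->
  sum_conf n (fun x => c x * F x) w = c w * sum_conf n F w.
Proof.
move=> h; rewrite mulr_sumr; apply: eq_bigr => s _; congr (_ * _).
by apply: h; exact: concat_ge.
Qed.

Definition weight n w : R := expR (beta * energy n w).

Lemma weight_gt0 n w : 0 < weight n w.
Proof. exact: expR_gt0. Qed.

Definition partf n w := sum_conf n (weight n) w.

Lemma partf_gt0 n w : 0 < partf n w.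
Proof.
rewrite /partf /sum_conf (bigD1 [ffun=> true]) //= ltr_wpDr ?weight_gt0 //.
by apply: sumr_ge0 => s _; rewrite ltW // weight_gt0.
Qed.

(** The Gibbs kernel on the [n] rightmost sites, the other spins being those of
[w]. *)
Definition gibbs n F w : R := sum_conf n (fun x => weight n x * F x) w / partf n w.

Lemma gibbs_dep n F : past_dep n (gibbs n F).
Proof. by move=> w w' ww'; rewrite /gibbs /partf !(sum_conf_dep _ ww'). Qed.

Lemma field_dep a : past_dep a.+1 (field a).
Proof.
move=> w w' ww'; congr (limn _); apply/funext => M.
by apply: eq_big_nat => b /andP[ab _]; rewrite ww'.
Qed.

Definition site_factor n w : R := expR (beta * (spin (w n) * field n w)).

(** The extra factor does not depend on the spins to the right of [n]; this is
why Gibbs kernels are compatible with each other. *)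
Lemma weightS n w : weight n.+1 w = site_factor n w * weight n w.
Proof. by rewrite /weight /energy big_ord_recr /= mulrDr expRD mulrC. Qed.

Lemma site_factor_dep n : past_dep n (site_factor n).
Proof.
move=> w w' ww'; rewrite /site_factor ww' // (field_dep (w' := w')) // => k nk.
by apply: ww'; exact: ltnW.
Qed.

Lemma gibbs_sum_conf n F w : sum_conf n (fun x => weight n x * F x) w = gibbs n F w * partf n w.
Proof. by rewrite /gibbs divfK // gt_eqF // partf_gt0. Qed.

Lemma gibbs_gibbsS n F w : gibbs n.+1 (gibbs n F) w = gibbs n.+1 F w.
Proof.
rewrite /gibbs; congr (_ / _); rewrite !sum_confS; apply: eq_bigr => b _.
transitivity (sum_conf n (fun x => (site_factor n x * gibbs n F x) * weight n x) (set_spin n b w)).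
  by apply: eq_bigr => s _; rewrite weightS mulrAC.
rewrite sum_conf_mul; last by move=> x y xy; rewrite (site_factor_dep xy) (gibbs_dep F xy).
rewrite -mulrA -gibbs_sum_conf -sum_conf_mul; last exact: site_factor_dep.
by apply: eq_bigr => s _; rewrite weightS mulrA.
Qed.

Lemma gibbs1 n w : gibbs n (fun=> 1) w = 1.
Proof.
rewrite /gibbs (_ : sum_conf _ _ _ = partf n w) ?divff ?gt_eqF ?partf_gt0 //.
by apply: eq_bigr => s _; rewrite mulr1.
Qed.

Lemma gibbs_mul n c F w : past_dep n c -> gibbs n (fun x => c x * F x) w = c w * gibbs n F w.
Proof.
move=> h; rewrite /gibbs mulrA -sum_conf_mul //; congr (_ / _).
by apply: eq_bigr => s _; rewrite mulrCA.
Qed.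

Lemma gibbs_id n F w : past_dep n F -> gibbs n F w = F w.
Proof.
move=> h; rewrite -[RHS]mulr1 -(gibbs1 n w) -gibbs_mul //; congr (gibbs _ _ _).
by apply/funext => x; rewrite mulr1.
Qed.

Lemma gibbs_gibbs n N F w : (n <= N)%N -> gibbs N (gibbs n F) w = gibbs N F w.
Proof.
elim: N w => [|N IH] w.
  by rewrite leqn0 => /eqP ->; rewrite gibbs_id //; exact: gibbs_dep.
rewrite leq_eqVlt => /predU1P[->|]; first by rewrite gibbs_id //; exact: gibbs_dep.
rewrite ltnS => nN; rewrite -gibbs_gibbsS -[RHS]gibbs_gibbsS; congr (gibbs _ _ _).
by apply/funext => x; exact: IH.
Qed.

Lemma gibbsD n F G w : gibbs n (fun x => F x + G x) w = gibbs n F w + gibbs n G w.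
Proof.
rewrite /gibbs -mulrDl -big_split; congr (_ / _).
by apply: eq_bigr => s _; rewrite mulrDr.
Qed.

Lemma gibbsZ n (c : R) F w : gibbs n (fun x => c * F x) w = c * gibbs n F w.
Proof. exact: (@gibbs_mul n (fun=> c)). Qed.

Lemma gibbs_sum n (I : Type) (r : seq I) (P : pred I) (F : I -> Omega -> R) w :
  gibbs n (fun x => \sum_(i <- r | P i) F i x) w = \sum_(i <- r | P i) gibbs n (F i) w.
Proof.
elim: r => [|i r IH].
  rewrite big_nil (_ : (fun _ => _) = (fun x => 0 * 1)); first by rewrite gibbsZ mul0r.
  by apply/funext => x; rewrite big_nil mul0r.
rewrite big_cons -IH (_ : (fun _ => _) = (fun x => if P i then
    F i x + \sum_(j <- r | P j) F j x else \sum_(j <- r | P j) F j x)).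
  by case: (P i) => //; rewrite gibbsD.
by apply/funext => x; rewrite big_cons.
Qed.

Lemma le_gibbs n F G w : (forall x, agree_from n x w -> F x <= G x) -> gibbs n F w <= gibbs n G w.
Proof.
move=> FG; rewrite /gibbs ler_pM2r ?invr_gt0 ?partf_gt0 //.
apply: ler_sum => s _; rewrite ler_pM2l ?weight_gt0 // FG //; exact: concat_ge.
Qed.

Lemma gibbs_sum_prob n F w :
  gibbs n F w = \sum_(s : {ffun 'I_n -> bool})
     (weight n (concat s w) / partf n w) * F (concat s w).
Proof. by rewrite /gibbs mulr_suml; apply: eq_bigr => s _; rewrite mulrAC. Qed.

(** If the energies seen from the two exteriors differ by at most [eta], the
two Gibbs measures [P] and [Q] satisfy [c Q <= P] with
[c = exp (- 2 beta eta)]; they share a common part of mass [c], which does not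
contribute to the difference of the means. *)
Lemma gibbs_contract n F w w' (eta r eps : R) :
  (forall s : {ffun 'I_n -> bool},
     `|energy n (concat s w) - energy n (concat s w')| <= eta) ->
  (forall x y, F x - F y <= r) ->
  (forall s : {ffun 'I_n -> bool}, F (concat s w) - F (concat s w') <= eps) ->
  gibbs n F w - gibbs n F w' <= (1 - expR (- (2 * beta * eta))) * r + eps.
Proof.
move=> hE hr heps.
pose P (s : {ffun 'I_n -> bool}) := weight n (concat s w) / partf n w.
pose Q (s : {ffun 'I_n -> bool}) := weight n (concat s w') / partf n w'.
pose c := expR (- (2 * beta * eta)).
have P1 : \sum_s P s = 1 by rewrite /P -mulr_suml divff // gt_eqF // partf_gt0.
have Q1 : \sum_s Q s = 1 by rewrite /Q -mulr_suml divff // gt_eqF // partf_gt0.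
have Q0 s : 0 <= Q s by rewrite divr_ge0 // ltW // ?weight_gt0 ?partf_gt0.
have wt1 (s : {ffun 'I_n -> bool}) : weight n (concat s w') <= expR (beta * eta) * weight n (concat s w).
  rewrite /weight -expRD ler_expR -mulrDr ler_pM2l //.
  by have := hE s; rewrite ler_norml => /andP[? ?]; lra.
have wt2 (s : {ffun 'I_n -> bool}) : weight n (concat s w) <= expR (beta * eta) * weight n (concat s w').
  rewrite /weight -expRD ler_expR -mulrDr ler_pM2l //.
  by have := hE s; rewrite ler_norml => /andP[? ?]; lra.
have Zle : partf n w <= expR (beta * eta) * partf n w'.
  by rewrite /partf /sum_conf mulr_sumr; exact: ler_sum.
have PQ s : c * Q s <= P s.
  rewrite /P /Q ler_pdivlMr ?partf_gt0 //.
  rewrite [leLHS](_ : _ = c * weight n (concat s w') * partf n w / partf n w'); last by ring.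
  rewrite ler_pdivrMr ?partf_gt0 //.
  apply: le_trans (_ : c * (expR (beta * eta) * weight n (concat s w)) *
     (expR (beta * eta) * partf n w') <= _).
    apply: ler_pM => //; rewrite ?mulr_ge0 ?expR_ge0 // ?(ltW (weight_gt0 _ _)) ?(ltW (partf_gt0 _ _)) //.
    by rewrite ler_pM2l ?expR_gt0.
  have -> : c * (expR (beta * eta) * weight n (concat s w)) *
     (expR (beta * eta) * partf n w') =
     (c * expR (beta * eta) * expR (beta * eta)) * (weight n (concat s w) * partf n w') by ring.
  rewrite /c -!expRD (_ : - _ + _ + _ = 0) ?expR0 ?mul1r //; lra.
rewrite !gibbs_sum_prob -lerBlDr.
pose f (s : {ffun 'I_n -> bool}) := F (concat s w).
have h : \sum_s Q s * f s - \sum_s Q s * F (concat s w') <= eps.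
  rewrite -sumrB -[leRHS]mul1r -Q1 mulr_suml; apply: ler_sum => s _.
  by rewrite -mulrBr; apply: ler_wpM2l; [exact: Q0|exact: heps].
apply: le_trans (_ : \sum_s P s * f s - \sum_s Q s * f s <= _); first by rewrite /P /Q /f in h *; lra.
(* A coupling of P and Q that puts the mass c Q on the diagonal; its remaining
   part is the product of P - c Q and Q. *)
have -> : \sum_s P s * f s - \sum_s Q s * f s =
   \sum_s \sum_t (P s - c * Q s) * Q t * (f s - f t).
  have e s : \sum_t (P s - c * Q s) * Q t * (f s - f t) =
    (P s - c * Q s) * (f s - \sum_t Q t * f t).
    have -> : f s - \sum_t Q t * f t = \sum_t Q t * (f s - f t).
      by under [RHS]eq_bigr do rewrite mulrBr; rewrite sumrB -mulr_suml Q1 mul1r.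
    by rewrite mulr_sumr; apply: eq_bigr => t _; ring.
  under [RHS]eq_bigr do rewrite e.
  rewrite [RHS](eq_bigr (fun s => P s * f s - c * (Q s * f s) -
    (P s * (\sum_t Q t * f t) - c * (Q s * (\sum_t Q t * f t))))); last by move=> s _; ring.
  by rewrite !sumrB -!mulr_sumr -[X in _ - (X - _)]mulr_suml
    -[X in _ - (_ - _ * X)]mulr_suml P1 Q1; ring.
apply: le_trans (_ : \sum_s \sum_t (P s - c * Q s) * Q t * r <= _).
  apply: ler_sum => s _; apply: ler_sum => t _; apply: ler_wpM2l; last exact: hr.
  by rewrite mulr_ge0 // subr_ge0.
under eq_bigr do rewrite -mulr_suml -mulr_sumr Q1 mulr1.
by rewrite -mulr_suml sumrB P1 -mulr_sumr Q1 mulr1.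
Qed.

End Specification.

(** * Quasi-local functions *)

Section QuasiLocal.
Variables (R : realType) (p beta : R).
Hypotheses (p1 : 1 < p) (beta0 : 0 < beta).
Notation J := (power_law p).
Notation spin := (spin R).
Notation energy := (energy p).
Notation gibbs := (gibbs p beta).
Implicit Types (w : Omega) (F G : Omega -> R) (i k n M N : nat).

(** The spins beyond [M] act on a site [a < n] through couplings of total
strength [tail p (M - a)]. *)
Lemma energy_diff n M w w' : (n <= M)%N -> agree_upto M w w' ->
  `|energy n w - energy n w'| <= 2 * \sum_(a < n) tail p (M - a).
Proof.
move=> nM h; rewrite /energy -sumrB mulr_sumr.
apply: le_trans (ler_norm_sum _ _ _) _; apply: ler_sum => a _.
have aM : (a < M)%N by exact: leq_trans nM.
rewrite h // -mulrBr normrM spin_norm mul1r.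
by apply: field_diff => // b /andP[_]; exact: h.
Qed.

Definition uniform_cont F := forall e, 0 < e ->
  exists M, forall w w', agree_upto M w w' -> `|F w - F w'| <= e.

Definition quasi_local F := (exists C, forall w, `|F w| <= C) /\ uniform_cont F.

Lemma agree_upto_concat n (s : {ffun 'I_n -> bool}) M w w' :
  agree_upto M w w' -> agree_upto M (concat s w) (concat s w').
Proof.
move=> h k kM; have [nk|kn] := leqP n k; first by rewrite !concat_ge // h.
by rewrite !concat_lt.
Qed.

Lemma agree_upto_concatn n (s : {ffun 'I_n -> bool}) w w' :
  agree_upto n (concat s w) (concat s w').
Proof. by move=> k kn; rewrite !concat_lt. Qed.

Lemma agree_uptoC M w w' : agree_upto M w w' -> agree_upto M w' w.
Proof. by move=> h k kM; rewrite h. Qed.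

Lemma gibbs_bounded n F C w : (forall x, `|F x| <= C) -> `|gibbs n F w| <= C.
Proof.
move=> h; have h1 (c : R) : gibbs n (fun=> c) w = c.
  by rewrite gibbs_id.
rewrite ler_norml; apply/andP; split.
  by rewrite -[leLHS](h1 (- C)); apply: le_gibbs => x _; have := h x; rewrite ler_norml => /andP[].
by rewrite -[leRHS](h1 C); apply: le_gibbs => x _; have := h x; rewrite ler_norml => /andP[].
Qed.

(** Changing the exterior far away changes the energies, hence the kernel, by an
arbitrarily small amount; this is [gibbs_contract] with a small [eta]. *)
Lemma gibbs_quasi_local n F : quasi_local F -> quasi_local (gibbs n F).
Proof.
move=> [[C hC] uF]; split; first by exists C => w; exact: gibbs_bounded.
move=> e e0.
have C0 : 0 <= C by exact: le_trans (hC (fun=> true)).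
(* With total couplings at most e / (2 D) on each site, the bound of the
   contraction lemma is at most e / 2; the 1 keeps D positive. *)
pose D := 2 * beta * (2 * n%:R) * (2 * C) + 1.
have D0 : 0 < D by rewrite ltr_wpDl // !mulr_ge0 // ltW.
have e2 : 0 < e / 2 by lra.
have [M1 hM1] := uF _ e2.
have [L [L0 hL]] := tail_small p1 (divr_gt0 e2 D0).
exists (maxn M1 (n + L)).
suff h w w' : agree_upto (maxn M1 (n + L)) w w' -> gibbs n F w - gibbs n F w' <= e.
  move=> w w' ww'; rewrite ler_norml; apply/andP; split; last exact: h.
  by have := h _ _ (agree_uptoC ww'); lra.
move=> ww'.
set eta := 2 * (n%:R * (e / 2 / D)).
apply: le_trans (@gibbs_contract _ _ _ beta0 n F w w' eta (2 * C) (e / 2) _ _ _) _.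
- move=> s; have ws := agree_upto_concat s ww'.
  have nM : (n <= maxn M1 (n + L))%N by rewrite leq_max leq_addr orbT.
  apply: le_trans (energy_diff nM ws) _; rewrite /eta ler_pM2l //.
  apply: le_trans (_ : \sum_(a < n) (e / 2 / D) <= _).
    apply: ler_sum => a _; apply: hL; rewrite leq_subRL.
      by rewrite leq_max; apply/orP; right; rewrite leq_add2r ltnW.
    by apply: leq_trans nM; rewrite ltnW.
  by rewrite sumr_const card_ord mulr_natl.
- move=> x y; have := hC x; have := hC y; rewrite !ler_norml => /andP[? ?] /andP[? ?]; lra.
- move=> s; apply: le_trans (ler_norm _) _; apply: hM1.
  by move=> k kM; apply: (agree_upto_concat s ww'); rewrite leq_max kM.
have x1 : 1 - expR (- (2 * beta * eta)) <= 2 * beta * eta.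
  by have := expR_ge1Dx (- (2 * beta * eta)); lra.
have : (1 - expR (- (2 * beta * eta))) * (2 * C) <= 2 * beta * eta * (2 * C).
  by apply: ler_wpM2r => //; rewrite mulr_ge0.
suff : 2 * beta * eta * (2 * C) <= e / 2 by lra.
have -> : 2 * beta * eta * (2 * C) = (D - 1) / D * (e / 2).
  by rewrite /eta /D; field; rewrite -/D gt_eqF.
by apply: ler_piMl; [lra|rewrite ler_pdivrMr // mul1r; lra].
Qed.

Lemma past_set_dep i (A : set Omega) : past i A ->
  forall w w', agree_from i w w' -> A w -> A w'.
Proof.
move=> pA.
suff h : past i `<=` [set B | forall w w', agree_from i w w' -> B w -> B w'] by exact: h.
apply: smallest_sub; last first.
  move=> B [k [b [ik ->]]] w w' ww' /= <-; exact/esym/ww'.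
split=> /=.
- by move=> w w' _ [].
- move=> B hB w w' ww' [_ nBw]; split => // Bw'; apply: nBw.
  by apply: hB Bw' => k ik; rewrite ww'.
- move=> B hB w w' ww' [n _ Bw]; exists n => //; exact: hB Bw.
Qed.

Lemma past_indic_dep i (A : set Omega) : past i A -> past_dep i (\1_A : Omega -> R).
Proof.
move=> pA w w' ww'; rewrite !indicE; congr (_%:R); congr nat_of_bool.
apply/idP/idP; rewrite !inE; apply: (past_set_dep pA) => //.
by move=> k ik; rewrite ww'.
Qed.

Lemma ising_lssE i w : ising_lss J beta i w =
  sum_conf i (weight p beta i.+1) w / partf p beta i.+1 w.
Proof.
by rewrite /ising_lss; congr (_ / _); apply: eq_bigr => s _;
  rewrite ising_energyE // mulNr opprK.
Qed.

(** The transition kernel at [i] redraws the spin at [i] from the marginal of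
the Gibbs measure on the interval from [i] to the origin, and the event does not
depend on the spins to the right of [i]. *)
Lemma lss_kernelE i (A : set Omega) w : past i A ->
  lss_kernel (ising_lss J beta) i A w = gibbs i.+1 (\1_A : Omega -> R) w.
Proof.
move=> pA; rewrite /lss_kernel /gibbs sum_confS mulr_suml; apply: eq_bigr => b _.
rewrite ising_lssE [in RHS](_ : (fun x => _) = fun x => \1_A x * weight p beta i.+1 x).
  rewrite sum_conf_mul; last exact: past_indic_dep.
  rewrite mulrC mulrA; congr (_ * _^-1); apply: sum_conf_dep => k ik.
  by rewrite /set_spin gtn_eqF.
by apply/funext => x; rewrite mulrC.
Qed.

End QuasiLocal.

(** * Consistent laws and Gibbs kernels *)

Section Laws.
Variables (R : realType) (p beta : R).
Hypotheses (p1 : 1 < p) (beta0 : 0 < beta).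
Notation gibbs := (gibbs p beta).
Implicit Types (w : Omega) (F G : Omega -> R) (i k n M N : nat).

(** Cylinders given by finitely many coordinates.  Those on coordinates in the
past of [i] form a pi-system generating the sigma-algebra of that past. *)
Definition box (l : seq (nat * bool)) : set Omega :=
  [set x | all (fun q => x q.1 == q.2) l].

Definition boxes i : set (set Omega) :=
  [set A | exists l, all (fun q => (i <= q.1)%N) l /\ A = box l].

Lemma box_cons q l : box (q :: l) = [set x | x q.1 = q.2] `&` box l.
Proof.
apply/seteqP; split => x; rewrite /box /=; first by move=> /andP[/eqP].
by move=> [-> ->]; rewrite eqxx.
Qed.

Lemma box_cat l l' : box (l ++ l') = box l `&` box l'.
Proof. by apply/seteqP; split => x; rewrite /box /= all_cat => /andP. Qed.

Lemma boxes_setI i : setI_closed (boxes i).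
Proof.
move=> _ _ [l [il ->]] [l' [il' ->]]; exists (l ++ l').
by rewrite all_cat il il' box_cat.
Qed.

Lemma past_box i l : all (fun q => (i <= q.1)%N) l -> past i (box l).
Proof.
elim: l => [_|q l IH /= /andP[iq il]].
  rewrite (_ : box [::] = setT); last by apply/seteqP; split.
  exact: (@measurableT _ (g_sigma_algebraType (past_cylinders i))).
rewrite box_cons; apply: (@measurableI _ (g_sigma_algebraType (past_cylinders i))).
  by apply: sub_sigma_algebra; exists q.1, q.2.
exact: IH.
Qed.

Lemma past_boxes i : past i = <<s boxes i >>.
Proof.
apply/seteqP; split.
  apply: sub_sigma_algebra2 => _ [k [b [ik ->]]]; exists [:: (k, b)].
  split; first by rewrite /= ik.
  by apply/seteqP; split => x; rewrite /box /= andbT => /eqP.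
apply: smallest_sub; first exact: smallest_sigma_algebra.
by move=> _ [l [il ->]]; exact: past_box.
Qed.

Lemma past_measurable i (A : set Omega) : past i A -> measurable A.
Proof.
apply: sub_sigma_algebra2 => _ [k [b [ik ->]]]; by exists k, b.
Qed.

Lemma box_measurable l : measurable (box l).
Proof. by apply: (@past_measurable 0); apply: past_box; apply/allP. Qed.

Definition spins i n (s : {ffun 'I_n -> bool}) : seq (nat * bool) :=
  [seq (val j, s j) | j <- [seq j : 'I_n <- enum 'I_n | (i <= j)%N]].

(** The coordinates of [w] in the interval from [i] to [n - 1] and + spins elsewhere: composing with
[mask i n] approximates a quasi-local function of the past of [i] by a finite
combination of indicators of events in the past of [i]. *)
Definition mask i n w : Omega := fun k => if (i <= k < n)%N then w k else true.

Lemma mem_box_spins i n (s : {ffun 'I_n -> bool}) w :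
  box (spins i s) w <-> forall k : 'I_n, (i <= k)%N -> w k = s k.
Proof.
rewrite /box /spins /= all_map; split=> [/allP h k ik|h].
  by have := h k; rewrite mem_filter ik mem_enum => /(_ isT)/eqP.
by apply/allP => k; rewrite mem_filter => /andP[ik _] /=; rewrite h.
Qed.

Definition mask_coef i n F (s : {ffun 'I_n -> bool}) : R :=
  if [forall k : 'I_n, (k < i)%N ==> s k] then F (concat s (fun=> true)) else 0.

Lemma mask_repr i n F w : F (mask i n w) =
  \sum_(s : {ffun 'I_n -> bool}) mask_coef i F s * \1_(box (spins i s)) w.
Proof.
pose s0 : {ffun 'I_n -> bool} := [ffun k : 'I_n => if (i <= k)%N then w k else true].
rewrite (bigD1 s0) //= /mask_coef ifT; last first.
  by apply/forallP => k; rewrite ffunE ltnNge; case: leqP.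
rewrite big1 ?addr0 => [|s ns]; last first.
  case: ifP => [/forallP h|]; last by rewrite mul0r.
  rewrite indicE memNset ?mulr0 // => /mem_box_spins hs; move/eqP: ns; apply.
  apply/ffunP => k; rewrite ffunE; case: leqP => [/hs ->//|ki].
  exact: implyP (h k) ki.
rewrite indicE mem_set ?mulr1; last by apply/mem_box_spins => k ik; rewrite ffunE ik.
congr F; apply/funext => k; rewrite /mask; have [kn|nk] := ltnP k n.
  by rewrite concat_lt ffunE andbT.
by rewrite concat_ge // andbF.
Qed.

Lemma mask_close i F e n : past_dep i F ->
  (forall w w', agree_upto n w w' -> `|F w - F w'| <= e) ->
  forall w, `|F w - F (mask i n w)| <= e.
Proof.
move=> dF h w; rewrite (dF (mask i n w) (mask 0 n w)).
  by apply: h => k kn; rewrite /mask kn.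
by move=> k ik; rewrite /mask ik.
Qed.

Lemma quasi_local_indic l : quasi_local (\1_(box l) : Omega -> R).
Proof.
split; first by exists 1 => w; rewrite indicE; case: (_ \in _); rewrite ?normr1 ?normr0.
move=> e e0; exists (\max_(q <- l) q.1).+1 => w w' ww'.
rewrite !indicE (_ : (w \in box l) = (w' \in box l)) ?subrr ?normr0 ?ltW //.
apply/idP/idP; rewrite !inE /box /= => /allP h; apply/allP => q ql;
  rewrite -(eqP (h q ql)) /= ?eqxx; apply/eqP.
  by rewrite ww' // ltnS (leq_bigmax_seq _ ql).
by rewrite ww' // ltnS (leq_bigmax_seq _ ql).
Qed.

Lemma quasi_local_measurable F : quasi_local F -> measurable_fun setT F.
Proof.
move=> [_ uF]; apply: (@measurable_fun_cvg _ _ _ setT (fun n => F \o mask 0 n)).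
  move=> n; rewrite (_ : F \o _ = fun w => \sum_(s : {ffun 'I_n -> bool})
     mask_coef 0 F s * \1_(box (spins 0 s)) w).
    apply: measurable_sum => s; apply: measurable_funM => //.
    by apply: measurable_indic; exact: box_measurable.
  by apply/funext => w; rewrite /= mask_repr.
move=> w _; apply/cvgrPdist_le => e e0; have [M hM] := uF e e0.
exists M => // n /= Mn; apply: hM => k kM; by rewrite /mask /= (leq_trans kM).
Qed.

Definition tame F := measurable_fun setT F /\ exists C, forall w, `|F w| <= C.

Lemma quasi_local_tame F : quasi_local F -> tame F.
Proof. by move=> qF; split; [exact: quasi_local_measurable|case: qF]. Qed.

Lemma tame_cst c : tame (fun=> c : R).
Proof. by split => //; exists `|c|. Qed.

Lemma tameD F G : tame F -> tame G -> tame (fun w => F w + G w).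
Proof.
move=> [mF [C hC]] [mG [D hD]]; split; first exact: measurable_funD.
by exists (C + D) => w; apply: le_trans (ler_normD _ _) _; exact: lerD.
Qed.

Lemma tameM F G : tame F -> tame G -> tame (fun w => F w * G w).
Proof.
move=> [mF [C hC]] [mG [D hD]]; split; first exact: measurable_funM.
by exists (C * D) => w; rewrite normrM ler_pM.
Qed.

Lemma tame_sum (I : Type) (r : seq I) (F : I -> Omega -> R) :
  (forall j, tame (F j)) -> tame (fun w => \sum_(j <- r) F j w).
Proof.
move=> h; elim: r => [|j r IH].
  by under eq_fun do rewrite big_nil; exact: tame_cst.
by under eq_fun do rewrite big_cons; exact: tameD.
Qed.

Lemma tame_indic (A : set Omega) : measurable A -> tame (\1_A : Omega -> R).
Proof.
move=> mA; split; first exact: measurable_indic.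
by exists 1 => w; rewrite indicE; case: (_ \in _); rewrite ?normr1 ?normr0.
Qed.

Lemma measurable_to_Omega d (T : measurableType d) (f : T -> Omega) :
  (forall k b, measurable [set x | f x k = b]) -> measurable_fun setT f.
Proof.
move=> h; apply: (@measurability _ _ T Omega setT f (past_cylinders 0)) => //.
by move=> _ [_ [k [b [_ ->]]] <-]; rewrite setTI; exact: h.
Qed.

Lemma concat_measurable n (s : {ffun 'I_n -> bool}) :
  measurable_fun setT (concat s : Omega -> Omega).
Proof.
apply: measurable_to_Omega => k b; have [kn|nk] := ltnP k n; last first.
  rewrite (_ : [set x | _] = [set w : config | w k = b]).
    by apply: sub_sigma_algebra; exists k, b.
  by apply/seteqP; split => w /=; rewrite concat_ge.
have [sb|sb] := eqVneq (s (Ordinal kn)) b.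
  rewrite (_ : [set x | _] = setT); first exact: measurableT.
  by apply/seteqP; split => w //= _; rewrite concat_lt.
rewrite (_ : [set x | _] = set0); first exact: measurable0.
by apply/seteqP; split => w //=; rewrite concat_lt => /eqP; rewrite (negPf sb).
Qed.

Lemma gibbs_ge0 n F w : (forall x, 0 <= F x) -> 0 <= gibbs n F w.
Proof. by move=> F0; rewrite -(@gibbs_id _ p beta n (fun=> 0) w) //; exact: le_gibbs. Qed.

(** The probabilities of the cylinders are quasi-local, hence measurable in [w];
so is then the Gibbs mean of every measurable function. *)
Lemma gibbs_cylinders n F w : gibbs n F w = \sum_(s : {ffun 'I_n -> bool})
  gibbs n (\1_(box (spins 0 s))) w * F (concat s w).
Proof.
rewrite gibbs_sum_prob; apply: eq_bigr => s _; congr (_ * _).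
rewrite gibbs_sum_prob (bigD1 s) //= big1 ?addr0 => [|t ts].
  by rewrite indicE mem_set ?mulr1 //; apply/mem_box_spins => k _; rewrite concat_lt; congr (s _); exact/val_inj.
rewrite indicE memNset ?mulr0 // => /mem_box_spins h; case/eqP: ts; apply/ffunP => k.
by rewrite -h // concat_lt; congr (t _); exact/val_inj.
Qed.

Lemma tame_gibbs n F : tame F -> tame (gibbs n F).
Proof.
move=> [mF [C hC]]; split; last by exists C => w; exact: gibbs_bounded.
rewrite (_ : gibbs n F = fun w => \sum_(s : {ffun 'I_n -> bool})
  gibbs n (\1_(box (spins 0 s))) w * F (concat s w)); last first.
  by apply/funext => w; exact: gibbs_cylinders.
apply: measurable_sum => s; apply: measurable_funM.
  by apply: quasi_local_measurable; apply: gibbs_quasi_local => //; exact: quasi_local_indic.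
by apply: measurableT_comp => //; exact: concat_measurable.
Qed.

Lemma gibbs_close n F G e w : (forall x, `|F x - G x| <= e) -> `|gibbs n F w - gibbs n G w| <= e.
Proof.
move=> h; have -> : gibbs n F w - gibbs n G w = gibbs n (fun x => F x + -1 * G x) w.
  by rewrite gibbsD gibbsZ mulN1r.
by apply: gibbs_bounded => x; rewrite mulN1r.
Qed.

Section Expectation.
Variable mu : probability Omega R.
Definition expect F : R := \int[mu]_x F x.

Lemma tame_integrable F : tame F -> mu.-integrable setT (EFin \o F).
Proof.
move=> [mF [C hC]]; apply: measurable_bounded_integrable => //.
- exact: fin_num_fun_lty.
- exists C; split; first exact: num_real.
  by move=> x Cx w _; rewrite /= (le_trans (hC w)) // ltW.
Qed.

Lemma expectD F G : tame F -> tame G ->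
  expect (fun w => F w + G w) = expect F + expect G.
Proof. by move=> qF qG; rewrite /expect RintegralD //; exact: tame_integrable. Qed.

Lemma expectZ c F : tame F -> expect (fun w => c * F w) = c * expect F.
Proof. by move=> qF; rewrite /expect RintegralZl //; exact: tame_integrable. Qed.

Lemma expect_cst c : expect (fun=> c) = c.
Proof.
have mT : fine (mu setT) = 1 by exact: (congr1 fine (probability_setT mu)).
rewrite /expect Rintegral_cst //; apply: etrans (mulr1 c); congr (_ * _).
exact: mT.
Qed.

Lemma expect_sum (I : Type) (r : seq I) (F : I -> Omega -> R) :
  (forall j, tame (F j)) ->
  expect (fun w => \sum_(j <- r) F j w) = \sum_(j <- r) expect (F j).
Proof.
move=> h; elim: r => [|j r IH].
  by rewrite (_ : (fun _ => _) = fun=> 0) ?expect_cst ?big_nil //; apply/funext => w; rewrite big_nil.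
rewrite big_cons -IH -expectD //; last exact: tame_sum.
by congr expect; apply/funext => w; rewrite big_cons.
Qed.

Lemma expect_close F G e : tame F -> tame G ->
  (forall w, `|F w - G w| <= e) -> `|expect F - expect G| <= e.
Proof.
move=> qF qG h; have le_e A B : tame A -> tame B ->
    (forall w, A w <= B w + e) -> expect A <= expect B + e.
  move=> qA qB hAB; rewrite -[X in _ <= _ + X](expect_cst e) -expectD //; last exact: tame_cst.
  apply: le_Rintegral => //; apply: tame_integrable => //.
  by apply: tameD => //; exact: tame_cst.
rewrite ler_norml; apply/andP; split.
  rewrite lerNl opprB lerBlDr addrC; apply: le_e => // w.
  by have := h w; rewrite ler_norml => /andP[? ?]; lra.
rewrite lerBlDr addrC; apply: le_e => // w.
by have := h w; rewrite ler_norml => /andP[? ?]; lra.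
Qed.

Lemma expectE F : tame F -> (expect F)%:E = (\int[mu]_x (F x)%:E)%E.
Proof.
move=> tF; rewrite /expect /Rintegral fineK //.
by apply: integrable_fin_num => //; exact: (tame_integrable tF).
Qed.

Lemma expect_indic (A : set Omega) : measurable A -> (expect (\1_A))%:E = mu A.
Proof.
move=> mA; rewrite /expect /Rintegral integral_indic // setIT fineK //.
exact: fin_num_measure.
Qed.

Lemma tame_mask i n F : tame (fun w => F (mask i n w)).
Proof.
rewrite (_ : (fun _ => _) = fun w => \sum_(s : {ffun 'I_n -> bool})
   mask_coef i F s * \1_(box (spins i s)) w).
  by apply: tame_sum => s; apply: tameM; [exact: tame_cst|apply: tame_indic; exact: box_measurable].
by apply/funext => w; rewrite mask_repr.
Qed.

(** Consistency at [i] extends from events to quasi-local functions of the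
past of [i] by approximation.  As [gibbs n F] is such a function for [i = n],
and [gibbs n.+1 (gibbs n F) = gibbs n.+1 F], the claim follows by induction
on [n]. *)
Lemma consistent_quasi_local : consistent (ising_lss (power_law p) beta) mu ->
  forall n F, quasi_local F -> expect (gibbs n F) = expect F.
Proof.
move=> hmu.
have box_inv i l : all (fun q => (i <= q.1)%N) l ->
    expect (gibbs i.+1 (\1_(box l))) = expect (\1_(box l)).
  move=> il; have pA := past_box il; have mA := box_measurable l.
  apply: EFin_inj; rewrite expect_indic // -(hmu i _ pA) expectE.
    by apply: eq_integral => w _; rewrite lss_kernelE.
  by apply: tame_gibbs; exact: tame_indic.
have past_inv i F : quasi_local F -> past_dep i F -> expect (gibbs i.+1 F) = expect F.
  move=> qF dF; have tF := quasi_local_tame qF.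
  apply/eqP; rewrite -subr_eq0 -normr_le0; apply/ler_addgt0Pr => e e0; rewrite add0r.
  have e2 : 0 < e / 2 by lra.
  have [M hM] := qF.2 _ e2; have cl := mask_close dF hM.
  pose G w := F (mask i M w); have tG : tame G by exact: tame_mask.
  have GE : G = fun w => \sum_(s : {ffun 'I_M -> bool})
      mask_coef i F s * \1_(box (spins i s)) w.
    by apply/funext => w; rewrite /G mask_repr.
  have tS (s : {ffun 'I_M -> bool}) : tame (\1_(box (spins i s)) : Omega -> R).
    by apply: tame_indic; exact: box_measurable.
  have EG : expect (gibbs i.+1 G) = expect G.
    rewrite (_ : gibbs i.+1 G = fun w => \sum_(s : {ffun 'I_M -> bool})
      mask_coef i F s * gibbs i.+1 (\1_(box (spins i s))) w); last first.
      by apply/funext => w; rewrite GE gibbs_sum; apply: eq_bigr => s _; rewrite gibbsZ.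
    rewrite GE !expect_sum; last 2 first.
    - by move=> s; apply: tameM; [exact: tame_cst|exact: tS].
    - by move=> s; apply: tameM; [exact: tame_cst|apply: tame_gibbs; exact: tS].
    apply: eq_bigr => s _; rewrite !expectZ ?box_inv //; last by apply: tame_gibbs; exact: tS.
    by rewrite /spins all_map; apply/allP => k; rewrite mem_filter => /andP[].
  have h1 : `|expect (gibbs i.+1 F) - expect (gibbs i.+1 G)| <= e / 2.
    by apply: expect_close => [||w]; [exact: tame_gibbs|exact: tame_gibbs|exact: gibbs_close].
  have h2 : `|expect F - expect G| <= e / 2 by exact: expect_close.
  rewrite EG in h1; move: h1 h2; rewrite !ler_norml => /andP[? ?] /andP[? ?].
  by apply/andP; split; lra.
move=> n F qF; elim: n => [|n IH].
  by congr expect; apply/funext => w; rewrite gibbs_id // => x y xy; congr F; apply/funext => k; exact: xy.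
rewrite -IH -[RHS](past_inv n).
- by congr expect; apply/funext => w; rewrite gibbs_gibbsS.
- exact: gibbs_quasi_local.
- exact: gibbs_dep.
Qed.

(** Both sides of the consistency equation are measures in the event, so that
it is enough to check it on a generating pi-system. *)
Lemma quasi_local_consistent :
  (forall n l, expect (gibbs n (\1_(box l))) = expect (\1_(box l))) ->
  consistent (ising_lss (power_law p) beta) mu.
Proof.
move=> hbox i A pA.
transitivity (\int[mu]_w (gibbs i.+1 (\1_A) w)%:E)%E.
  by apply: eq_integral => w _; rewrite lss_kernelE.
have pA' : <<s boxes i >> A by rewrite -past_boxes.
move: A {pA} pA'.
apply: (@dynkin_induction _ (g_sigma_algebraType (past_cylinders i)) (boxes i)
  (fun A => \int[mu]_w (gibbs i.+1 (\1_A) w)%:E = mu A)%E).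
- exact: past_boxes.
- exact: boxes_setI.
- rewrite -expectE; last by apply: tame_gibbs; exact: tame_indic.
  rewrite -(expect_indic measurableT); congr (_%:E).
  congr expect; apply/funext => w.
  by rewrite gibbs_id // => x y _; rewrite !indicE !in_setT.
- move=> _ [l [il ->]]; have mA := box_measurable l.
  rewrite -expectE; last by apply: tame_gibbs; exact: tame_indic.
  by rewrite hbox expect_indic.
- move=> A /past_measurable mA.
  have tA := tame_indic mA; have tAC := tame_indic (measurableC mA).
  rewrite -!expectE; [|exact: tame_gibbs|exact: tame_gibbs].
  rewrite -!expect_indic //; last exact: measurableC.
  have -> : \1_(~` A) = (fun w => 1 + -1 * \1_A w) :> (Omega -> R).
    by apply/funext => w; rewrite !indicE in_setC; case: (_ \in _) => /=; ring.
  move=> [hA]; congr (_%:E).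
  have tG : tame (gibbs i.+1 (\1_A)) by exact: tame_gibbs.
  have tnA : tame (fun w => -1 * \1_A w) by apply: tameM => //; exact: tame_cst.
  have tnG : tame (fun w => -1 * gibbs i.+1 (\1_A) w) by apply: tameM => //; exact: tame_cst.
  have t1 := tame_cst 1.
  rewrite expectD // expectZ // -hA -expectZ // -expectD //.
  by congr expect; apply/funext => w; rewrite gibbsD gibbsZ gibbs1.
- move=> F mF tF hF.
  have mF' k : @measurable _ Omega (F k) := past_measurable (mF k : past i (F k)).
  transitivity (\int[mu]_w (\sum_(0 <= k <oo) (gibbs i.+1 (\1_(F k)) w)%:E))%E.
    apply: eq_integral => w _.
    rewrite gibbs_cylinders -sumEFin.
    under [RHS]eq_eseriesr do rewrite gibbs_cylinders -sumEFin.
    rewrite nneseries_sum => [|s k _]; last first.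
      by rewrite lee_fin mulr_ge0 ?gibbs_ge0 // => ?; rewrite indicE.
    apply: eq_bigr => s _; under eq_eseriesr do rewrite EFinM.
    rewrite nneseriesZl => [|k _]; last by rewrite lee_fin indicE.
    rewrite EFinM; congr (_ * _)%E.
    have dE (B : set Omega) x : (\1_B x)%:E = @dirac _ Omega x R B by rewrite diracE indicE.
    under eq_eseriesr do rewrite dE.
    by rewrite dE measure_semi_bigcup //; exact: bigcup_measurable.
  rewrite integral_nneseries //; last 2 first.
  + move=> k; apply/measurable_EFinP.
    by have [] : tame (gibbs i.+1 (\1_(F k))) by apply: tame_gibbs; exact: tame_indic.
  + by move=> k w _; rewrite lee_fin gibbs_ge0 // => ?; rewrite indicE.
  under eq_eseriesr do rewrite hF.
  by rewrite measure_semi_bigcup //; exact: bigcup_measurable.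
Qed.

End Expectation.

End Laws.

(** * Extension of finite-dimensional distributions *)

Section Extension.
Variables (R : realType).

Lemma uniform_law_ex :
  exists P0 : probability (measurableTypeR R) R,
    forall A, P0 A = lebesgue_measure (A `&` `[0, 1[).
Proof.
pose D : set (measurableTypeR R) := `[0, 1[%classic.
have mD : measurable D by exact: measurable_itv.
have e : mrestr (@lebesgue_measure R) mD setT = 1%E.
  by rewrite /mrestr setTI lebesgue_measure_itv /= lte01 oppr0 adde0.
pose P0 : probability (measurableTypeR R) R := HB.pack (mrestr (@lebesgue_measure R) mD)
  (Measure_isProbability.Build _ _ R (mrestr (@lebesgue_measure R) mD) e).
by exists P0.
Qed.

Variable m : nat -> Omega -> R.
Hypothesis m_dep : forall n w w', agree_upto n w w' -> m n w = m n w'.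
Hypothesis m0 : forall w, m 0 w = 1.
Hypothesis m_ge0 : forall n w, 0 <= m n w.
Hypothesis mS : forall n w, m n w = m n.+1 (set_spin n false w) + m n.+1 (set_spin n true w).

(** The left end of the interval of the prefix of length [n] of [w].  The
interval of a prefix is cut into the one with the next spin -, on the left, and
the one with the next spin +. *)
Fixpoint left_end n (w : Omega) : R :=
  if n is k.+1 then
    left_end k w + (if w k then m k.+1 (set_spin k false w) else 0)
  else 0.

Fixpoint digits (u : R) n : Omega :=
  if n is k.+1 then
    set_spin k (left_end k (digits u k) + m k.+1 (set_spin k false (digits u k)) <= u)
      (digits u k)
  else fun=> true.

Definition expansion (u : R) : Omega := fun k => digits u k.+1 k.

Lemma left_end_dep n w w' : agree_upto n w w' -> left_end n w = left_end n w'.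
Proof.
elim: n => //= n IH ww'; rewrite IH => [|k kn]; last by apply: ww'; exact: ltnW.
rewrite ww' //; case: (w' n) => //; congr (_ + _); apply: m_dep => k kn.
rewrite /set_spin; case: eqP => // kn'; apply: ww'.
by rewrite ltnS leq_eqVlt in kn; case/predU1P: kn => // kn; exact: ltnW.
Qed.

Lemma digits_expansion u n : agree_upto n (digits u n) (expansion u).
Proof.
elim: n => // n IH k; rewrite ltnS leq_eqVlt => /predU1P[->//|kn].
by rewrite /= /set_spin ltn_eqF // IH.
Qed.

Definition threshold n w : R := left_end n w + m n.+1 (set_spin n false w).

Lemma threshold_dep n w w' : agree_upto n w w' -> threshold n w = threshold n w'.
Proof.
move=> ww'; rewrite /threshold (left_end_dep ww'); congr (_ + _); apply: m_dep => k.
rewrite ltnS leq_eqVlt => /predU1P[->|kn]; first by rewrite /set_spin eqxx.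
by rewrite /set_spin ltn_eqF // ww'.
Qed.

Lemma expansionE u n : expansion u n = (threshold n (expansion u) <= u).
Proof.
by rewrite {1}/expansion /= /set_spin eqxx -(threshold_dep (@digits_expansion u n)).
Qed.

Lemma left_endS_true n w : w n = true -> left_end n.+1 w = threshold n w /\
  left_end n.+1 w + m n.+1 w = left_end n w + m n w.
Proof.
move=> wn; rewrite /threshold /= wn; split => //.
rewrite (mS n w) (m_dep (w := w) (w' := set_spin n true w)); first by ring.
by move=> k kn; rewrite /set_spin; case: eqP => // ->.
Qed.

Lemma left_endS_false n w : w n = false -> left_end n.+1 w = left_end n w /\
  left_end n.+1 w + m n.+1 w = threshold n w.
Proof.
move=> wn; rewrite /threshold /= wn addr0; split => //; congr (_ + _).
by apply: m_dep => k kn; rewrite /set_spin; case: eqP => // ->.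
Qed.

Lemma threshold_bounds n w : left_end n w <= threshold n w <= left_end n w + m n w.
Proof.
by rewrite /threshold (mS n w) lerDl m_ge0 lerD2l lerDl m_ge0.
Qed.

Lemma expansion_interval u n w : 0 <= u < 1 ->
  (agree_upto n (expansion u) w <-> left_end n w <= u < left_end n w + m n w).
Proof.
move=> u01; elim: n => [|n IH]; first by rewrite /= m0 add0r; split.
have /andP[tl tr] := threshold_bounds n w.
split=> [h|].
  have h' : agree_upto n (expansion u) w by move=> k kn; apply: h; exact: ltnW.
  have /andP[hl hr] := (IH.1 h').
  have := expansionE u n; rewrite (threshold_dep h') (h n) //.
  case wn : (w n) => /esym hu.
    by have [-> ->] := left_endS_true wn; rewrite hu hr.
  have [-> ->] := left_endS_false wn; rewrite hl /=; by rewrite ltNge hu.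
move=> hu.
have h' : agree_upto n (expansion u) w.
  apply: IH.2; case wn : (w n) hu.
    by have [-> ->] := left_endS_true wn => /andP[h ->]; rewrite (le_trans tl).
  by have [-> ->] := left_endS_false wn => /andP[-> h]; rewrite (lt_le_trans h).
move=> k; rewrite ltnS leq_eqVlt => /predU1P[->|kn]; last exact: h'.
rewrite expansionE (threshold_dep h'); case wn : (w n) hu.
  by have [-> ->] := left_endS_true wn => /andP[-> _].
by have [-> ->] := left_endS_false wn => /andP[_ h]; apply/negbTE; rewrite -ltNge.
Qed.

Lemma left_end_bounds n w : 0 <= left_end n w /\ left_end n w + m n w <= 1.
Proof.
elim: n => [|n [IH1 IH2]]; first by rewrite /= m0 add0r.
have /andP[tl tr] := threshold_bounds n w.
case wn : (w n).
  by have [-> ->] := left_endS_true wn; split => //; exact: le_trans tl.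
by have [-> ->] := left_endS_false wn; split => //; exact: le_trans IH2.
Qed.

Definition prefix_set n w : set Omega := [set x | agree_upto n x w].

Lemma preimage_prefix n w :
  expansion @^-1` (prefix_set n w) `&` `[0, 1[%classic =
  `[left_end n w, left_end n w + m n w[%classic.
Proof.
have [l0 l1] := left_end_bounds n w.
apply/seteqP; split => u /=.
  by rewrite !in_itv /= => -[h u01]; apply: (expansion_interval n w u01).1.
rewrite !in_itv /= => /andP[h1 h2].
have u01 : 0 <= u < 1 by rewrite (le_trans l0 h1) (lt_le_trans h2).
by split => //; apply: (expansion_interval n w u01).2; rewrite h1.
Qed.

(** A point [u] of the unit interval is sent to the sequence of its successive
positions in nested partitions into intervals, where the interval of the prefix
of length [n] of [w] has length [m n w]. *)
Lemma extension_ex : exists mu : probability Omega R,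
  forall n w, mu (prefix_set n w) = (m n w)%:E.
Proof.
have [P0 P0E] := uniform_law_ex.
pose Y (u : measurableTypeR R) : Omega := if u \in `[0, 1[%classic then expansion u else fun=> true.
have mY : measurable_fun setT Y.
  apply: measurable_to_Omega => k b.
  rewrite (_ : [set x | _] =
    (\bigcup_(s in [set s : {ffun 'I_k.+1 -> bool} | s ord_max = b])
       (expansion @^-1` (prefix_set k.+1 (concat s (fun=> true))) `&` `[0, 1[%classic)) `|`
    (if b then ~` `[0, 1[%classic else set0)).
    apply: measurableU; last first.
      case: b; last exact: measurable0.
      by apply: measurableC; exact: measurable_itv.
    apply: fin_bigcup_measurable; first exact: finite_finset.
    by move=> s _; rewrite preimage_prefix; exact: measurable_itv.
  apply/seteqP; split=> u.
    rewrite /= /Y; case: ifPn => [u01 ub|u01 /= <-]; last first.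
      by right; rewrite /= => h; move: u01; rewrite mem_set.
    left; exists [ffun j : 'I_k.+1 => expansion u (val j)]; first by rewrite /= ffunE.
    split; last by rewrite inE in u01.
    by move=> j jk; rewrite concat_lt ffunE.
  move=> [[s /= sb [h u01]]|]; last first.
    by case: b => //= h; rewrite /Y memNset.
  rewrite /Y mem_set // h // concat_lt -sb; congr (s _); exact/val_inj.
pose X : {mfun measurableTypeR R >-> Omega} := HB.pack Y (isMeasurableFun.Build _ _ _ _ Y mY).
exists (distribution P0 X) => n w.
apply: (etrans (P0E (Y @^-1` (prefix_set n w)))).
have -> : Y @^-1` (prefix_set n w) `&` `[0, 1[%classic =
    `[left_end n w, left_end n w + m n w[%classic.
  rewrite -preimage_prefix; apply/seteqP; split=> u [/= h u01]; split => //.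
    by move: h; rewrite /Y mem_set.
  by rewrite /Y mem_set.
rewrite lebesgue_measure_itv /= lte_fin ltrDl.
have [m00|] := ltP 0 (m n w); first by rewrite -EFinB; congr (_%:E); ring.
by move=> mle; congr (_%:E); apply/eqP; rewrite eq_le mle m_ge0.
Qed.

End Extension.

(** * Infinite-volume limits of Gibbs kernels *)

Section GibbsLimit.
Variable R : realType.
Implicit Types (F G : Omega -> R) (w : Omega).

Section UltraLimit.
Variables (p beta : R).
Hypotheses (p1 : 1 < p) (beta0 : 0 < beta).
Notation gibbs := (gibbs p beta).
Variables (w0 : Omega) (N : nat -> nat).
Hypothesis leN : forall j, (j <= N j)%N.

Definition bounded_fun F := exists C, forall w, `|F w| <= C.

Context (U : set_system nat) {UU : UltraFilter U}.
Hypothesis sU : \oo `<=` U.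

(** Along an ultrafilter every bounded sequence converges, so that no
subsequence has to be extracted and [glim] is linear. *)
Definition glim F : R := lim ((fun j => gibbs (N j) F w0) @ U).

Lemma glim_cvg F : bounded_fun F -> (fun j => gibbs (N j) F w0) @ U --> glim F.
Proof.
move=> [C hC]; apply/cvg_ex; pose u j := gibbs (N j) F w0.
have FA : (u @ U) [set` `[- C, C]].
  have h : u @^-1` [set` `[- C, C]] = setT.
    by apply/seteqP; split => // j _; rewrite /= in_itv /= -ler_norml /u; exact: gibbs_bounded hC.
  have hT : U setT by exact: filterT.
  by rewrite -h in hT; exact: hT.
have [l [_ hl]] := @segment_compact R (- C) C (u @ U) _ FA.
exists l => A /= Al; have [//|UnA] := in_ultra_setVsetC (u @^-1` A) UU.
by have [x [nAx Ax]] := hl (~` A) A UnA Al.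
Qed.

Lemma glim_eq F G : (\forall j \near \oo, gibbs (N j) F w0 = gibbs (N j) G w0) ->
  glim F = glim G.
Proof.
move=> h; rewrite /glim; congr (lim _); apply/seteqP; split => A; rewrite /fmap /= => hA;
  apply: filterS2 hA (sU h) => j; rewrite /=.
  by move=> ? <-.
by move=> ? ->.
Qed.

Lemma glim_gibbs n F : glim (gibbs n F) = glim F.
Proof.
apply: glim_eq; exists n => // j /= nj; apply: gibbs_gibbs => //.
exact: leq_trans (leN j).
Qed.

Lemma boundedD F G : bounded_fun F -> bounded_fun G -> bounded_fun (fun w => F w + G w).
Proof.
move=> [C hC] [D hD]; exists (C + D) => w.
by apply: le_trans (ler_normD _ _) _; exact: lerD.
Qed.

Lemma boundedZ c F : bounded_fun F -> bounded_fun (fun w => c * F w).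
Proof. by move=> [C hC]; exists (`|c| * C) => w; rewrite normrM ler_wpM2l. Qed.

Lemma bounded_indic (A : set Omega) : bounded_fun (\1_A : Omega -> R).
Proof. by exists 1 => w; rewrite indicE; case: (_ \in _); rewrite ?normr1 ?normr0. Qed.

Lemma glimD F G : bounded_fun F -> bounded_fun G ->
  glim (fun w => F w + G w) = glim F + glim G.
Proof.
move=> bF bG; apply: (@cvg_lim _ (@Rhausdorff R)).
under eq_fun do rewrite gibbsD.
by apply: cvgD; exact: glim_cvg.
Qed.

Lemma glimZ c F : bounded_fun F -> glim (fun w => c * F w) = c * glim F.
Proof.
move=> bF; apply: (@cvg_lim _ (@Rhausdorff R)).
under eq_fun do rewrite gibbsZ.
by apply: cvgMr; exact: glim_cvg.
Qed.

Lemma glim_cst c : glim (fun=> c) = c.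
Proof.
apply: (@cvg_lim _ (@Rhausdorff R)); rewrite (_ : (fun j => _) = fun=> c); first exact: cvg_cst.
by apply/funext => j; rewrite gibbs_id.
Qed.

Lemma glim_sum (I : Type) (r : seq I) (F : I -> Omega -> R) :
  (forall i, bounded_fun (F i)) ->
  bounded_fun (fun w => \sum_(i <- r) F i w) /\
  glim (fun w => \sum_(i <- r) F i w) = \sum_(i <- r) glim (F i).
Proof.
move=> h; elim: r => [|i r [IH1 IH2]].
  under eq_fun do rewrite big_nil; rewrite big_nil glim_cst; split => //.
  by exists 0 => w; rewrite normr0.
under eq_fun do rewrite big_cons; rewrite big_cons -IH2 glimD //; split => //.
exact: boundedD.
Qed.

Lemma glim_ge F c : bounded_fun F -> (forall j, c <= gibbs (N j) F w0) -> c <= glim F.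
Proof.
move=> bF h; rewrite /glim; apply: limr_ge.
  by apply/cvg_ex; exists (glim F); exact: glim_cvg.
by apply: nearW.
Qed.

Lemma glim_close F G e : bounded_fun F -> bounded_fun G ->
  (forall w, `|F w - G w| <= e) -> `|glim F - glim G| <= e.
Proof.
move=> bF bG h; have bN : bounded_fun (fun w => -1 * G w) by exact: boundedZ.
have key (A B : Omega -> R) : bounded_fun A -> bounded_fun B ->
    (forall w, `|A w - B w| <= e) -> - e <= glim A - glim B.
  move=> bA bB hAB; rewrite -[X in _ + X]mulN1r -glimZ // -glimD //; last exact: boundedZ.
  apply: glim_ge => [|j]; first by apply: boundedD => //; exact: boundedZ.
  rewrite gibbsD gibbsZ mulN1r; have := @gibbs_close R p beta (N j) A B e w0 hAB.
  by rewrite ler_norml => /andP[].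
rewrite ler_norml key //= -lerN2 opprB key // => w; by rewrite distrC.
Qed.

Lemma box_prefix n (s : {ffun 'I_n -> bool}) :
  box (spins 0 s) = prefix_set n (concat s (fun=> true)).
Proof.
apply/seteqP; split => x.
  by move=> /mem_box_spins h k kn; rewrite concat_lt -(h (Ordinal kn)).
by move=> h; apply/mem_box_spins => k _; rewrite h // concat_lt; congr (s _); exact/val_inj.
Qed.

Lemma gibbs_limit_law : exists mu : probability Omega R,
  forall F, quasi_local F -> expect mu F = glim F.
Proof.
have [||||mu hmu] := @extension_ex R (fun n w => glim (\1_(prefix_set n w))).
- move=> n w w' ww'; congr (glim (\1_ _)); apply/seteqP; split => x h k kn.
    by rewrite h // ww'.
  by rewrite h // ww'.
- move=> w; rewrite -[RHS]glim_cst; congr glim; apply/funext => x.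
  by rewrite indicE mem_set.
- move=> n w; apply: glim_ge; first exact: bounded_indic.
  by move=> j; apply: gibbs_ge0 => x; rewrite indicE.
- move=> n w; rewrite -glimD; try exact: bounded_indic; congr glim; apply/funext => x.
  have pS b : prefix_set n.+1 (set_spin n b w) x <-> prefix_set n w x /\ x n = b.
    split=> [h|[h hb] k].
      split=> [k kn|]; first by have := h k (ltnW kn); rewrite /set_spin ltn_eqF.
      by have := h n (ltnSn n); rewrite /set_spin eqxx.
    rewrite ltnS leq_eqVlt => /predU1P[->|kn]; first by rewrite /set_spin eqxx.
    by rewrite /set_spin ltn_eqF // h.
  rewrite !indicE.
  have [h|h] := pselect (prefix_set n w x); last first.
    by rewrite !memNset ?addr0 // => /pS[].
  rewrite (mem_set h); case xn : (x n).
    rewrite memNset ?add0r ?mem_set //; first by apply/pS.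
    by move=> /pS[_]; rewrite xn.
  rewrite mem_set ?memNset ?addr0 //; first by move=> /pS[_]; rewrite xn.
  by apply/pS.
exists mu => F qF; have tF := quasi_local_tame qF; have bF : bounded_fun F by case: qF.
apply/eqP; rewrite -subr_eq0 -normr_le0; apply/ler_addgt0Pr => e e0; rewrite add0r.
have e2 : 0 < e / 2 by lra.
have [M hM] := qF.2 _ e2.
have cl : forall w, `|F w - F (mask 0 M w)| <= e / 2.
  by apply: mask_close hM => w w' ww'; congr F; apply/funext => k; exact: ww'.
pose G w := F (mask 0 M w).
have GE : G = fun w => \sum_(s : {ffun 'I_M -> bool})
    mask_coef 0 F s * \1_(box (spins 0 s)) w.
  by apply/funext => w; rewrite /G mask_repr.
have bS (s : {ffun 'I_M -> bool}) :
    bounded_fun (fun w => mask_coef 0 F s * \1_(box (spins 0 s)) w).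
  by apply: boundedZ; exact: bounded_indic.
have bG : bounded_fun G by rewrite GE; exact: (glim_sum _ bS).1.
have EG : expect mu G = glim G.
  rewrite GE (glim_sum _ bS).2 expect_sum; last first.
    by move=> s; apply: tameM; [exact: tame_cst|apply: tame_indic; exact: box_measurable].
  apply: eq_bigr => s _; have mB := box_measurable (spins 0 s).
  rewrite expectZ; last exact: tame_indic.
  rewrite glimZ; last exact: bounded_indic.
  by congr (_ * _); apply: EFin_inj; rewrite expect_indic // box_prefix hmu.
have h1 : `|expect mu F - expect mu G| <= e / 2.
  by apply: expect_close => //; exact: tame_mask.
have h2 := glim_close bF bG cl; rewrite EG in h1.
move: h1 h2; rewrite !ler_norml => /andP[? ?] /andP[? ?].
by apply/andP; split; lra.
Qed.

End UltraLimit.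

(** The law is the limit of the Gibbs kernels with exterior [w0]; it is
consistent since [gibbs (N j) (gibbs n F) = gibbs (N j) F] as soon as
[n <= N j]. *)
Lemma gibbs_limit (p beta : R) w0 (N : nat -> nat) : 1 < p -> 0 < beta -> (forall j, (j <= N j)%N) ->
  exists2 mu : probability Omega R,
  consistent (ising_lss (power_law p) beta) mu &
  forall F c, quasi_local F -> (forall j, c <= gibbs p beta (N j) F w0) -> c <= expect mu F.
Proof.
move=> p1 beta0 leN.
have [U [UU sU]] : exists U : set_system nat, UltraFilter U /\ (\oo `<=` U).
  by have [U [? ?]] := @ultraFilterLemma nat \oo _; exists U.
have [mu hmu] := @gibbs_limit_law p beta w0 N U UU; exists mu.
  apply: quasi_local_consistent => // n l; have qB := quasi_local_indic R l.
  rewrite !hmu //; last exact: gibbs_quasi_local.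
  by apply: glim_gibbs.
move=> F c qF h; rewrite hmu //; apply: glim_ge => //; by case: qF.
Qed.

End GibbsLimit.

(** * Uniqueness from vanishing oscillation *)

Section Uniqueness.
Variables (R : realType) (p beta : R).
Hypotheses (p1 : 1 < p) (beta0 : 0 < beta).
Notation gibbs := (gibbs p beta).
Implicit Types (F G : Omega -> R) (w x y : Omega).

Definition osc_le F r := forall x y, F x - F y <= r.

(** A consistent law gives to an event the mean of its Gibbs probability, which
is almost constant in the exterior. *)
Lemma exactly_one_of_osc :
  (forall l e, 0 < e -> exists n, osc_le (gibbs n (\1_(box l))) e) ->
  exactly_one_law (consistent (ising_lss (power_law p) beta)).
Proof.
move=> h.
have [mu cmu _] := gibbs_limit (fun=> true) p1 beta0 (fun j => leqnn j).
exists mu => // nu cnu A mA.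
apply: (measure_unique (boxes 0) (fun=> setT)) => //.
- exact: past_boxes.
- exact: boxes_setI.
- by move=> _; exists [::]; split => //; apply/seteqP; split.
- by rewrite bigcup_const.
- move=> _ [l [_ ->]]; have mB := box_measurable l.
  apply: (etrans (esym (expect_indic mu mB)) (etrans _ (expect_indic nu mB))).
  congr (_%:E); have qB := quasi_local_indic R l.
  rewrite -(consistent_quasi_local p1 beta0 cmu 0 qB).
  apply/eqP; rewrite -subr_eq0 -normr_le0; apply/ler_addgt0Pr => e e0; rewrite add0r.
  have [n hn] := h l (e / 2) (divr_gt0 e0 (ltr0Sn _ 1)).
  pose w1 : Omega := fun=> true.
  have close (m : probability Omega R) : consistent (ising_lss (power_law p) beta) m ->
      `|expect m (\1_(box l)) - gibbs n (\1_(box l)) w1| <= e / 2.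
    move=> cm; rewrite -(consistent_quasi_local p1 beta0 cm n qB).
    rewrite -[X in _ - X](expect_cst m); apply: expect_close.
    - by apply: tame_gibbs => //; apply: tame_indic; exact: box_measurable.
    - exact: tame_cst.
    - by move=> x; rewrite ler_norml lerNl opprB !hn.
  have := close _ cmu; have := close _ cnu.
  rewrite (consistent_quasi_local p1 beta0 cmu 0 qB) !ler_norml => /andP[? ?] /andP[? ?].
  by apply/andP; split; lra.
- by move=> _; exact: fin_num_fun_lty.
Qed.

Lemma exists_expr_le (q e : R) : 0 <= q < 1 -> 0 < e -> exists k, q ^+ k <= e.
Proof.
move=> /andP[q0 q1] e0.
have /cvgrPdist_le/(_ e e0) [k _ h] : q ^+ n @[n --> \oo] --> (0 : R).
  by apply: cvg_expr; rewrite ger0_norm.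
exists k; have := h k (leqnn k); rewrite sub0r normrN; apply: le_trans; exact: ler_norm.
Qed.

Lemma indic_osc (A : set Omega) : osc_le (\1_A : Omega -> R) 1.
Proof. by move=> x y; rewrite !indicE; case: (_ \in _); case: (_ \in _) => /=; lra. Qed.

Lemma gibbs_osc n F r w w' : osc_le F r -> gibbs n F w - gibbs n F w' <= r.
Proof.
move=> h; have c (z : R) v : gibbs n (fun=> z) v = z by rewrite gibbs_id.
have h1 x : gibbs n F w <= F x + r.
  by rewrite -(c (F x + r) w); apply: le_gibbs => y _; have := h y x; lra.
rewrite lerBlDr addrC -lerBlDr.
by rewrite -(c (gibbs n F w - r) w'); apply: le_gibbs => y _; rewrite lerBlDr; exact: h1.
Qed.

(** The Gibbs measures on a large interval with arbitrary exteriors have a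
common part of fixed mass [c]; since [gibbs n] is quasi-local, averaging it over a
larger interval multiplies its oscillation by a factor close to [1 - c]. *)
Lemma unique_if_boundary_bounded C :
  (forall n, \sum_(a < n) tail p (n - a) <= C) ->
  exactly_one_law (consistent (ising_lss (power_law p) beta)).
Proof.
move=> hC; apply: exactly_one_of_osc => l e e0.
pose c := expR (- (2 * beta * (2 * C))); have c0 : 0 < c by exact: expR_gt0.
have C0 : 0 <= C by have := hC 0%N; rewrite big_ord0.
have c1 : c <= 1 by rewrite expR_le1 oppr_le0 !mulr_ge0 // ltW.
have step n r : 0 < r -> osc_le (gibbs n (\1_(box l))) r ->
    exists N, osc_le (gibbs N (\1_(box l))) ((1 - c / 2) * r).
  move=> r0 hr.
  have qF : quasi_local (gibbs n (\1_(box l))).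
    by apply: gibbs_quasi_local => //; exact: quasi_local_indic.
  (* Half of the gain c is given up to the spins beyond M. *)
  have [M hM] := qF.2 (c / 2 * r) (mulr_gt0 (divr_gt0 c0 (ltr0Sn _ 1)) r0).
  exists (maxn M n) => x y; rewrite -(gibbs_gibbs p beta (\1_(box l)) x (leq_maxr M n)).
  rewrite -(gibbs_gibbs p beta (\1_(box l)) y (leq_maxr M n)).
  apply: le_trans (@gibbs_contract _ _ _ beta0 _ _ x y (2 * C) r (c / 2 * r) _ _ _) _.
  - move=> s; apply: le_trans (energy_diff p1 (leqnn _) (agree_upto_concatn s x y)) _.
    by rewrite ler_pM2l.
  - exact: hr.
  - move=> s; apply: le_trans (ler_norm _) _; apply: hM => k kM.
    by apply: agree_upto_concatn; rewrite (leq_trans kM) ?leq_maxl.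
  by rewrite -/c; lra.
have q01 : 0 <= 1 - c / 2 < 1 by apply/andP; split; lra.
have [k hk] := exists_expr_le q01 e0.
suff [n hn] : exists n, osc_le (gibbs n (\1_(box l))) ((1 - c / 2) ^+ k).
  by exists n => x y; apply: le_trans (hn x y) hk.
have q0 : 0 < 1 - c / 2 by lra.
elim: k {hk} => [|k [n hn]].
  exists 0%N => x y; rewrite expr0 !gibbs_id; first exact: indic_osc.
  - by move=> v v' vv'; congr (\1_ _ _); apply/funext => j; exact: vv'.
  - by move=> v v' vv'; congr (\1_ _ _); apply/funext => j; exact: vv'.
by rewrite exprS; apply: step hn; exact: exprn_gt0.
Qed.

End Uniqueness.

(** * Comparison of finite-volume Gibbs measures *)

Section Dobrushin.
Variables (R : realType) (p beta : R).
Hypotheses (p1 : 1 < p) (beta0 : 0 < beta).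
Notation J := (power_law p).
Notation spin := (spin R).
Notation energy := (energy p).
Notation field := (field p).
Notation gibbs := (gibbs p beta).
Notation weight := (weight p beta).
Implicit Types (F G : Omega -> R) (w x y : Omega) (a d : nat -> R).

(** The field of all the other sites on [k]. *)
Definition site_field k x : R := \sum_(j < k) J j k * spin (x j) + field k x.

Lemma energy_flip n k x : (k < n)%N ->
  energy n (set_spin k true x) - energy n (set_spin k false x) = 2 * site_field k x.
Proof.
move=> kn; rewrite /energy -sumrB.
have E (a : 'I_n) :
    spin (set_spin k true x a) * field a (set_spin k true x)
      - spin (set_spin k false x a) * field a (set_spin k false x)
    = (if (a < k)%N then 2 * (J a k * spin (x a)) else 0) +
      (if a == Ordinal kn then 2 * field k x else 0).
  have [ak|ka] := ltnP a k.
    have -> : (a == Ordinal kn) = false by apply/negP => /eqP e; move: ak; rewrite e /= ltnn.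
    by rewrite !field_flip // /set_spin ltn_eqF // /Defs.spin; ring.
  rewrite !field_past // add0r; have [-> /=|] := eqVneq a (Ordinal kn).
    by rewrite /set_spin eqxx /Defs.spin; ring.
  move=> /eqP ne; rewrite /set_spin; case: eqP => [e|_]; last by rewrite subrr.
  by case: ne; exact/val_inj.
rewrite (eq_bigr _ (fun i _ => E i)) big_split /= /site_field mulrDr; congr (_ + _).
  rewrite -big_mkcond /= (big_ord_widen_cond n xpredT (fun j => J j k * spin (x j))) ?(ltnW kn) //.
  by rewrite mulr_sumr.
by rewrite -big_mkcond big_pred1_eq.
Qed.

Lemma site_field_flip k j b x : j != k ->
  `|site_field k (set_spin j b x) - site_field k x| <= 2 * J k j.
Proof.
move=> jk; have sp : `|spin b - spin (x j)| <= 2.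
  by apply: le_trans (ler_normB _ _) _; rewrite !spin_norm; lra.
rewrite /site_field; move: jk; rewrite neq_ltn => /orP[jk|kj].
  rewrite field_past ?(ltnW jk) // opprD addrACA subrr addr0 -sumrB (bigD1 (Ordinal jk)) //= big1 ?addr0.
    rewrite /set_spin eqxx -mulrBr normrM ger0_norm ?power_law_ge0 // power_lawC.
    by rewrite mulrC ler_wpM2r // power_law_ge0.
  move=> i /eqP ne; rewrite /set_spin; case: eqP => [e|_]; last by rewrite subrr.
  by case: ne; exact/val_inj.
rewrite field_flip //.
rewrite (eq_bigr (fun i : 'I_k => J i k * spin (x i))) => [|i _]; last first.
  by rewrite /set_spin ltn_eqF // (ltn_trans (ltn_ord i)).
rewrite [X in `|X|](_ : _ = J k j * (spin b - spin (x j))); last by ring.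
by rewrite normrM ger0_norm ?power_law_ge0 // mulrC ler_wpM2r // power_law_ge0.
Qed.

Lemma site_field_agree n k x y : (k < n)%N -> agree_upto n x y ->
  `|site_field k x - site_field k y| <= 2 * tail p (n - k).
Proof.
move=> kn xy; rewrite /site_field.
rewrite (eq_bigr (fun i : 'I_k => J i k * spin (y i))) => [|i _]; last first.
  by rewrite xy // (ltn_trans (ltn_ord i)).
by rewrite opprD addrACA subrr add0r; apply: field_diff => // b /andP[_]; exact: xy.
Qed.

Lemma site_field_own k b x : site_field k (set_spin k b x) = site_field k x.
Proof.
rewrite /site_field field_past //; congr (_ + _); apply: eq_bigr => i _.
by rewrite /set_spin ltn_eqF.
Qed.

Definition logistic (z : R) := (1 + expR (- z))^-1.

Lemma logistic01 z : 0 <= logistic z <= 1.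
Proof.
have e0 := expR_gt0 (- z); rewrite /logistic; apply/andP; split.
  by rewrite invr_ge0; lra.
by rewrite invf_le1; lra.
Qed.

Lemma logistic_lip z t : logistic z - logistic t <= `|z - t|.
Proof.
have e0 := expR_gt0 (- z); have f0 := expR_gt0 (- t).
have [zt|tz] := leP z t.
  apply: le_trans (normr_ge0 _); rewrite subr_le0 /logistic lef_pV2 ?posrE; try lra.
  by rewrite lerD2l ler_expR; lra.
rewrite ger0_norm; last lra.
have h := expR_ge1Dx (- (z - t)).
have ez : expR (- z) = expR (- (z - t)) * expR (- t) by rewrite -expRD; congr expR; ring.
rewrite /logistic -subr_ge0.
have -> : z - t - ((1 + expR (- z))^-1 - (1 + expR (- t))^-1) =
   (z - t) - (expR (- t) - expR (- z)) / ((1 + expR (- z)) * (1 + expR (- t))).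
  by field; rewrite !gt_eqF //; lra.
rewrite subr_ge0 ler_pdivrMr; last by rewrite mulr_gt0 //; lra.
rewrite ez.
set u := expR (- (z - t)) in h ez *; set v := expR (- t) in f0 ez *.
have u0 : 0 < u by exact: expR_gt0.
apply: le_trans (_ : (z - t) * v <= _).
  rewrite -subr_ge0 (_ : _ - _ = (z - t - 1 + u) * v); last by ring.
  by apply: mulr_ge0; lra.
apply: ler_wpM2l; first lra.
have uv : 0 <= u * v by apply: mulr_ge0 => //; exact: ltW.
have uvv : 0 <= u * v * v by apply: mulr_ge0 => //; exact: ltW.
rewrite -subr_ge0 (_ : _ - _ = 1 + u * v + u * v * v); last by ring.
lra.
Qed.

Definition heat_prob k x : R := logistic (2 * beta * site_field k x).
(** Resampling of the spin at [k] given all the other ones. *)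
Definition heat_bath k F x : R :=
  heat_prob k x * F (set_spin k true x) + (1 - heat_prob k x) * F (set_spin k false x).

Lemma set_spinK k b c x : set_spin k b (set_spin k c x) = set_spin k b x.
Proof. by apply/funext => j; rewrite /set_spin; case: eqP. Qed.

Lemma set_spin_id k x : set_spin k (x k) x = x.
Proof. by apply/funext => j; rewrite /set_spin; case: eqP => [->|]. Qed.

Lemma heat_prob_own k b x : heat_prob k (set_spin k b x) = heat_prob k x.
Proof. by rewrite /heat_prob site_field_own. Qed.

Lemma heat_prob_balance n k x : (k < n)%N ->
  heat_prob k x * (weight n (set_spin k true x) + weight n (set_spin k false x))
  = weight n (set_spin k true x).
Proof.
move=> kn; have e := energy_flip x kn.
rewrite /heat_prob /logistic.
have -> : weight n (set_spin k false x) =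
    expR (- (2 * beta * site_field k x)) * weight n (set_spin k true x).
  by rewrite /weight -expRD -mulrA mulrCA -e; congr expR; ring.
have w0 := expR_gt0 (- (2 * beta * site_field k x)).
by field; rewrite gt_eqF //; lra.
Qed.

Lemma sum_conf_flip n k F w : (k < n)%N ->
  sum_conf n F w = sum_conf n (fun x => F (set_spin k (~~ x k) x)) w.
Proof.
move=> kn.
pose fl (s : {ffun 'I_n -> bool}) : {ffun 'I_n -> bool} :=
  [ffun i => if i == Ordinal kn then ~~ s i else s i].
have flK : involutive fl.
  by move=> s; apply/ffunP => i; rewrite !ffunE; case: eqP => // _; rewrite negbK.
rewrite /sum_conf (reindex_inj (inv_inj flK)) /=; apply: eq_bigr => s _; congr F.
apply/funext => j; have [jn|nj] := ltnP j n; last first.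
  by rewrite /set_spin gtn_eqF ?(leq_trans kn) // !concat_ge.
rewrite /set_spin !concat_lt ffunE; case: eqP => [/(congr1 val) /= e|ne].
  by rewrite ifT; [congr (~~ s _); exact/val_inj|exact/eqP].
by case: eqP => [e|//]; case: ne; exact/val_inj.
Qed.

Lemma gibbs_heat_bath n k F w : (k < n)%N -> gibbs n (heat_bath k F) w = gibbs n F w.
Proof.
move=> kn; rewrite /gibbs; congr (_ / _).
have sym G : 2 * sum_conf n G w =
    sum_conf n (fun x => G (set_spin k true x) + G (set_spin k false x)) w.
  rewrite mulr_natl mulr2n {2}(sum_conf_flip G w kn) /sum_conf -big_split /=.
  apply: eq_bigr => s _; set x := concat s w.
  rewrite -{1}(set_spin_id k x); case: (x k) => //=; by rewrite addrC.
apply: (@mulfI _ 2); first by [].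
rewrite !sym; apply: eq_bigr => s _; set x := concat s w.
rewrite /heat_bath !heat_prob_own !set_spinK.
have := heat_prob_balance x kn.
set W1 := weight n _; set W2 := weight n _; set q := heat_prob k x => h.
have h2 : (1 - q) * (W1 + W2) = W2 by rewrite mulrBl h; ring.
rewrite -[in RHS]h -[X in _ = _ + X * _]h2; ring.
Qed.

Definition local_fun n F := forall x y, agree_upto n x y -> F x = F y.
Definition varies_by n F d := forall k b x, (k < n)%N -> `|F (set_spin k b x) - F x| <= d k.

(** The vector [a] bounds the influence of the exteriors on a local function in
terms of its variations [d] in each coordinate. *)
Definition estimate n w w' a := forall F d, local_fun n F ->
  (forall k, 0 <= d k) -> varies_by n F d ->
  gibbs n F w - gibbs n F w' <= \sum_(k < n) a k * d k.

(** The coordinates are changed one after the other. *)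
Lemma local_osc n F d : local_fun n F -> varies_by n F d ->
  osc_le F (\sum_(k < n) d k).
Proof.
move=> lF vF x y; pose z i : Omega := fun k => if (k < i)%N then y k else x k.
have h i : (i <= n)%N -> F x - F (z i) <= \sum_(k < i) d k.
  elim: i => [|i IH] i_n; first by rewrite big_ord0 (_ : z 0 = x) ?subrr //; apply/funext.
  rewrite big_ord_recr /=.
  have -> : z i.+1 = set_spin i (y i) (z i).
    apply/funext => k; rewrite /z /set_spin ltnS leq_eqVlt.
    by case: eqP => [->|].
  have := vF i (y i) (z i) i_n; rewrite distrC => /(le_trans (ler_norm _)).
  by have := IH (ltnW i_n); lra.
rewrite (_ : F y = F (z n)); first exact: h.
by apply: lF => k kn; rewrite /z kn.
Qed.

Lemma estimate1 n w w' : estimate n w w' (fun=> 1).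
Proof.
move=> F d lF _ vF; under eq_bigr do rewrite mul1r.
by apply: gibbs_osc; exact: local_osc.
Qed.

Lemma estimateW n w w' a a' : (forall k, (k < n)%N -> a k <= a' k) ->
  estimate n w w' a -> estimate n w w' a'.
Proof.
move=> aa' h F d lF d0 vF; apply: le_trans (h F d lF d0 vF) _.
by apply: ler_sum => k _; apply: ler_wpM2r => //; exact: aa'.
Qed.

Definition glue n x w : Omega := fun k => if (k < n)%N then x k else w k.

Lemma heat_prob_diff k x y : heat_prob k x - heat_prob k y <= 2 * beta * `|site_field k x - site_field k y|.
Proof.
apply: le_trans (logistic_lip _ _) _; rewrite -mulrBr normrM ger0_norm // mulr_ge0 //.
exact: ltW.
Qed.

Lemma heat_prob_dist k x y : `|heat_prob k x - heat_prob k y| <= 2 * beta * `|site_field k x - site_field k y|.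
Proof.
rewrite ler_norml heat_prob_diff andbT lerNl opprB.
by apply: le_trans (heat_prob_diff _ _ _) _; rewrite distrC.
Qed.

Definition influence k j : R := 4 * beta * J k j.

(** Resampling the spin at [k] preserves both Gibbs measures, up to the
dependence of the resampling on the exterior.  It removes the variation of the
function at [k] and distributes it to the other sites in proportion to their
influence on [k]. *)
Lemma estimate_update n w w' a k : (k < n)%N -> (forall j, 0 <= a j) ->
  estimate n w w' a ->
  estimate n w w' (fun j => if j == k then
     \sum_(i < n | i != k :> nat) a i * influence k i + 4 * beta * tail p (n - k)
   else a j).
Proof.
move=> kn a0 est F d lF d0 vF.
(* The exterior v is built into T, so that T v is a local function, to which the
   estimate applies. *)
pose T v x := heat_bath k F (glue n x v).
have gT v : gibbs n (T v) v = gibbs n F v.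
  rewrite -(gibbs_heat_bath F v kn) /gibbs; congr (_ / _); apply: eq_bigr => s _; congr (_ * _).
  rewrite /T; congr heat_bath; apply/funext => j; rewrite /glue; case: ltnP => // nj.
  by rewrite concat_ge.
have lT v : local_fun n (T v).
  move=> x y xy; rewrite /T; congr heat_bath; apply/funext => j; rewrite /glue.
  by case: ifP => // /xy.
have Fd x : `|F (set_spin k true x) - F (set_spin k false x)| <= d k.
  by rewrite -(set_spinK k true false x); exact: vF.
pose d' j := if j == k then 0 else d j + influence k j * d k.
have inf0 j : 0 <= influence k j.
  rewrite /influence; apply: mulr_ge0; last exact: power_law_ge0.
  by rewrite mulr_ge0 // ltW.
have d'0 j : 0 <= d' j by rewrite /d'; case: eqP => // _; rewrite addr_ge0 // mulr_ge0.
have vT : varies_by n (T w) d'.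
  move=> j b x jn; rewrite /T /d'.
  have -> : glue n (set_spin j b x) w = set_spin j b (glue n x w).
    by apply/funext => i; rewrite /glue /set_spin; case: eqP => // ->; rewrite jn.
  set z := glue n x w; case: eqP => [->|/eqP jk].
    by rewrite /heat_bath !set_spinK heat_prob_own subrr normr0.
  rewrite /heat_bath.
  have comm c : set_spin k c (set_spin j b z) = set_spin j b (set_spin k c z).
    apply/funext => i; rewrite /set_spin; case: eqP => // ->.
    by rewrite eq_sym (negPf jk).
  have h1 := vF j b (set_spin k true z) jn; have h2 := vF j b (set_spin k false z) jn.
  have := heat_prob_dist k (set_spin j b z) z; rewrite !comm.
  have hs := site_field_flip b z jk.
  have [q0 q1] : 0 <= heat_prob k (set_spin j b z) /\ heat_prob k (set_spin j b z) <= 1.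
    by have /andP[] := logistic01 (2 * beta * site_field k (set_spin j b z)).
  move: h1 h2 q0 q1 (Fd z) hs.
  set q' := heat_prob k (set_spin j b z); set q := heat_prob k z.
  set A' := F (set_spin j b (set_spin k true z)); set A := F (set_spin k true z).
  set B' := F (set_spin j b (set_spin k false z)); set B := F (set_spin k false z).
  move=> h1 h2 q0 q1 AB hs hq.
  have -> : q' * A' + (1 - q') * B' - (q * A + (1 - q) * B) =
     q' * (A' - A) + (1 - q') * (B' - B) + (q' - q) * (A - B) by ring.
  apply: le_trans (ler_normD _ _) _; apply: lerD.
    have q1' : 0 <= 1 - q' by lra.
    apply: le_trans (ler_normD _ _) _; rewrite !normrM (ger0_norm q0) (ger0_norm q1').
    have g1 := ler_wpM2l q0 h1.
    have g2 := ler_wpM2l q1' h2.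
    have -> : d j = q' * d j + (1 - q') * d j by ring.
    exact: lerD.
  rewrite normrM; apply: ler_pM => //; apply: le_trans hq _.
  rewrite /influence (_ : 4 * beta * J k j = 2 * beta * (2 * J k j)); last by ring.
  by apply: ler_wpM2l => //; rewrite mulr_ge0 // ltW.
have := est _ _ (lT w) d'0 vT; rewrite gT.
have e2 : gibbs n (T w) w' - gibbs n F w' <= 4 * beta * tail p (n - k) * d k.
  rewrite -(gT w'); apply: le_trans (ler_norm _) _; apply: gibbs_close => x.
  rewrite /T /heat_bath.
  have same c : F (set_spin k c (glue n x w)) = F (set_spin k c (glue n x w')).
    by apply: lF => i i_n; rewrite /set_spin /glue i_n.
  rewrite !same; set z := glue n x w'; set z' := glue n x w.
  set A := F (set_spin k true z); set B := F (set_spin k false z).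
  rewrite (_ : _ - _ = (heat_prob k z' - heat_prob k z) * (A - B)); last by ring.
  rewrite normrM; apply: ler_pM => //; last exact: Fd.
  apply: le_trans (heat_prob_dist _ _ _) _.
  rewrite (_ : 4 * beta * tail p (n - k) = 2 * beta * (2 * tail p (n - k))); last by ring.
  apply: ler_wpM2l; first by rewrite mulr_ge0 // ltW.
  by apply: site_field_agree => // i i_n; rewrite /z /z' /glue i_n.
move=> e1; have -> : \sum_(j < n) (if j == k :> nat then
     \sum_(i < n | i != k :> nat) a i * influence k i + 4 * beta * tail p (n - k)
   else a j) * d j = \sum_(j < n) a j * d' j + 4 * beta * tail p (n - k) * d k.
  have dk : d' k = 0 by rewrite /d' eqxx.
  rewrite (bigD1 (Ordinal kn)) //= eqxx [X in _ = X + _](bigD1 (Ordinal kn)) //=.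
  rewrite dk mulr0 add0r mulrDl addrAC; congr (_ + _).
  rewrite mulr_suml -big_split /=; apply: eq_bigr => i ik.
  rewrite /d' (negPf (ik : i != k :> nat)); ring.
lra.
Qed.

End Dobrushin.

(** * Uniqueness at high temperature *)

Section SmallBeta.
Variables (R : realType) (p beta : R).
Hypotheses (p1 : 1 < p) (beta0 : 0 < beta) (small : 32 * beta * tail p 1 <= 1).
Notation J := (power_law p).
Notation gibbs := (gibbs p beta).
Notation estimate := (estimate p beta).
Implicit Types (w : Omega) (n m t L k : nat).

Definition profile (r : R) m : nat -> R := fun k => if (k < m)%N then r else 1.

(** Sites at distance at least [L] from [k], including the exterior, have a
small total influence; the sensitivity at the other ones is at most [r]. *)
Lemma influence_sum_le n m L k a (r : R) : (k < m)%N -> (m + L <= n)%N -> (0 < L)%N ->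
  0 <= r -> (forall j, 0 <= a j <= 1) -> (forall j, (j < m + L)%N -> a j <= r) ->
  \sum_(i < n | i != k :> nat) a i * influence p beta k i + 4 * beta * tail p (n - k)
  <= 8 * beta * tail p 1 * r + 8 * beta * tail p L.
Proof.
move=> km mn L0 r0 a01 ar.
have J0 i : 0 <= influence p beta k i.
  by rewrite /influence; apply: mulr_ge0; [rewrite mulr_ge0 // ltW|exact: power_law_ge0].
have b4 : 0 <= 4 * beta by rewrite mulr_ge0 // ltW.
have step : \sum_(i < n | i != k :> nat) a i * influence p beta k i <=
    r * (4 * beta * (2 * tail p 1)) + 4 * beta * tail p L.
  apply: le_trans (_ : \sum_(0 <= i < n | i != k)
     (r * influence p beta k i + (if (m + L <= i)%N then influence p beta k i else 0)) <= _).
    rewrite big_mkord; apply: ler_sum => i _.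
    case: (leqP (m + L) i) => h.
      rewrite -[leLHS]add0r; apply: lerD; first exact: mulr_ge0.
      by rewrite ler_piMl //; case/andP: (a01 i).
    by rewrite addr0 ler_wpM2r // ar.
  rewrite big_split /=; apply: lerD.
    rewrite -mulr_sumr; apply: ler_wpM2l => //; rewrite /influence -mulr_sumr.
    by apply: ler_wpM2l => //; exact: row_sum_le.
  apply: le_trans (_ : \sum_(m + L <= i < n) influence p beta k i <= _).
    rewrite (big_cat_nat (leq0n (m + L)) mn) /= [X in X + _]big_nat_cond big1 ?add0r.
      rewrite big_mkcond; rewrite !big_nat; apply: ler_sum => i /andP[-> _].
      by case: ifP => // _; exact: J0.
    by move=> i /andP[/andP[_ h] _]; rewrite leqNgt h.
  rewrite /influence -mulr_sumr; apply: ler_wpM2l => //.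
  have kmL : (k < m + L)%N by exact: leq_trans km (leq_addr _ _).
  rewrite sum_power_law //; apply: le_trans (zsum_le_tail _ p1 _) _; first by rewrite subn_gt0.
  by apply: tail_le => //; rewrite leq_subRL ?(ltnW kmL) // leq_add2r ltnW.
have tn : tail p (n - k) <= tail p L.
  apply: tail_le => //; rewrite leq_subRL; first by apply: leq_trans mn; rewrite leq_add2r ltnW.
  by rewrite ltnW // (leq_trans km) // (leq_trans _ mn) // leq_addr.
have := ler_wpM2l b4 tn; lra.
Qed.

(** All the sites on the right of [m] are updated in turn.  The constant 32
leaves a factor 1/4 for the main part, and [L] is chosen so that the remainder
is at most [r / 4] as well. *)
Lemma estimate_halve (r : R) : 0 < r <= 1 -> exists L, forall m n w w', (m + L <= n)%N ->
  estimate n w w' (profile r (m + L)) -> estimate n w w' (profile (r / 2) m).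
Proof.
move=> /andP[r0 r1]; have b8 : 0 < 8 * beta by rewrite mulr_gt0.
have [L [L0 hL]] := tail_small p1 (divr_gt0 (divr_gt0 r0 (ltr0Sn _ 3)) b8).
exists L => m n w w' mn est.
have tL : 8 * beta * tail p L <= r / 4.
  have := hL L (leqnn L); rewrite ler_pdivlMr //; lra.
have t1 : 8 * beta * tail p 1 * r <= r / 4.
  have : 0 <= (1 - 32 * beta * tail p 1) * r by rewrite mulr_ge0 ?(ltW r0) // subr_ge0.
  lra.
suff key q : (q <= m)%N -> estimate n w w'
    (fun j => if (j < q)%N then r / 2 else profile r (m + L) j).
  apply: estimateW (key m (leqnn m)) => k _; rewrite /profile; case: ifP => // _.
  by case: ifP.
elim: q => [|q IH] qm; first exact: est.
have pr01 j : 0 <= (if (j < q)%N then r / 2 else profile r (m + L) j) <= 1.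
  by rewrite /profile; case: ifP => _; [|case: ifP => _]; apply/andP; split; lra.
have prr j : (j < m + L)%N -> (if (j < q)%N then r / 2 else profile r (m + L) j) <= r.
  by move=> jm; rewrite /profile jm; case: ifP => _; lra.
have qn : (q < n)%N by apply: leq_trans qm _; apply: leq_trans mn; exact: leq_addr.
have a0 j : 0 <= (if (j < q)%N then r / 2 else profile r (m + L) j) by case/andP: (pr01 j).
have := estimate_update p1 beta0 qn a0 (IH (ltnW qm)).
apply: estimateW => j _; case: eqP => [->|/eqP jq].
  rewrite ltnSn; apply: le_trans (influence_sum_le qm mn L0 (ltW r0) pr01 prr) _; lra.
by rewrite ltnS [(j <= q)%N]leq_eqVlt (negPf jq).
Qed.

Lemma estimate_iter t : exists M, forall m n w w', (m + M <= n)%N ->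
  estimate n w w' (profile (2^-1 ^+ t) m).
Proof.
elim: t => [|t [M IH]].
  exists 0%N => m n w w' _; apply: estimateW (@estimate1 _ _ _ _ _ _) => k _.
  by rewrite expr0 /profile; case: ifP.
have h01 : 0 < (2^-1 : R) ^+ t <= 1.
  by rewrite exprn_gt0 ?invr_gt0 //= exprn_ile1 // ?invr_ge0 //; lra.
have [L hL] := estimate_halve h01.
exists (L + M)%N => m n w w' mn; rewrite exprSr; apply: hL.
  by apply: leq_trans mn; rewrite addnA leq_addr.
by apply: IH; rewrite -addnA.
Qed.

Lemma unique_if_small_beta : exactly_one_law (consistent (ising_lss (power_law p) beta)).
Proof.
apply: exactly_one_of_osc => // l e e0.
(* The event only depends on the m rightmost sites; each of them may contribute
   e / m to the oscillation. *)
pose m := (\max_(q <- l) q.1).+1.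
have m0 : 0 < m%:R :> R by rewrite ltr0n.
have q01 : 0 <= (2^-1 : R) < 1 by apply/andP; split; lra.
have [t ht] := exists_expr_le q01 (divr_gt0 e0 m0).
have [M hM] := estimate_iter t.
exists (m + M)%N => w w'.
have lF n : (m <= n)%N -> local_fun n (\1_(box l) : Omega -> R).
  move=> mn x y xy; rewrite !indicE (_ : (x \in box l) = (y \in box l)) //.
  have hq q : q \in l -> x q.1 = y q.1.
    by move=> ql; apply: xy; apply: leq_trans mn; rewrite ltnS (leq_bigmax_seq _ ql).
  apply/idP/idP; rewrite !inE /box /= => /allP h; apply/allP => q ql.
    by rewrite -(hq q ql); exact: h.
  by rewrite (hq q ql); exact: h.
have mM : (m <= m + M)%N by exact: leq_addr.
have vF : varies_by (m + M) (\1_(box l) : Omega -> R) (fun k => (k < m)%:R).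
  move=> k b x kn; have [km|mk] := ltnP k m.
    by rewrite ler_norml lerNl opprB !indic_osc.
  rewrite (lF m (leqnn m) (set_spin k b x) x) ?subrr ?normr0 // => j jm.
  by rewrite /set_spin ltn_eqF // (leq_trans jm).
have est := hM m _ w w' (leqnn (m + M)).
apply: le_trans (est _ _ (lF _ mM) (fun k => ler0n _ _) vF) _.
apply: le_trans (_ : \sum_(k < m) (e / m%:R) <= _); last first.
  by rewrite sumr_const card_ord -[leLHS]mulr_natr divfK // gt_eqF.
rewrite big_split_ord /= [X in _ + X]big1 ?addr0 => [|k _]; last by rewrite ltnNge leq_addr mulr0.
by apply: ler_sum => k _; rewrite /profile ltn_ord mulr1.
Qed.

End SmallBeta.

(** * Phase transition at low temperature *)

Section PhaseTransition.
Variables (R : realType) (p beta : R).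
Hypotheses (p1 : 1 < p) (beta0 : 0 < beta).
Notation J := (power_law p).
Notation spin := (spin R).
Notation gibbs := (gibbs p beta).
Implicit Types (x w : Omega) (n a : nat).

Definition plus : Omega := fun=> true.
(** The field at [a] of the exterior of the [n] rightmost sites when all its
spins are +. *)
Definition outer_field n a : R := field p a plus - field_upto p a n plus.

Lemma field_split n a x : (a < n)%N -> agree_from n x plus ->
  field p a x = field_upto p a n x + outer_field n a.
Proof.
move=> an xp; suff e : field p a x - field p a plus = field_upto p a n x - field_upto p a n plus.
  by rewrite /outer_field; lra.
have c : field_upto p a M x - field_upto p a M plus @[M --> \oo] --> field p a x - field p a plus.
  by apply: cvgB; exact: field_cvg.
rewrite -(cvg_lim (@Rhausdorff R) c); apply: cvg_lim => //.
apply: cvg_near_cst; exists n => // M /= nM.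
rewrite /field_upto !(big_cat_nat an nM) /=.
rewrite [X in _ + X - _](_ : _ = \sum_(n <= b < M) J a b * spin (plus b)); last first.
  by apply: eq_big_nat => b /andP[nb _]; rewrite xp.
by rewrite opprD addrACA subrr addr0.
Qed.

(** The [n] sites coded by [n], ..., [2 n - 1] suffice. *)
Lemma outer_field_ge n a : (a < n)%N -> n%:R * (2 * n)%:R `^ (- p) <= outer_field n a.
Proof.
move=> an; rewrite /outer_field lerBrDr; apply: limr_ge; first exact: is_cvg_field.
exists (2 * n)%N => // M /= nM.
have n2n : (n <= 2 * n)%N by rewrite leq_pmull.
rewrite /field_upto (big_cat_nat an (leq_trans n2n nM)) /= [leRHS]addrC lerD2r.
rewrite (big_cat_nat n2n nM) /=.
apply: le_trans (_ : \sum_(n <= b < 2 * n) J a b * 1 <= _); last first.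
  rewrite lerDl; apply: sumr_ge0 => b _; rewrite mulr1; exact: power_law_ge0.
apply: le_trans (_ : \sum_(n <= b < 2 * n) (2 * n)%:R `^ (- p) <= _).
  by rewrite sumr_const_nat mul2n -addnn addnK mulr_natl.
rewrite !big_nat; apply: ler_sum => b /andP[nb bn]; rewrite mulr1.
apply: le_power_law; first exact: ltW (lt_trans ltr01 p1).
- by rewrite neq_ltn (leq_trans an).
- by rewrite (leq_trans (ltnW an)) // (leq_trans nb) // leq_addr.
- by rewrite (leq_trans (ltnW bn)) // leq_addl.
Qed.

(** With + spins outside, the Gibbs measure is a ferromagnet in the external
fields [beta * outer_field n u]. *)
Lemma gibbs_wmean n (n0 : (0 < n)%N) :
  gibbs n (fun x => spin (x 0)) plus =
  wmean (fun s => inner (fun q : 'I_n * 'I_n => beta * J q.1 q.2) (block n (Ordinal n0) n) s *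
      expR (\sum_(u < n) (beta * outer_field n u) * spin_prod R [:: u] s)) (spin_prod R [:: Ordinal n0]).
Proof.
have val_concat (s : {ffun 'I_n -> bool}) (u : 'I_n) : concat s plus u = s u.
  by rewrite concat_lt; congr (s _); exact/val_inj.
have W (s : {ffun 'I_n -> bool}) : weight p beta n (concat s plus) =
   inner (fun q : 'I_n * 'I_n => beta * J q.1 q.2) (block n (Ordinal n0) n) s *
      expR (\sum_(u < n) (beta * outer_field n u) * spin_prod R [:: u] s).
  rewrite /weight /inner -expRD; congr expR; rewrite /energy.
  rewrite (eq_bigr (fun u : 'I_n =>
     (\sum_(v < n | (u < v)%N) J u v * spin_prod R [:: u; v] s) +
     outer_field n u * spin_prod R [:: u] s)) => [|u _]; last first.
    rewrite (field_split (ltn_ord u)); last exact: concat_ge.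
    rewrite mulrDr /field_upto -big_nat_gt big_mkord mulr_sumr; congr (_ + _).
      apply: eq_bigr => v _; rewrite !val_concat /spin_prod !big_cons !big_nil; ring.
    by rewrite val_concat /spin_prod big_seq1 mulrC.
  rewrite big_split mulrDr /=; congr (_ + _); rewrite mulr_sumr; last first.
    by apply: eq_bigr => u _; rewrite mulrA.
  rewrite (eq_bigr (fun u : 'I_n => \sum_(v < n | (u < v)%N)
     beta * J u v * spin_prod R [:: u; v] s)) => [|u _]; last first.
    by rewrite mulr_sumr; apply: eq_bigr => v _; rewrite mulrA.
  rewrite (pair_big_dep xpredT (fun u v : 'I_n => (u < v)%N)
     (fun u v => beta * J u v * spin_prod R [:: u; v] s)) /=.
  by apply: eq_bigl => -[u v]; rewrite !inE /= !add0n !ltn_ord.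
rewrite /gibbs /wmean /partf /sum_conf; congr (_ / _); last by apply: eq_bigr => s _.
apply: eq_bigr => s _; rewrite W mulrC; congr (_ * _).
by rewrite /spin_prod big_seq1 (val_concat s (Ordinal n0)).
Qed.

(** At scale [j], the cluster of the origin has [K.-1 ^ j] sites, each of which
feels a field of order [beta * (K ^ j) `^ (1 - p)]; the product of the two is
bounded below since [K^p <= (K - 1)^2 <= K (K - 1)]. *)
Lemma plus_magnetization K j : (1 < K)%N -> 2 * K%:R `^ p <= (K.-1)%:R ^+ 2 ->
  4 * K%:R ^+ 2 * (4 * K%:R + 1) * (K%:R `^ p / beta) <= 1 ->
  2^-1 * th (beta * 2 `^ (- p)) <= gibbs (K ^ j) (fun x => spin (x 0)) plus.
Proof.
move=> K1 Kp Kb; have n0 : (0 < K ^ j)%N by rewrite expn_gt0 ltnW.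
rewrite (gibbs_wmean n0).
have J0 (q : 'I_(K ^ j) * 'I_(K ^ j)) : 0 <= beta * J q.1 q.2.
  by rewrite mulr_ge0 ?power_law_ge0 // ltW.
have pp : 0 <= p by exact: ltW (lt_trans ltr01 p1).
have Kpow0 : 0 < K%:R `^ p :> R by rewrite powR_gt0 // ltr0n ltnW.
have := @giant_cluster_level _ _ _ J0 p beta K pp K1 Kp beta0 Kb (fun u v _ => lexx _)
  j (Ordinal n0) (leqnn _).
set rho := 6 * _ * _ * _ => gc.
pose h0 : R := beta * ((K ^ j)%:R * (2 * K ^ j)%:R `^ (- p)).
have h00 : 0 <= h0 by rewrite !mulr_ge0 ?powR_ge0 // ltW.
have hh (u : 'I_(K ^ j)) : h0 <= beta * outer_field (K ^ j) u.
  by rewrite ler_pM2l // outer_field_ge.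
apply: le_trans (giant_cluster_magnetization gc h00 hh).
have t0 : 0 < K%:R `^ p / beta by rewrite divr_gt0.
have K2 : 2 <= K%:R :> R by rewrite ler_nat.
(* Since K >= 2, the condition on K^p / beta gives 72 K^(p+1) / beta <= 1. *)
have rho2 : rho <= 2^-1.
  apply: le_trans (_ : 6 * K%:R * (K%:R `^ p / beta) <= _).
    rewrite /rho ler_piMr //; first by apply: mulr_ge0; [apply: mulr_ge0|exact: ltW].
  move: Kb; set t := K%:R `^ p / beta in t0 *; set k := K%:R in K2 * => Kb'.
  have kt0 : 0 <= k * t by apply: mulr_ge0; lra.
  have kkt0 : 0 <= k * (k * t) by apply: mulr_ge0 => //; lra.
  have F1 : 0 <= (k - 2) * (k * t) by apply: mulr_ge0 => //; lra.
  have F2 : 0 <= (k - 2) * (k * (k * t)) by apply: mulr_ge0 => //; lra.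
  have E : 4 * k ^+ 2 * (4 * k + 1) * t =
      16 * ((k - 2) * (k * (k * t))) + 36 * ((k - 2) * (k * t)) + 72 * (k * t) by ring.
  by rewrite E in Kb'; lra.
have base : 0 <= beta * 2 `^ (- p) by rewrite mulr_ge0 ?powR_ge0 // ltW.
apply: ler_pM => //.
- by case/andP: (th01 base).
- by lra.
apply: le_th; rewrite /h0 -!mulrA ler_pM2l //.
rewrite [leRHS](_ : _ = 2 `^ (- p) *
   ((K ^ j)%:R * (K ^ j)%:R `^ (- p) * (K.-1 ^ j)%:R)); last first.
  by rewrite natrM powRM //; ring.
rewrite ler_peMr ?powR_ge0 //.
have -> : (K ^ j)%:R * (K ^ j)%:R `^ (- p) * (K.-1 ^ j)%:R =
    (K%:R * K%:R `^ (- p) * K.-1%:R) ^+ j :> R.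
  by rewrite !natrX powR_exprn // !exprMn.
apply: exprn_ege1; rewrite powRN mulrAC ler_pdivlMr // mul1r.
apply: le_trans (_ : K.-1%:R ^+ 2 <= _); first by lra.
by rewrite expr2 ler_wpM2r // ler_nat leq_pred.
Qed.

Definition flip_all x : Omega := fun k => ~~ x k.

Lemma spinN (b : bool) : spin (~~ b) = - spin b.
Proof. by case: b; rewrite /Defs.spin ?opprK. Qed.

Lemma energy_flip_all n x : energy p n (flip_all x) = energy p n x.
Proof.
apply: eq_bigr => a _; rewrite /flip_all spinN.
have -> : field p a (fun k => ~~ x k) = - field p a x.
  apply: cvg_lim => //; rewrite (_ : (fun M => _) = (fun M => - field_upto p a M x)).
    by apply: cvgN; exact: field_cvg.
  apply/funext => M; rewrite /field_upto -sumrN; apply: eq_bigr => b _.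
  by rewrite spinN mulrN.
by rewrite mulrNN.
Qed.

Lemma sum_conf_flip_all n F w :
  sum_conf n F (flip_all w) = sum_conf n (fun x => F (flip_all x)) w :> R.
Proof.
pose fl (s : {ffun 'I_n -> bool}) : {ffun 'I_n -> bool} := [ffun i => ~~ s i].
have flK : involutive fl by move=> s; apply/ffunP => i; rewrite !ffunE negbK.
rewrite /sum_conf (reindex_inj (inv_inj flK)) /=; apply: eq_bigr => s _; congr F.
apply/funext => k; rewrite /flip_all; have [kn|nk] := ltnP k n.
  by rewrite !concat_lt ffunE.
by rewrite !concat_ge.
Qed.

Lemma gibbs_flip_all n F w : gibbs n F (flip_all w) = gibbs n (fun x => F (flip_all x)) w.
Proof.
rewrite /gibbs /partf !sum_conf_flip_all; congr (_ / _); apply: eq_bigr => s _;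
  by rewrite /weight energy_flip_all.
Qed.

(** The limit with exterior + favours a + spin at the origin; by the symmetry
under a global flip, the limit with exterior - favours a - spin. *)
Lemma more_than_one_of_magnetization c (N : nat -> nat) : 0 < c -> (forall j, (j <= N j)%N) ->
  (forall j, c <= gibbs (N j) (fun x => spin (x 0)) plus) ->
  more_than_one_law (consistent (ising_lss (power_law p) beta)).
Proof.
move=> c0 leN mag; pose A := box [:: (0%N, true)].
have mA : measurable A by exact: box_measurable.
have spinE x : spin (x 0%N) = 2 * \1_A x + -1.
  rewrite indicE /A; case x0 : (x 0%N).
    by rewrite mem_set /box /= ?x0 //; ring.
  by rewrite memNset /box /= ?x0 //; ring.
have tA : tame (\1_A : Omega -> R) by exact: tame_indic.
have gamA n w : gibbs n (fun x => spin (x 0%N)) w = 2 * gibbs n (\1_A) w + -1.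
  rewrite (_ : (fun x => _) = fun x => 2 * \1_A x + -1); last exact/funext.
  by rewrite gibbsD gibbsZ [X in _ + X]gibbs_id.
have [mu cmu hmu] := gibbs_limit plus p1 beta0 leN.
have [nu cnu hnu] := gibbs_limit (flip_all plus) p1 beta0 leN.
have qA := quasi_local_indic R [:: (0%N, true)].
have h1 : (1 + c) / 2 <= expect mu (\1_A).
  by apply: hmu => // j; have := mag j; rewrite gamA; lra.
have h2 : (c - 1) / 2 <= expect nu (fun x => -1 * \1_A x).
  apply: hnu => [|j].
    split; first by exists 1 => x; rewrite indicE; case: (_ \in _); rewrite ?mulr1 ?mulr0 ?normrN ?normr1 ?normr0.
    move=> e e0; have [M hM] := qA.2 e e0; exists M => x y xy.
    by rewrite -mulrBr mulN1r normrN; exact: hM.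
  rewrite gibbs_flip_all (_ : (fun x => _) = fun x => 2^-1 * spin (x 0%N) + - 2^-1).
    by rewrite gibbsD gibbsZ [X in _ <= _ + X]gibbs_id //; have := mag j; lra.
  apply/funext => x; have := spinE (flip_all x); rewrite /flip_all spinN => h; lra.
exists mu, nu; split => // same.
have : expect mu (\1_A) = expect nu (\1_A).
  apply: EFin_inj; apply: (etrans (expect_indic mu mA) (etrans _ (esym (expect_indic nu mA)))).
  exact: same.
by rewrite expectZ // in h2; lra.
Qed.

End PhaseTransition.

(** As [(K - 1)^2 >= K^2 / 4] for [K >= 2], it is enough that [K^(2-p) >= 8]. *)
Lemma large_scale_ex (R : realType) (p : R) : 1 < p -> p < 2 ->
  exists2 K, (1 < K)%N & 2 * K%:R `^ p <= (K.-1)%:R ^+ 2.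
Proof.
move=> p1 p2; pose a : R := 8 `^ (2 - p)^-1.
have a0 : 0 <= a by exact: powR_ge0.
pose K := (Num.truncn a).+2; exists K => //.
have aK : a <= K%:R.
  by have /andP[_] := truncn_itv a0; rewrite /K -natr1 => h; lra.
have K2 : 2 <= K%:R :> R by rewrite ler_nat.
have d0 : 0 < 2 - p by lra.
have h8 : 8 <= K%:R `^ (2 - p).
  have -> : (8 : R) = a `^ (2 - p) by rewrite /a -powRrM mulVf ?powRr1 // gt_eqF.
  by apply: ge0_ler_powR; rewrite ?nnegrE ?ler0n // ltW.
have Kp : K%:R `^ p * K%:R `^ (2 - p) = K%:R ^+ 2 :> R.
  rewrite -powRD; last by rewrite pnatr_eq0 implybT.
  by rewrite (_ : p + (2 - p) = 2%:R) ?powR_mulrn ?ler0n //; ring.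
have P0 : 0 <= K%:R `^ p :> R by exact: powR_ge0.
have h : 8 * K%:R `^ p <= K%:R ^+ 2 :> R by rewrite -Kp mulrC ler_wpM2l.
have -> : K.-1%:R = K%:R - 1 :> R by rewrite /K -[in RHS]natr1 addrK.
have : 0 <= (K%:R - 2) * (3 * K%:R - 2) :> R by apply: mulr_ge0; lra.
have E : (K%:R - 2) * (3 * K%:R - 2) = 4 * (K%:R - 1) ^+ 2 - K%:R ^+ 2 :> R by ring.
by rewrite E; lra.
Qed.

Theorem proposition1 (R : realType) (p : R) :
  (summable_couplings (power_law p) <-> 1 < p) /\
  (1 < p ->
    [/\ (exists beta0 : R, 0 < beta0 /\
           forall beta : R, 0 < beta -> beta < beta0 ->
             exactly_one_law (consistent (ising_lss (power_law p) beta))),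
        (2 < p ->
           forall beta : R, 0 < beta ->
             exactly_one_law (consistent (ising_lss (power_law p) beta)))
      & (p < 2 ->
           exists beta0 : R, 0 < beta0 /\
             forall beta : R, beta0 < beta ->
               more_than_one_law (consistent (ising_lss (power_law p) beta)))]).
Proof.
split; first exact: summable_power_law.
move=> p1; split.
- have t0 : 0 <= tail p 1 by exact: tail_ge0.
  exists (32 * (tail p 1 + 1))^-1; split; first by rewrite invr_gt0; lra.
  move=> beta b0 bb; apply: unique_if_small_beta => //.
  have d0 : 0 < 32 * (tail p 1 + 1) by lra.
  move: bb; rewrite -[X in _ < X]mul1r ltr_pdivlMr // => h.
  have := mulr_ge0 (ltW b0) t0; lra.
- move=> p2 beta b0; have [C hC] := sum_tail_bounded p2.
  exact: (unique_if_boundary_bounded p1 b0 hC).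
- move=> p2; have [K K1 Kp] := large_scale_ex p1 p2.
  have Kpow0 : 0 < K%:R `^ p :> R by rewrite powR_gt0 // ltr0n ltnW.
  have c0 : 0 < 4 * K%:R ^+ 2 * (4 * K%:R + 1) :> R.
    have k0 : 0 < K%:R :> R by rewrite ltr0n ltnW.
    by apply: mulr_gt0; [rewrite mulr_gt0 // exprn_gt0|lra].
  exists (4 * K%:R ^+ 2 * (4 * K%:R + 1) * K%:R `^ p); split; first exact: mulr_gt0.
  move=> beta hb; have b0 : 0 < beta by apply: lt_trans hb; exact: mulr_gt0.
  apply: (@more_than_one_of_magnetization _ _ _ p1 b0 (2^-1 * th (beta * 2 `^ (- p))) (expn K)).
  + by rewrite mulr_gt0 ?invr_gt0 // th_gt0 // mulr_gt0 // powR_gt0.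
  + by move=> j; rewrite ltnW // ltn_expl.
  + move=> j; apply: plus_magnetization => //.
    by rewrite mulrA ler_pdivrMr // mul1r ltW.
Qed.
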